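(* Let $\nu$ be an arbitrary partition and let $\mu$ be a partition of one of the forms $(2^{m_2},1^{m_1})$, $(r,1^{m_1})$ (for some $r\ge1$), or $(3,2)$. Then the matrix problem $\mathcal{P}_k(\mu,\nu)$ is of finite type: for every field $k$ it has finitely many orbits, and the number of orbits does not depend on $k$. In particular, $\mathcal{P}_k(\mu,\nu)$ is of finite type for every partition $\mu$ with $|\mu|<6$ and every partition $\nu$.
   Context: For partitions $\mu$ of $m$ and $\nu$ of $n$ and a field $k$, the matrix problem $\mathcal{P}_k(\mu,\nu)$ is the action of the group $C_{GL_m(k)}(J_\mu(0)) \times C_{GL_n(k)}(J_\nu(0))$ on the quotient space $Q = M_{m,n}(k)/\{wJ_\nu(0) - J_\mu(0)w : w\in M_{m,n}(k)\}$ given by $(X,Y)\cdot[v] = [XvY^{-1}]$. Here $J_r(0)$ is the $r\times r$ matrix with $1$ in each $(i+1,i)$ entry and $0$ elsewhere, and $J_\mu(0) = \bigoplus_i J_{\mu_i}(0)$. The notation $(r^{l_r},\dots,1^{l_1})$ denotes the partition in which part $j$ occurs $l_j$ times (exponents may be $0$). *)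

(* Defs.v *)
From mathcomp Require Import all_boot all_algebra.
Set Implicit Arguments. Unset Strict Implicit. Unset Printing Implicit Defensive.
Import GRing.Theory.

Definition is_partition (s : seq nat) : bool :=
  sorted geq s && all (fun x => 0 < x) s.

Section MatrixProblem.
Variable k : fieldType.
Local Open Scope ring_scope.

Definition Jblock (r : nat) : 'M[k]_r :=
  \matrix_(i < r, j < r) ((nat_of_ord i == (nat_of_ord j).+1)%:R).

Fixpoint Jpart (s : seq nat) : 'M[k]_(sumn s) :=
  match s return 'M[k]_(sumn s) with
  | [::] => 0
  | r :: s' => block_mx (Jblock r) 0 0 (Jpart s')
  end.

(* [v] and [v'] lie in the same orbit of the action
   (X,Y).[v] = [X v Y^-1] of C_{GL_m}(J_mu) x C_{GL_n}(J_nu) on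
   Q = M_{m,n}(k) / { w J_nu - J_mu w }. *)
Definition same_orbit (mu nu : seq nat)
  (v v' : 'M[k]_(sumn mu, sumn nu)) : Prop :=
  exists (X : 'M[k]_(sumn mu)) (Y : 'M[k]_(sumn nu)),
    [/\ X \in unitmx, Y \in unitmx,
        X *m Jpart mu = Jpart mu *m X,
        Y *m Jpart nu = Jpart nu *m Y &
        exists w : 'M[k]_(sumn mu, sumn nu),
          X *m v *m invmx Y - v' = w *m Jpart nu - Jpart mu *m w].

End MatrixProblem.

Definition finite_type (mu nu : seq nat) : Prop :=
  exists N : nat, forall k : fieldType,
    exists reps : 'I_N -> 'M[k]_(sumn mu, sumn nu),
      (forall v, exists i, same_orbit v (reps i)) /\
      (forall i j, same_orbit (reps i) (reps j) -> i = j).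

(* Main.v *)
(** View a matrix [v] as an extension 0 -> M_mu -> E -> M_nu -> 0 of k[t]-modules. Its orbit is
determined by the filtration of M_mu by heights, b |-> M_mu cap t^b E, up to automorphisms of M_mu.
For the partitions mu considered, M_mu always has a basis adapted to this filtration on which t
acts by one of finitely many patterns, independent of the field, and the pattern and the heights
can be read off from the filtration. The basis elements that do not inherit their height from t
applied to an element of height one less match the nonzero columns of a normal form: if g is such
an element, of height b, then in g = t^b e some generator of M_nu of order b must occur in e with
unit coefficient and can be exchanged for e. So the orbits correspond to the height configurations
whose generating elements fit injectively into the parts of nu, a condition without reference to k. *)

From HB Require Import structures.
Require Import Defs.
From mathcomp Require Import all_boot all_algebra.
From mathcomp Require Import perm boolp zify ring.
Set Implicit Arguments. Unset Strict Implicit. Unset Printing Implicit Defensive.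
Import GRing.Theory.

(** What depends on the shape of [mu] is whether every filtration by heights splits, that is, has
    coordinate subspaces of some basis as levels. For blocks of sizes 2 and 1 this amounts to a
    common basis for two filtrations of one vector space, which always exists; three filtrations
    would have none in general. For [(r, 1^m1)] a generator of greatest height of the long block is
    split off, and two filtrations remain; for [(3, 2)] a full flag of characteristic submodules
    governs everything. The operator need not be in Jordan form on the adapted basis, hence the
    patterns. The exchange argument uses only that a nonzero entry raises heights and that an
    inherited height is inherited modulo strictly higher vectors. Repeated heights are kept in
    sorted order, so that an invertible map between two adapted bases forces their configurations to
    be equal. *)

Local Notation blk := reshape_index.
Local Notation off := reshape_offset.

(** * Positions inside the blocks of a partition, and Jordan matrices *)

Section BlockIndex.

Lemma blk0 (r : nat) (s : seq nat) (i : nat) : i < r -> blk (r :: s) i = 0.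
Proof. by move=> Hi; have := @flatten_indexKl (r :: s) 0 i Hi; rewrite /flatten_index /=. Qed.

Lemma off0 (r : nat) (s : seq nat) (i : nat) : i < r -> off (r :: s) i = i.
Proof. by move=> Hi; have := @flatten_indexKr (r :: s) 0 i Hi; rewrite /flatten_index /=. Qed.

Lemma flatten_index_cons (r : nat) (s : seq nat) (j a : nat) :
  flatten_index (r :: s) j.+1 a = r + flatten_index s j a.
Proof. by rewrite /flatten_index /= addnA. Qed.

Lemma blkS (r : nat) (s : seq nat) (i : nat) :
  i < sumn s -> blk (r :: s) (r + i) = (blk s i).+1.
Proof.
move=> Hi; have Ho := reshape_offsetP Hi.
have := @flatten_indexKl (r :: s) (blk s i).+1 (off s i) Ho.
by rewrite flatten_index_cons reshape_indexK.
Qed.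

Lemma offS (r : nat) (s : seq nat) (i : nat) :
  i < sumn s -> off (r :: s) (r + i) = off s i.
Proof.
move=> Hi; have Ho := reshape_offsetP Hi.
have := @flatten_indexKr (r :: s) (blk s i).+1 (off s i) Ho.
by rewrite flatten_index_cons reshape_indexK.
Qed.

Definition bpos (s : seq nat) (j a : nat) (H : a < nth 0 s j) : 'I_(sumn s) :=
  Ordinal (flatten_indexP H).

Lemma blk_bpos s j a (H : a < nth 0 s j) : blk s (bpos H) = j.
Proof. exact: flatten_indexKl. Qed.

Lemma off_bpos s j a (H : a < nth 0 s j) : off s (bpos H) = a.
Proof. exact: flatten_indexKr. Qed.

Lemma bpos_inj s (l l' : 'I_(sumn s)) : blk s l = blk s l' -> off s l = off s l' -> l = l'.
Proof.
move=> E1 E2; apply: val_inj.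
by rewrite /= -(reshape_indexK s l) E1 E2 reshape_indexK.
Qed.

End BlockIndex.

Section Jordan.
Variable k : fieldType.
Local Open Scope ring_scope.

Lemma JpartE (s : seq nat) (i j : 'I_(sumn s)) :
  Jpart k s i j = ((blk s i == blk s j) && (off s i == (off s j).+1))%:R.
Proof.
elim: s i j => [|r s IH] /=; first by case.
move=> i j; rewrite -(splitK i) -(splitK j).
case: (split i) => i' /=; case: (split j) => j' /=.
- by rewrite block_mxEul !mxE !blk0 // !off0.
- by rewrite block_mxEur !mxE blk0 ?blkS.
- by rewrite block_mxEdl !mxE blkS ?blk0.
- by rewrite block_mxEdr IH !blkS ?offS.
Qed.

Lemma col_mulmx (a b c : nat) (A : 'M[k]_(a, b)) (B : 'M[k]_(b, c)) l :
  col l (A *m B) = A *m col l B.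
Proof. by apply/colP => i; rewrite !mxE; apply: eq_bigr => j _; rewrite mxE. Qed.

Section Family.
Variables (s : seq nat) (d : nat).
Implicit Types (A : 'M[k]_d) (x : nat -> 'cV[k]_d).

(* Column [(j, a)] is [A ^ a * x j]: the matrix of the module map sending the generator of the
   [j]-th Jordan block to [x j], as soon as [A ^ s_j * x j = 0]. *)
Definition fam A x : 'M[k]_(d, sumn s) :=
  \matrix_(i, l) (iter (off s l) (mulmx A) (x (blk s l))) i 0.

Definition last_col x : 'M[k]_(d, sumn s) :=
  \matrix_(i, l) (if (off s l).+1 == nth 0%N s (blk s l) then x (blk s l) i 0 else 0).

Lemma col_fam A x l : col l (fam A x) = iter (off s l) (mulmx A) (x (blk s l)).
Proof. by apply/colP => i; rewrite !mxE. Qed.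

Lemma col_last_col x l : col l (last_col x) =
  (if (off s l).+1 == nth 0%N s (blk s l) then x (blk s l) else 0).
Proof. by apply/colP => i; rewrite !mxE; case: ifP; rewrite ?mxE. Qed.

Lemma col_mulJ (M : 'M[k]_(d, sumn s)) (l : 'I_(sumn s))
    (H : ((off s l).+1 < nth 0 s (blk s l))%N) :
  col l (M *m Jpart k s) = col (bpos H) M.
Proof.
apply/colP => i; rewrite !mxE (bigD1 (bpos H)) //= big1 ?addr0 => [|j Hj].
  by rewrite JpartE blk_bpos off_bpos !eqxx mulr1.
rewrite JpartE; case: (blk s j =P _) => [E1|]; last by rewrite mulr0.
case: (off s j =P _) => [E2|]; last by rewrite mulr0.
by case/eqP: Hj; apply: bpos_inj; rewrite ?blk_bpos ?off_bpos.
Qed.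

Lemma col_mulJ0 (M : 'M[k]_(d, sumn s)) (l : 'I_(sumn s)) :
  (off s l).+1 = nth 0%N s (blk s l) -> col l (M *m Jpart k s) = 0.
Proof.
move=> H; apply/colP => i; rewrite !mxE big1 // => j _.
rewrite JpartE; case: (blk s j =P _) => [E1|]; last by rewrite mulr0.
case: (off s j =P _) => [E2|]; last by rewrite mulr0.
by have := reshape_offsetP (ltn_ord j); rewrite E1 E2 H ltnn.
Qed.

Lemma eq_cols (p : nat) (M N : 'M[k]_(d, p)) : (forall l, col l M = col l N) -> M = N.
Proof. by move=> H; apply/matrixP => i l; have /colP/(_ i) := H l; rewrite !mxE. Qed.

(** Inside a block both sides move to the next power of [A]; in the last column [Jpart] gives 0
    while [A] gives [A^(s_j) x_j], so only the relations appear as an error term. *)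
Lemma fam_shift A x :
  A *m fam A x =
  fam A x *m Jpart k s + last_col (fun j => iter (nth 0%N s j) (mulmx A) (x j)).
Proof.
apply: eq_cols => l; rewrite linearD /= col_last_col col_mulmx col_fam -iterS.
have := reshape_offsetP (ltn_ord l); rewrite leq_eqVlt; case: eqP => [E _|_ H].
  by rewrite (col_mulJ0 _ E) add0r E.
by rewrite (col_mulJ _ H) col_fam blk_bpos off_bpos addr0.
Qed.

End Family.
End Jordan.

(** * Extensions and heights *)

Section IterMul.
Variable k : fieldType.
Local Open Scope ring_scope.

Definition mpow (d : nat) (A : 'M[k]_d) (b : nat) (y : 'cV[k]_d) : 'cV[k]_d := iter b (mulmx A) y.

Variables (d : nat) (A : 'M[k]_d).

Lemma mpow0 y : mpow A 0 y = y. Proof. by []. Qed.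
Lemma mpowS b y : mpow A b.+1 y = A *m mpow A b y. Proof. by []. Qed.
Lemma mpowSr b y : mpow A b.+1 y = mpow A b (A *m y). Proof. exact: iterSr. Qed.
Lemma mpow_add b c y : mpow A (b + c) y = mpow A b (mpow A c y). Proof. exact: iterD. Qed.

Lemma mpow_linear b : linear (mpow A b).
Proof. by elim: b => [|b IH] // a x y; rewrite !mpowS IH mulmxDr -scalemxAr. Qed.

HB.instance Definition _ b := GRing.isLinear.Build k 'cV[k]_d 'cV[k]_d *:%R (mpow A b) (mpow_linear b).

Lemma mpow_intertwine (e : nat) (B : 'M[k]_e) (M : 'M[k]_(d, e)) b y :
  A *m M = M *m B -> mpow A b (M *m y) = M *m mpow B b y.
Proof. by move=> H; elim: b => [|b IH] //; rewrite !mpowS IH !mulmxA H. Qed.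

Lemma mulmx_sum_col (e : nat) (M : 'M[k]_(d, e)) (y : 'cV[k]_e) :
  M *m y = \sum_l y l 0 *: col l M.
Proof.
apply/colP => i; rewrite !mxE summxE; apply: eq_bigr => l _.
by rewrite !mxE mulrC.
Qed.

End IterMul.

Section Heights.
Variables (k : fieldType) (m : nat) (nu : seq nat).
Local Open Scope ring_scope.
Local Notation n := (sumn nu).
Local Notation N := (Jpart k nu).
Variables (J : 'M[k]_m) (v : 'M[k]_(m, n)).

Definition extmx : 'M[k]_(m + n) := block_mx J v 0 N.
Local Notation T := extmx.

(* [k^(m+n)] with [T] is the extension of [N] by [J] with cocycle [v]; this is the intersection of
   the submodule [k^m] with the image of [T^b]. *)
Definition height_ge (b : nat) (u : 'cV[k]_m) : Prop :=
  exists e : 'cV[k]_(m + n), mpow T b e = col_mx u 0.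

Lemma extmx_up b u : mpow T b (col_mx u 0) = col_mx (mpow J b u) 0.
Proof.
elim: b => // b IH; rewrite !mpowS IH mul_block_col.
by rewrite !mulmx0 !mul0mx !addr0.
Qed.

Lemma dsub_extmx b e : dsubmx (mpow T b e) = mpow N b (dsubmx e).
Proof.
elim: b => // b IH; rewrite !mpowS -IH -[mpow T b e]vsubmxK mul_block_col.
by rewrite !col_mxKd mul0mx add0r.
Qed.

Lemma mpow_Jpart b (c : 'cV[k]_n) (l l' : 'I_n) :
  blk nu l' = blk nu l -> off nu l' = (b + off nu l)%N -> mpow N b c l' 0 = c l 0.
Proof.
elim: b l' => [|b IH] l' E1 E2; first by rewrite mpow0 (@bpos_inj _ l' l).
have H : (b + off nu l < nth 0 nu (blk nu l))%N.
  by rewrite -E1 (leq_trans _ (reshape_offsetP (ltn_ord l'))) // E2 addSn.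
rewrite mpowS mxE (bigD1 (bpos H)) //= big1 ?addr0 => [|j Hj].
  rewrite JpartE E1 E2 blk_bpos off_bpos addSn !eqxx mul1r.
  by apply: IH; rewrite ?blk_bpos ?off_bpos.
rewrite JpartE E1 E2 addSn eqSS; case: (blk nu l =P _) => [F1|]; last by rewrite mul0r.
case: (_ =P off nu j) => [F2|]; last by rewrite mul0r.
by case/eqP: Hj; apply: bpos_inj; rewrite ?blk_bpos ?off_bpos.
Qed.

(* [e] lifts generators of the cyclic summands of the quotient [k^n], and [w] records the relations
   [T^(nu_j) e_j = w_j] that determine the extension. *)
Definition lifts (e : nat -> 'cV[k]_(m + n)) (w : nat -> 'cV[k]_m) : Prop :=
  (forall j, mpow T (nth 0%N nu j) (e j) = col_mx (w j) 0) /\ dsubmx (fam nu T e) \in unitmx.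

Lemma last_col_up (w : nat -> 'cV[k]_m) :
  last_col nu (fun j => col_mx (w j) (0 : 'cV[k]_n)) = col_mx (last_col nu w) 0.
Proof.
apply/matrixP => i l; rewrite mxE -[i]splitK; case: (split i) => i' /=.
  by rewrite !col_mxEu mxE.
by rewrite !col_mxEd !mxE if_same.
Qed.

Lemma lifts_shift e w : (forall j, mpow T (nth 0%N nu j) (e j) = col_mx (w j) 0) ->
  T *m fam nu T e = fam nu T e *m N + col_mx (last_col nu w) 0.
Proof.
move=> H; rewrite fam_shift -last_col_up; congr (_ + _).
by apply: eq_cols => l; rewrite !col_last_col -!/(mpow _ _ _) H.
Qed.

(** The upper rows say that [v *m Y] and [last_col nu w] agree up to a coboundary, [Y] being the
    lower part of the family; the lower rows put [Y] in the centraliser of [N]. Choosing lifts with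
    [Y] invertible is thus a move inside the orbit. *)
Lemma lifts_shift_block e w : (forall j, mpow T (nth 0%N nu j) (e j) = col_mx (w j) 0) ->
  J *m usubmx (fam nu T e) + v *m dsubmx (fam nu T e) = usubmx (fam nu T e) *m N + last_col nu w /\
  N *m dsubmx (fam nu T e) = dsubmx (fam nu T e) *m N.
Proof.
move/lifts_shift; set P := fam nu T e; move=> H.
have : T *m col_mx (usubmx P) (dsubmx P) =
  col_mx (usubmx P) (dsubmx P) *m N + col_mx (last_col nu w) 0 by rewrite vsubmxK.
rewrite mul_block_col mul_col_mx add_col_mx mul0mx add0r addr0.
by case/eq_col_mx.
Qed.

(** Expand [eh] in the powers of the lifts modulo [k^m], with coefficients [c]. Applying [T^b] must
    kill the quotient part, which excludes the powers that stay inside their block; the others cross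
    the relation [T^(nu_j) e_j = w_j] and end up in [k^m]. *)
Lemma lifts_decomp e w b u eh : lifts e w -> mpow T b eh = col_mx u 0 ->
  let c := invmx (dsubmx (fam nu T e)) *m dsubmx eh in
  (forall l : 'I_n, (off nu l + b < nth 0 nu (blk nu l))%N -> c l 0 = 0) /\
  exists u0, u = mpow J b u0 + \sum_(l < n | (nth 0 nu (blk nu l) <= off nu l + b)%N)
     c l 0 *: mpow J (off nu l + b - nth 0%N nu (blk nu l)) (w (blk nu l)).
Proof.
move=> [Hw HY] Hu c; set Y := dsubmx _ in HY.
have [HW HN] := lifts_shift_block Hw; rewrite -/Y in HN HW.
have Hc : dsubmx eh = Y *m c by rewrite mulKVmx.
have N0 : mpow N b c = 0.
  have : mpow N b (dsubmx eh) = 0 by rewrite -dsub_extmx Hu col_mxKd.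
  by rewrite Hc (mpow_intertwine _ _ HN) => E; rewrite -(mulKmx HY (mpow N b c)) E mulmx0.
have c0 (l : 'I_n) : (off nu l + b < nth 0 nu (blk nu l))%N -> c l 0 = 0.
  move=> H; rewrite -(@mpow_Jpart b c l (bpos H)) ?blk_bpos ?off_bpos 1?addnC //.
  by rewrite N0 mxE.
split=> //.
set P := fam nu T e.
exists (usubmx eh - usubmx P *m c).
have Eh : eh = P *m c + col_mx (usubmx eh - usubmx P *m c) 0.
  rewrite -[P]vsubmxK mul_col_mx col_mxKu -/Y -Hc add_col_mx addr0 addrC subrK.
  by rewrite vsubmxK.
have := Hu; rewrite {1}Eh linearD /= extmx_up mulmx_sum_col linear_sum /= => Hs.
have Hs2 : col_mx u 0 = col_mx (mpow J b (usubmx eh - usubmx P *m c)) (0 : 'cV_n) +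
   \sum_(l < n | (nth 0 nu (blk nu l) <= off nu l + b)%N)
     c l 0 *: col_mx (mpow J (off nu l + b - nth 0%N nu (blk nu l)) (w (blk nu l))) 0.
  rewrite -Hs addrC; congr (_ + _); rewrite [RHS]big_mkcond; apply: eq_bigr => l _.
  case: leqP => H; last by rewrite c0 // scale0r linear0.
  rewrite linearZ /= col_fam; congr (_ *: _).
  by rewrite -/(mpow T _ _) -mpow_add (addnC b) -[in LHS](subnK H) mpow_add Hw extmx_up.
have := congr1 usubmx Hs2; rewrite linearD /= linear_sum /= !col_mxKu => ->.
by congr (_ + _); apply: eq_bigr => l _; rewrite linearZ /= col_mxKu.
Qed.

End Heights.

Definition upd (T : Type) (f : nat -> T) (j0 : nat) (a : T) (j : nat) : T :=
  if j == j0 then a else f j.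

Section Replace.
Variable k : fieldType.
Local Open Scope ring_scope.

Lemma unitmx_inj (d : nat) (C : 'M[k]_d) :
  (forall y : 'cV_d, C *m y = 0 -> y = 0) -> C \in unitmx.
Proof.
move=> H; rewrite -unitmx_tr -row_free_unit -kermx_eq0; apply/eqP/row_matrixP => i.
rewrite row0; apply: trmx_inj; rewrite trmx0; apply: H.
by apply: trmx_inj; rewrite trmx_mul trmxK trmx0 -row_mul mulmx_ker row0.
Qed.

Variables (m : nat) (nu : seq nat) (J : 'M[k]_m).
Local Notation n := (sumn nu).
Local Notation N := (Jpart k nu).
Variable v : 'M[k]_(m, n).
Local Notation T := (extmx J v).

Lemma mpow_Jpart_small b (c : 'cV[k]_n) (l : 'I_n) : (off nu l < b)%N -> mpow N b c l 0 = 0.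
Proof.
elim: b l => // b IH l H; rewrite mpowS mxE big1 // => j _.
rewrite JpartE; case: (off nu l =P _) => [E|]; last by rewrite andbF mul0r.
by rewrite IH ?mulr0 // -ltnS -E.
Qed.

(** In terms of the old lifts, the new ones form a matrix [C] whose columns outside the block of
    [l0] are unit vectors and inside it are the shifts of [c]. As [c] is nonzero at the head of the
    block, these shifts are independent there, so [C] is invertible. *)
Lemma lifts_replace e w (l0 : 'I_n) eh w0 : lifts J v e w -> off nu l0 = 0%N ->
  mpow T (nth 0%N nu (blk nu l0)) eh = col_mx w0 0 ->
  (invmx (dsubmx (fam nu T e)) *m dsubmx eh) l0 0 != 0 ->
  lifts J v (upd e (blk nu l0) eh) (upd w (blk nu l0) w0).
Proof.
set Y := dsubmx (fam nu T e) => -[Hw HY] Hl0 Heh; set c := invmx Y *m _ => Hc.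
split=> [j|]; first by rewrite /upd; case: eqP => [->|].
set Y' := dsubmx _; have [_ HN] := lifts_shift_block Hw; rewrite -/Y in HN.
have colY' l : col l Y' = dsubmx (mpow T (off nu l) (upd e (blk nu l0) eh (blk nu l))).
  by apply/colP => i; rewrite !mxE.
have colY l : col l Y = dsubmx (mpow T (off nu l) (e (blk nu l))).
  by apply/colP => i; rewrite !mxE.
pose C := invmx Y *m Y'.
suff CU : C \in unitmx by rewrite -(mulKVmx HY Y') unitmx_mul HY.
have C1 (l : 'I_n) : blk nu l != blk nu l0 -> col l C = delta_mx l 0.
  move=> Hl; rewrite col_mulmx colY' /upd (negbTE Hl) -colY -col_mulmx mulVmx //.
  by rewrite colE mul1mx.
have C2 (l : 'I_n) : blk nu l = blk nu l0 -> col l C = mpow N (off nu l) c.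
  move=> Hl; rewrite col_mulmx colY' /upd Hl eqxx dsub_extmx.
  have -> : dsubmx eh = Y *m c by rewrite mulKVmx.
  by rewrite (mpow_intertwine _ _ HN) mulKmx.
apply: unitmx_inj => d; rewrite mulmx_sum_col => Hd.
(* Forward substitution down the block: in row [l], earlier columns of the block already have
   coefficient 0 and later shifts have not reached [l], so only [d_l] times the head coefficient is
   left. *)
have D2 : forall a (l : 'I_n), blk nu l = blk nu l0 -> (off nu l < a)%N -> d l 0 = 0.
  elim=> // a IH l Hl; rewrite ltnS leq_eqVlt => /orP[/eqP Ea|]; last exact: IH.
  have /colP/(_ l) := Hd; rewrite summxE mxE (bigD1 l) //= big1 ?addr0.
    rewrite C2 // mxE (@mpow_Jpart k nu (off nu l) c l0 l) ?Hl0 ?addn0 // => /eqP.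
    by rewrite mulf_eq0 (negbTE Hc) orbF => /eqP.
  move=> l' Hl'; rewrite mxE; case: (blk nu l' =P blk nu l0) => [E|/eqP E].
    rewrite C2 //; case: (ltngtP (off nu l') (off nu l)) => [H|H|H].
    - by rewrite IH ?mul0r // -Ea.
    - by rewrite mpow_Jpart_small ?mulr0.
    - by case/eqP: Hl'; apply: bpos_inj; rewrite ?E ?Hl.
  rewrite C1 // mxE; case: (l =P l') => [E'|]; last by rewrite mulr0.
  by rewrite -E' Hl eqxx in E.
have {}D2 (l : 'I_n) : blk nu l = blk nu l0 -> d l 0 = 0 by move=> H; apply: (D2 (off nu l).+1).
apply/colP => l; rewrite mxE; case: (blk nu l =P blk nu l0) => [/D2//|/eqP E].
have /colP/(_ l) := Hd; rewrite summxE mxE (bigD1 l) //= big1 ?addr0.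
  by rewrite C1 // !mxE !eqxx mulr1.
move=> l' Hl'; rewrite mxE; case: (blk nu l' =P blk nu l0) => [/D2 ->|/eqP E'].
  by rewrite mul0r.
by rewrite C1 // mxE eq_sym (negbTE Hl') mulr0.
Qed.

Lemma lifts_perm e w (sg : nat -> nat) : involutive sg ->
  (forall j, nth 0%N nu (sg j) = nth 0%N nu j) ->
  lifts J v e w -> lifts J v (e \o sg) (w \o sg).
Proof.
move=> sgK Hsg [Hw HY]; split=> [j|]; first by rewrite /= -Hsg Hw.
set Y := dsubmx _ in HY; set Y' := dsubmx _.
have Hp (l : 'I_n) : (off nu l < nth 0 nu (sg (blk nu l)))%N.
  by rewrite Hsg reshape_offsetP.
pose p l := bpos (Hp l).
have pK : involutive p by move=> l; apply: bpos_inj; rewrite ?blk_bpos ?off_bpos ?sgK.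
have colY' l : col l Y' = col (p l) Y.
  by apply/colP => i; rewrite !mxE /p blk_bpos off_bpos.
apply: unitmx_inj => d Hd; have E : Y *m (\col_l d (p l) 0) = 0.
  rewrite -Hd !mulmx_sum_col (reindex_inj (inv_inj pK)) /=.
  by apply: eq_bigr => l _; rewrite mxE pK colY'.
apply/colP => l; have /colP/(_ (p l)) : \col_l d (p l) 0 = 0.
  by rewrite -(mulKmx HY (\col_l _)) E mulmx0.
by rewrite !mxE pK.
Qed.

End Replace.

Section Orbit.
Variables (k : fieldType) (mu nu : seq nat).
Local Open Scope ring_scope.
Local Notation J := (Jpart k mu).
Local Notation N := (Jpart k nu).

Lemma comm_inv (d : nat) (X A : 'M[k]_d) : X \in unitmx -> A *m X = X *m A ->
  A *m invmx X = invmx X *m A.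
Proof.
by move=> HX E; rewrite -[LHS](mulKmx HX) [X *m _]mulmxA -E mulmxK.
Qed.

(** The group element is [(X^-1, Y^-1)], with [Y] the lower part of the lifted family, and [X^-1 W],
    with [W] the upper part, supplies the coboundary. *)
Lemma lifts_same_orbit (v : 'M[k]_(sumn mu, sumn nu)) e w (X : 'M_(sumn mu)) g :
  lifts J v e w -> X \in unitmx -> J *m X = X *m J -> (forall j, (0 < nth 0 nu j)%N -> w j = X *m g j) ->
  same_orbit v (last_col nu g).
Proof.
move=> [Hw HY] HX HJ Hg; have [] := lifts_shift_block Hw.
set W := usubmx _; set Y := dsubmx _ in HY *; move=> E1 E2.
have Eg : last_col nu w = X *m last_col nu g.
  apply: eq_cols => l; rewrite col_mulmx !col_last_col.
  by case: eqP => [E|]; rewrite ?mulmx0 // Hg -?E.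
exists (invmx X), (invmx Y); split; rewrite ?unitmx_inv //.
- by rewrite (comm_inv HX).
- by rewrite (comm_inv HY).
exists (invmx X *m W); rewrite invmxK.
have -> : invmx X *m v *m Y = invmx X *m (W *m N + last_col nu w - J *m W).
  by rewrite -E1 addrAC subrr add0r mulmxA.
rewrite Eg mulmxBr mulmxDr mulKmx // !mulmxA (comm_inv HX) //.
by rewrite addrAC addrK.
Qed.

(** Orbit equivalence is an isomorphism [P] between the two extensions that restricts to [X] on
    [k^m]; it carries the image of [T^b] to the image of [T^b]. *)
Lemma same_orbit_height (v v' : 'M[k]_(sumn mu, sumn nu)) : same_orbit v v' ->
  exists X : 'M[k]_(sumn mu), [/\ X \in unitmx, J *m X = X *m J &
    forall b u, height_ge J v b u <-> height_ge J v' b (X *m u)].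
Proof.
case=> X [Y [HX HY XJ YN [w Ew]]]; exists X; split=> // b u.
pose P : 'M[k]_(sumn mu + sumn nu) := block_mx X (- (w *m Y)) 0 Y.
have PU : P \in unitmx by rewrite unitmxE det_ublock unitrM -!unitmxE HX.
have EP : extmx J v' *m P = P *m extmx J v.
  rewrite !mulmx_block !mul0mx !mulmx0 !add0r !addr0 XJ YN; congr block_mx.
  have -> : v' = X *m v *m invmx Y - (w *m N - J *m w) by rewrite -Ew opprB addrC subrK.
  rewrite !mulmxBl !mulmxN !mulNmx -!mulmxA mulVmx // mulmx1 YN !mulmxA.
  by rewrite opprB addrCA addKr.
have Pu (y : 'cV_(sumn mu)) : P *m col_mx y 0 = col_mx (X *m y) 0.
  by rewrite mul_block_col !mulmx0 mul0mx !addr0.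
split=> -[e He].
  by exists (P *m e); rewrite (mpow_intertwine _ _ EP) He Pu.
exists (invmx P *m e); have PT : extmx J v *m invmx P = invmx P *m extmx J v'.
  by rewrite -[LHS](mulKmx PU) [P *m _]mulmxA -EP mulmxK.
by rewrite (mpow_intertwine _ _ PT) He -Pu mulKmx.
Qed.

End Orbit.

(** * Filtrations raised by an operator *)

Section Chain.
Variable k : fieldType.
Local Open Scope ring_scope.

(** Level [b] models the vectors of height at least [b]. With [A = 0] the axiom [chain_mul] only
    puts 0 in every level, so [chain 0 F] is a plain decreasing filtration by subspaces. *)
Record chain (d : nat) (A : 'M[k]_d) (C : nat -> 'cV[k]_d -> Prop) : Prop := Chain {
  chain_top : forall y, C 0%N y;
  chainD : forall b y z, C b y -> C b z -> C b (y + z);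
  chainZ : forall b a y, C b y -> C b (a *: y);
  chain_pred : forall b y, C b.+1 y -> C b y;
  chain_mul : forall b y, C b y -> C b.+1 (A *m y) }.

Section ChainTheory.
Variables (d : nat) (A : 'M[k]_d) (C : nat -> 'cV[k]_d -> Prop).
Hypothesis HC : chain A C.

Lemma chain_le b c y : (b <= c)%N -> C c y -> C b y.
Proof.
move=> /subnKC <-; elim: (c - b)%N => [|i IH]; first by rewrite addn0.
by rewrite addnS => /(chain_pred HC)/IH.
Qed.

Lemma chain_mpow b i y : C b y -> C (b + i) (mpow A i y).
Proof.
move=> H; elim: i => [|i IH]; first by rewrite addn0.
by rewrite addnS; apply: (chain_mul HC).
Qed.

Lemma chain0 b : C b 0.
Proof. by rewrite -[b]add0n -(linear0 (mpow A b)); apply/chain_mpow/(chain_top HC). Qed.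

Lemma chainN b y : C b y -> C b (- y).
Proof. by rewrite -scaleN1r; apply: (chainZ HC). Qed.

Lemma chainB b y z : C b y -> C b z -> C b (y - z).
Proof. by move=> Hy Hz; apply: (chainD HC) => //; apply: chainN. Qed.

Lemma chainDl b y z : C b y -> C b (y + z) -> C b z.
Proof. by move=> Hy Hz; rewrite -(addKr y z) addrC; apply: chainB. Qed.

Lemma chainDr b y z : C b z -> C b (y + z) -> C b y.
Proof. by rewrite addrC; apply: chainDl. Qed.

Lemma chain_sum b (I : finType) (P : pred I) (F : I -> 'cV[k]_d) :
  (forall i, P i -> C b (F i)) -> C b (\sum_(i | P i) F i).
Proof. by move=> H; elim/big_ind: _ => //; [apply: chain0 | move=> *; apply: (chainD HC)]. Qed.

Lemma chain_mulmx b (p : nat) (M : 'M[k]_(d, p)) (y : 'cV[k]_p) :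
  (forall l, y l 0 != 0 -> C b (col l M)) -> C b (M *m y).
Proof.
move=> H; rewrite mulmx_sum_col; apply: chain_sum => l _.
have [->|/H Hl] := eqVneq (y l 0) 0; first by rewrite scale0r; apply: chain0.
exact: (chainZ HC).
Qed.

End ChainTheory.

Definition graded (d : nat) (h : 'I_d -> nat) (b : nat) (y : 'cV[k]_d) : Prop :=
  forall l, y l 0 != 0 -> (b <= h l)%N.

(* The basis vectors that do not inherit their height from a basis vector of height one less:
   these correspond to the nonzero columns of the normal form. *)
Definition generating (d : nat) (h : 'I_d -> nat) (nz : rel 'I_d) (l : 'I_d) : bool :=
  (0 < h l)%N && [forall l', nz l l' ==> (h l != (h l').+1)].

Section Nakayama.
Variables (d : nat) (tau : 'M[k]_d) (h : 'I_d -> nat) (nz : rel 'I_d).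
Hypothesis nzE : forall l l', (tau l l' != 0) = nz l l'.
Hypothesis nz_lt : forall l l', nz l l' -> (h l' < h l)%N.
Hypothesis nz_tight : forall l l' l'', nz l l' -> nz l'' l' -> h l = (h l').+1 ->
  l'' = l \/ (h l < h l'')%N.

Lemma graded_chain : chain tau (graded h).
Proof.
split=> //.
- move=> b y z Hy Hz l; rewrite mxE; have [E|/Hy//] := eqVneq (y l 0) 0.
  by rewrite E add0r => /Hz.
- by move=> b a y Hy l; rewrite mxE mulf_eq0 negb_or => /andP[_ /Hy].
- by move=> b y Hy l /Hy /ltnW.
move=> b y Hy l; rewrite mxE => H.
have [l' Hl'] : exists l', tau l l' * y l' 0 != 0.
  apply/existsP; apply: contraNT H => /existsPn H; apply/eqP/big1 => l' _.
  by have := H l'; rewrite negbK => /eqP.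
move: Hl'; rewrite mulf_eq0 negb_or nzE => /andP[/nz_lt Hl' /Hy Hb].
exact: leq_ltn_trans Hl'.
Qed.

Lemma graded_delta l b : (b <= h l)%N -> graded h b (delta_mx l 0).
Proof. by move=> Hb l'; rewrite mxE; case: (l' =P l) => [->//|_] /=; rewrite eqxx. Qed.

(** By [nz_tight], a non-generating basis vector of height [b + 1] is, up to a unit and strictly
    higher vectors, the image under [tau] of a basis vector of height [b]. Heights are bounded, so
    descending induction takes care of the higher vectors, as in Nakayama's lemma. *)
Lemma nakayama (C : nat -> 'cV[k]_d -> Prop) : chain tau C ->
  (forall l, generating h nz l -> C (h l) (delta_mx l 0)) ->
  forall b y, graded h b y -> C b y.
Proof.
move=> HC Hgen b0 y0 Hy0; pose H := \max_l h l.
(* The power [i] is carried along because the inner induction replaces [(b + 1, i)] by [(b, i + 1)],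
   keeping the sum; the outer one, on [s], bounds how far the sum is from the greatest height
   [H]. *)
suff P : forall s b i y, (H < b + i + s)%N -> graded h b y -> C (b + i)%N (mpow tau i y).
  by have := P H.+1 b0 0%N y0; rewrite !addn0 addnS ltnS leq_addl; apply=> //.
elim=> [|s IHs].
  move=> b i y Hb /(chain_mpow graded_chain i) Hy.
  suff -> : mpow tau i y = 0 by apply: (chain0 HC).
  apply/colP => l; rewrite [RHS]mxE; apply/eqP/negPn/negP => /Hy.
  by rewrite leqNgt (leq_ltn_trans _ (leq_trans Hb _)) ?addn0 // leq_bigmax.
have step b i l : (H < b + i + s.+1)%N -> (b < h l)%N -> C (b + i)%N (mpow tau i (delta_mx l 0)).
  move=> Hb Hl; apply: (chain_le HC (leq_addr 1 _)); rewrite addn1 -addSn.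
  by apply: IHs; [rewrite !addSn -addnS | apply: graded_delta].
elim=> [|b IHb] i y Hb Hy; first by apply: (chain_mpow HC); apply: (chain_top HC).
rewrite -[y]mul1mx mulmx_sum_col linear_sum /=; apply: (chain_sum HC) => l _.
have [->|Hyl] := eqVneq (y l 0) 0; first by rewrite scale0r linear0; apply: (chain0 HC).
rewrite linearZ /=; apply: (chainZ HC); rewrite colE mul1mx.
move: (Hy _ Hyl); rewrite leq_eqVlt => /orP[/eqP El|]; last exact: step.
case G : (generating h nz l).
  by rewrite El; apply: (chain_mpow HC); apply: Hgen.
move: G; rewrite /generating -El /= => /negbT/forallPn[l'].
rewrite negb_imply negbK => /andP[Hnz /eqP Etight].
have Et : tau *m delta_mx l' 0 = tau l l' *: delta_mx l 0 +
    \sum_(l'' | l'' != l) tau l'' l' *: (delta_mx l'' 0 : 'cV_d).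
  rewrite -colE -[col _ _]mul1mx mulmx_sum_col (bigD1 l) //= mxE colE mul1mx.
  by congr (_ + _); apply: eq_bigr => l'' _; rewrite mxE colE mul1mx.
have Hn0 : tau l l' != 0 by rewrite nzE.
have : C (b.+1 + i)%N (mpow tau i (tau l l' *: delta_mx l 0)).
  have {Et} -> : tau l l' *: delta_mx l 0 = tau *m delta_mx l' 0 -
    \sum_(l'' | l'' != l) tau l'' l' *: (delta_mx l'' 0 : 'cV_d) by rewrite Et addrK.
  rewrite linearB /=; apply: (chainB HC) => //.
    rewrite -mpowSr addSnnS; apply: IHb; first by rewrite (addnS b i) -(addSn b i).
    by apply: graded_delta; case: Etight => ->.
  rewrite linear_sum /=; apply: (chain_sum HC) => l'' Hl''.
  rewrite linearZ /=; have [->|Hn] := eqVneq (tau l'' l') 0.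
    by rewrite scale0r; apply: (chain0 HC).
  apply: (chainZ HC); apply: step => //; rewrite El.
  have := nz_tight Hnz (_ : nz l'' l'); rewrite -nzE => /(_ Hn).
  by rewrite -El => /(_ Etight) [E|//]; rewrite E eqxx in Hl''.
by move/(chainZ HC (tau l l')^-1); rewrite linearZ /= scalerA mulVf // scale1r.
Qed.

End Nakayama.
End Chain.

Section HeightChain.
Variables (k : fieldType) (m : nat) (nu : seq nat).
Local Open Scope ring_scope.
Local Notation n := (sumn nu).
Local Notation N := (Jpart k nu).
Variables (J : 'M[k]_m) (v : 'M[k]_(m, n)).
Local Notation T := (extmx J v).

Lemma height_chain : chain J (height_ge J v).
Proof.
split.
- by move=> y; exists (col_mx y 0).
- move=> b y z [e He] [f Hf]; exists (e + f).
  by rewrite linearD /= He Hf add_col_mx addr0.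
- by move=> b a y [e He]; exists (a *: e); rewrite linearZ /= He scale_col_mx scaler0.
- by move=> b y [e He]; exists (T *m e); rewrite -mpowSr.
by move=> b y [e He]; exists e; rewrite mpowS He -[T *m _]/(mpow T 1 _) extmx_up.
Qed.

Lemma mpow_Jpart_nil (s : seq nat) (c : 'cV[k]_(sumn s)) : mpow (Jpart k s) (sumn s) c = 0.
Proof.
apply/colP => l; rewrite mxE mpow_Jpart_small //.
apply: leq_trans (ltn_ord l); rewrite ltnS -{2}(reshape_indexK s l); exact: leq_addl.
Qed.

Definition std_gen (j : nat) : 'cV[k]_n := \col_l ((blk nu l == j) && (off nu l == 0%N))%:R.

Lemma mpow_std_gen j a : mpow N a (std_gen j) = \col_l ((blk nu l == j) && (off nu l == a))%:R.
Proof.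
apply/colP => l; rewrite mxE; case: (ltnP (off nu l) a) => H.
  by rewrite mpow_Jpart_small // (ltn_eqF H) andbF.
have H' : (off nu l - a < nth 0 nu (blk nu l))%N.
  by apply: leq_ltn_trans (leq_subr _ _) _; apply: reshape_offsetP.
rewrite (@mpow_Jpart k nu a _ (bpos H') l) ?blk_bpos ?off_bpos ?subnKC // mxE.
by rewrite blk_bpos off_bpos subn_eq0 [_ == a]eqn_leq H andbT.
Qed.

Lemma lifts_std : lifts J v (fun j => col_mx 0 (std_gen j))
  (fun j => usubmx (mpow T (nth 0%N nu j) (col_mx 0 (std_gen j)))).
Proof.
split=> [j|].
  rewrite -[LHS]vsubmxK; congr col_mx; rewrite dsub_extmx col_mxKd mpow_std_gen.
  apply/colP => l; rewrite !mxE; case: eqP => //= <-.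
  by rewrite ltn_eqF // reshape_offsetP.
suff -> : dsubmx (fam nu T (fun j => col_mx 0 (std_gen j))) = 1%:M by rewrite unitmx1.
apply: eq_cols => l.
have -> : col l (dsubmx (fam nu T (fun j => col_mx 0 (std_gen j)))) =
    dsubmx (mpow T (off nu l) (col_mx 0 (std_gen (blk nu l)))).
  by apply/colP => i; rewrite !mxE.
rewrite dsub_extmx col_mxKd mpow_std_gen; apply/colP => l'; rewrite !mxE; congr (_%:R).
congr nat_of_bool; apply/andP/eqP => [[/eqP E1 /eqP E2]|-> //].
exact: bpos_inj.
Qed.

Lemma lifts_height e w j : lifts J v e w -> height_ge J v (nth 0%N nu j) (w j).
Proof. by case=> Hw _; exists (e j). Qed.

End HeightChain.

(** Only last columns of blocks carry an upper part, so the generator runs through its block inside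
    [k^n] and meets [g j] exactly when the block ends. *)
Lemma std_relation (k : fieldType) (m : nat) (nu : seq nat) (J : 'M[k]_m)
    (g : nat -> 'cV[k]_m) j : 0 < nth 0 nu j ->
  mpow (extmx J (last_col nu g)) (nth 0%N nu j) (col_mx 0 (std_gen k nu j)) = col_mx (g j) 0%R.
Proof.
case E : (nth 0 nu j) => [//|r] _.
have H a : a <= r -> mpow (extmx J (last_col nu g)) a (col_mx 0%R (std_gen k nu j)) =
    col_mx 0%R (mpow (Jpart k nu) a (std_gen k nu j)).
  elim: a => // a IH Ha; rewrite mpowS IH ?(ltnW Ha) // mul_block_col !mulmx0 !add0r.
  congr col_mx; rewrite mulmx_sum_col big1 // => l _; rewrite mpow_std_gen mxE col_last_col.
  case: eqP => [->|]; last by rewrite scale0r.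
  by rewrite E; case: eqP => [->|]; rewrite ?scale0r // eqSS ltn_eqF // scaler0.
rewrite mpowS H // mul_block_col !mulmx0 !add0r -mpowS; congr col_mx.
  have Hr : r < nth 0 nu j by rewrite E.
  rewrite mulmx_sum_col (bigD1 (bpos Hr)) //= big1 ?addr0 => [|l Hl].
    by rewrite mpow_std_gen mxE col_last_col blk_bpos off_bpos !eqxx E eqxx scale1r.
  rewrite mpow_std_gen mxE; case: eqP => [E1|]; last by rewrite scale0r.
  case: eqP => [E2|]; last by rewrite scale0r.
  by case/eqP: Hl; apply: bpos_inj; rewrite ?blk_bpos ?off_bpos.
rewrite mpow_std_gen; apply/colP => l; rewrite !mxE; case: eqP => //= Ej.
by rewrite ltn_eqF // -E -Ej reshape_offsetP.
Qed.

(** * Exchanging generators along an adapted basis *)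

Section Exchange.
Variables (k : fieldType) (m : nat) (nu : seq nat) (d : nat).
Local Open Scope ring_scope.
Local Notation n := (sumn nu).
Local Notation N := (Jpart k nu).
Variables (J : 'M[k]_m) (v : 'M[k]_(m, n)) (tau : 'M[k]_d).
Variables (X : 'M[k]_(m, d)) (X' : 'M[k]_(d, m)).
Variables (h : 'I_d -> nat) (nz : rel 'I_d).
Local Notation T := (extmx J v).
Hypothesis XK : X *m X' = 1%:M.
Hypothesis X'K : X' *m X = 1%:M.
Hypothesis XJ : J *m X = X *m tau.
Hypothesis nzE : forall l l', (tau l l' != 0) = nz l l'.
Hypothesis nz_lt : forall l l', nz l l' -> (h l' < h l)%N.
Hypothesis nz_tight : forall l l' l'', nz l l' -> nz l'' l' -> h l = (h l').+1 ->
  l'' = l \/ (h l < h l'')%N.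
Hypothesis hX : forall b y, height_ge J v b (X *m y) <-> graded h b y.
Local Notation gen := (generating h nz).

Lemma height_graded b u : height_ge J v b u -> graded h b (X' *m u).
Proof. by move=> H; apply/hX; rewrite mulmxA XK mul1mx. Qed.

Lemma intertwine_inv : X' *m J = tau *m X'.
Proof. by rewrite -[LHS]mulmx1 -XK mulmxA -(mulmxA X') XJ !mulmxA X'K mul1mx. Qed.

Lemma coef_gen0 l b u : gen l -> b = h l -> height_ge J v b.+1 u -> (X' *m u) l 0 = 0.
Proof. by move=> _ -> /height_graded H; apply/eqP/negPn/negP => /H; rewrite ltnn. Qed.

(** A nonzero coordinate would come from some [l'] with [nz l l'] and height at least [h l - 1],
    hence exactly that by [nz_lt], which [generating] forbids. With [coef_gen0], the coordinate at a
    generating index ignores both larger heights and [J] times anything one level lower. *)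
Lemma coef_genJ l b u : gen l -> b.+1 = h l -> height_ge J v b u -> (X' *m (J *m u)) l 0 = 0.
Proof.
move=> /andP[_ /forallP Hl] Eb /height_graded Hu.
rewrite mulmxA intertwine_inv -mulmxA mxE big1 // => l' _.
have [->|Hn] := eqVneq (tau l l') 0; first by rewrite mul0r.
have [->|/Hu Hb] := eqVneq ((X' *m u) l' 0) 0; first by rewrite mulr0.
move: Hn; rewrite nzE => Hn; have := Hl l'; rewrite Hn /= => /eqP[].
by apply/eqP; rewrite eqn_leq nz_lt // -Eb ltnS Hb.
Qed.

(** Expand [col l0 X] by [lifts_decomp] and read coordinate [l0], which is 1. The coefficient lemmas
    annihilate [J^h u0] and every summand with positive offset or with a positive power of [J] on
    its relation. Some summand survives, so it has offset 0 and its part equals [h l0]. *)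
Lemma exchange e w (S : pred 'I_d) (io : 'I_d -> nat) l0 : lifts J v e w -> gen l0 ->
  ~~ S l0 -> (forall l, S l -> w (io l) = col l X) ->
  exists (p : 'I_n) eh, [/\ nth 0%N nu (blk nu p) = h l0, forall l, S l -> io l != blk nu p &
    lifts J v (upd e (blk nu p) eh) (upd w (blk nu p) (col l0 X))].
Proof.
move=> Hew Hl0 HS Hio; have HC := height_chain J v.
have [eh Heh] : height_ge J v (h l0) (col l0 X).
  by rewrite colE; apply/hX/graded_delta.
have [c0 [u0 Hu0]] := lifts_decomp Hew Heh.
set c := invmx _ *m _ in c0 Hu0.
have Hpos : (0 < h l0)%N by case/andP: Hl0.
have phi1 : (X' *m col l0 X) l0 0 = 1 by rewrite colE mulmxA X'K mul1mx mxE !eqxx.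
have phi0 : (X' *m mpow J (h l0) u0) l0 0 = 0.
  rewrite -(prednK Hpos) mpowS; apply: coef_genJ Hl0 (prednK Hpos) _.
  by apply: (chain_mpow HC (b := 0%N)); apply: chain_top HC _.
move: phi1; rewrite Hu0 mulmxDr mxE phi0 add0r mulmx_sumr summxE => phi1.
have [p Hp Hpn] : exists2 p : 'I_n, (nth 0 nu (blk nu p) <= off nu p + h l0)%N &
   (X' *m (c p 0 *: mpow J (off nu p + h l0 - nth 0%N nu (blk nu p)) (w (blk nu p)))) l0 0 != 0.
  apply/exists_inP; apply: contra_eqT phi1 => /exists_inPn H.
  rewrite big1 ?[0 == 1]eq_sym ?oner_neq0 // => p Hp.
  by have := H p Hp; rewrite negbK => /eqP.
move: Hpn; rewrite -scalemxAr mxE mulf_eq0 negb_or => /andP[Hcp].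
set i := (_ - _)%N => Hphi.
have Hi : (nth 0%N nu (blk nu p) + i = off nu p + h l0)%N by rewrite subnKC.
have Hw := lifts_height (blk nu p) Hew.
have Hoff : off nu p = 0%N.
  case E : (off nu p) => [//|a]; case/eqP: Hphi.
  apply: (coef_gen0 (b := h l0)) => //.
  apply: (chain_le HC _ (chain_mpow HC i Hw)); rewrite Hi E addSn ltnS; exact: leq_addl.
rewrite Hoff add0n in Hi.
have Hi0 : i = 0%N.
  case E : i => [//|a]; case/eqP: Hphi; rewrite E mpowS.
  apply: (coef_genJ (b := (nth 0%N nu (blk nu p) + a)%N)) => //; first by rewrite -Hi E addnS.
  exact: chain_mpow HC _ _ _ Hw.
rewrite Hi0 mpow0 in Hphi; rewrite Hi0 addn0 in Hi.
exists p, eh; split=> //.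
  (* The relation at [p] has a nonzero coordinate [l0], whereas the columns already placed are other
     basis vectors, with coordinate 0 there. *)
  move=> l Sl; apply: contraNneq Hphi => <-; rewrite Hio // colE mulmxA X'K mul1mx mxE.
  by case: (l0 =P l) => [E|//]; rewrite E Sl in HS.
by rewrite -Hu0; apply: lifts_replace; rewrite ?Hi.
Qed.

Lemma exchange_all (s : seq 'I_d) : uniq s -> all gen s ->
  exists (io : 'I_d -> nat) e w, [/\ lifts J v e w, {in s &, injective io} &
    forall l, l \in s -> [/\ (io l < size nu)%N, nth 0%N nu (io l) = h l & w (io l) = col l X]].
Proof.
elim: s => [|l0 s IH] /=.
  by move=> _ _; exists (fun=> 0%N); do 2!eexists; split; [exact: lifts_std | |].
move=> /andP[Hl0 Us] /andP[Gl0 Gs]; have [io [e [w [Hew Hinj Hio]]]] := IH Us Gs.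
have [|p [eh [Hp Hne Hlift]]] := exchange (S := mem s) (io := io) Hew Gl0 Hl0.
  by move=> l /Hio[].
pose io' l := if l == l0 then blk nu p else io l.
have E l : l \in s -> io' l = io l.
  by rewrite /io'; case: eqP => // -> H; rewrite H in Hl0.
exists io'; do 2!eexists; split; first exact: Hlift.
  move=> l l'; rewrite !inE.
  case/predU1P => [->|Hl]; case/predU1P => [->|Hl'] //.
  - by rewrite (E _ Hl') /io' eqxx => F; have := Hne _ Hl'; rewrite -F eqxx.
  - by rewrite (E _ Hl) /io' eqxx => F; have := Hne _ Hl; rewrite F eqxx.
  - by rewrite (E _ Hl) (E _ Hl'); apply: Hinj.
move=> l; rewrite inE => /predU1P[->|Hl].
  by rewrite /io' eqxx /upd eqxx Hp; split=> //; apply: reshape_indexP.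
rewrite E // /upd (negbTE (Hne _ Hl)); exact: Hio.
Qed.

Definition nswap (a b j : nat) : nat := if j == a then b else if j == b then a else j.

Lemma nswapK a b : involutive (nswap a b).
Proof.
move=> j; rewrite /nswap; have [->|Ha] := eqVneq j a.
  by rewrite eqxx; case: eqP.
by have [->|Hb] := eqVneq j b; rewrite ?eqxx // (negbTE Ha) (negbTE Hb).
Qed.

Variable io : 'I_d -> nat.
Hypothesis io_inj : {in gen &, injective io}.
Hypothesis io_nu : forall l, gen l -> nth 0%N nu (io l) = h l.

(** A normal form needs a placement that depends on the configuration alone, whereas [exchange]
    finds some part of the right size. Swapping two equal parts moves the new column to the
    prescribed place. *)
Lemma exchange_at (s : seq 'I_d) : uniq s -> all gen s ->
  exists e w, lifts J v e w /\ forall l, l \in s -> w (io l) = col l X.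
Proof.
elim: s => [|l0 s IH] /=.
  by move=> _ _; do 2!eexists; split; first exact: lifts_std.
move=> /andP[Hl0 Us] /andP[Gl0 Gs]; have [e [w [Hew Hio]]] := IH Us Gs.
have [p [eh [Hp Hne Hlift]]] := exchange (S := mem s) Hew Gl0 Hl0 Hio.
do 2!eexists; split.
  apply: lifts_perm (nswapK (io l0) (blk nu p)) _ Hlift => j; rewrite /nswap.
  case: eqP => [->|_]; first by rewrite Hp io_nu.
  by case: eqP => [->|//]; rewrite Hp io_nu.
move=> l; rewrite inE => /predU1P[->|Hl] /=; rewrite /nswap /upd.
  by rewrite !eqxx.
have Gl := allP Gs _ Hl.
have /negbTE Hn : io l != io l0.
  by apply: contraNneq Hl0 => /io_inj; rewrite -![_ \in _]/(gen _) => <-.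
have /negbTE Hn' := Hne _ Hl.
by rewrite Hn Hn' Hn' Hio.
Qed.

(** The generating columns already force every height, by [nakayama], so the relation at an
    unoccupied part [j0] is also obtained without [e j0]. Subtracting such a preimage from [e j0]
    makes its relation 0 and keeps coefficient 1 at its own generator. *)
Lemma kill_columns (s : seq nat) :
  (forall j, j \in s -> (0 < nth 0 nu j)%N /\ forall l, gen l -> io l != j) ->
  exists e w, [/\ lifts J v e w, forall l, gen l -> w (io l) = col l X &
    forall j, j \in s -> w j = 0].
Proof.
have HC := height_chain J v.
elim: s => [|j0 s IH] Hs.
  have [|e [w [Hew Hw]]] := exchange_at (enum_uniq gen).
    by apply/allP => l; rewrite mem_enum.
  by exists e, w; split=> // l Hl; apply: Hw; rewrite mem_enum.
have [|e [w [Hew Hw H0]]] := IH; first by move=> j Hj; apply: Hs; rewrite inE Hj orbT.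
have [Hj0 Hne] := Hs j0 (mem_head _ _).
set P := fam nu T e.
(* [C b] is the part of level [b] reached from vectors that avoid block [j0]. *)
pose C b (y : 'cV[k]_d) := exists (c : 'cV[k]_n) u0, (forall l : 'I_n, blk nu l = j0 -> c l 0 = 0) /\
   mpow T b (P *m c + col_mx u0 0) = col_mx (X *m y) 0.
have CC : chain tau C.
  split.
  - by move=> y; exists 0, (X *m y); split=> [l|]; rewrite ?mxE // mulmx0 add0r.
  - move=> b y z [c [u [Hc Hu]]] [c' [u' [Hc' Hu']]]; exists (c + c'), (u + u'); split.
      by move=> l Hl; rewrite mxE Hc // Hc' // addr0.
    have -> : P *m (c + c') + col_mx (u + u') 0 = P *m c + col_mx u 0 + (P *m c' + col_mx u' 0).
      by rewrite mulmxDr addrACA add_col_mx addr0.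
    by rewrite linearD /= Hu Hu' add_col_mx addr0 mulmxDr.
  - move=> b a y [c [u [Hc Hu]]]; exists (a *: c), (a *: u); split.
      by move=> l Hl; rewrite mxE Hc // mulr0.
    have -> : P *m (a *: c) + col_mx (a *: u) 0 = a *: (P *m c + col_mx u 0).
      by rewrite scalerDr -scalemxAr scale_col_mx scaler0.
    by rewrite linearZ /= Hu scale_col_mx scaler0 scalemxAr.
  - move=> b y [c [u [Hc Hu]]]; exists (N *m c), (J *m u + last_col nu w *m c); split.
      move=> l Hl; rewrite mxE big1 // => l' _; rewrite JpartE.
      by case: eqP => [E|]; rewrite ?mul0r // Hc ?mulr0 // -E.
    rewrite -Hu mpowSr; congr (mpow _ _ _).
    have HP : T *m P = P *m N + col_mx (last_col nu w) 0 := lifts_shift (proj1 Hew).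
    rewrite mulmxDr [T *m (P *m c)]mulmxA HP mulmxDl -[P *m N *m c]mulmxA -addrA; congr (_ + _).
    by rewrite mul_col_mx mul0mx -[T *m _]/(mpow T 1 _) extmx_up add_col_mx addr0 addrC.
  move=> b y [c [u [Hc Hu]]]; exists c, u; split=> //.
  by rewrite mpowS Hu -[T *m _]/(mpow T 1 _) extmx_up mulmxA -XJ -mulmxA.
have Cgen l : gen l -> C (h l) (delta_mx l 0).
  move=> Gl; have Hpos : (0 < nth 0 nu (io l))%N by rewrite io_nu //; case/andP: Gl.
  exists (delta_mx (bpos Hpos) 0), 0; split.
    move=> l' Hl'; rewrite mxE; case: eqP => // E; move: (Hne _ Gl).
    by rewrite -Hl' E blk_bpos eqxx.
  rewrite col_mx0 addr0 -!colE col_fam blk_bpos off_bpos /= -(io_nu Gl).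
  by rewrite (proj1 Hew) Hw.
have := nakayama nzE nz_lt nz_tight CC Cgen (height_graded (lifts_height j0 Hew)).
rewrite /C mulmxA XK mul1mx => -[c [u [Hc Hu]]].
have [Hw' HY] := Hew.
have := @lifts_replace _ _ _ _ _ e w (bpos Hj0) (e j0 - (P *m c + col_mx u 0)) 0 Hew.
rewrite blk_bpos off_bpos => H; exists (upd e j0 (e j0 - (P *m c + col_mx u 0))), (upd w j0 0).
split.
- apply: H => //; first by rewrite linearB /= Hw' Hu subrr col_mx0.
  have Ee : e j0 = P *m delta_mx (bpos Hj0) 0 by rewrite -colE col_fam blk_bpos off_bpos.
  have -> : dsubmx (e j0 - (P *m c + col_mx u 0)) = dsubmx P *m (delta_mx (bpos Hj0) 0 - c).
    by rewrite Ee !raddfB /= raddfD /= col_mxKd addr0 -!mul_dsub_mx.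
  by rewrite mulKmx // !mxE Hc ?blk_bpos // subr0 !eqxx oner_neq0.
- by move=> l Gl; rewrite /upd (negbTE (Hne _ Gl)) Hw.
move=> j; rewrite inE /upd; case: eqP => //= _; exact: H0.
Qed.

End Exchange.

Definition fits (k : fieldType) (d : nat) (A : 'M[k]_d) (C : nat -> 'cV[k]_d -> Prop)
    (tau : 'M[k]_d) (h : 'I_d -> nat) : Prop :=
  exists X : 'M[k]_d, [/\ X \in unitmx, (A *m X = X *m tau)%R &
    forall b y, C b (X *m y)%R <-> graded h b y].

(** * Classification by height configurations *)

(* A configuration [f] prescribes heights [h f] for a basis in which the nilpotent operator has
   matrix [tau f]; only the zero pattern [nz f] of that matrix, not its entries, matters for which
   configurations occur, and this is what makes the count independent of the field. *)
Section Classification.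
Local Open Scope ring_scope.
Variables (mu nu : seq nat) (d : nat) (F : finType) (valid : pred F).
Variables (h : F -> 'I_d -> nat) (nz : F -> rel 'I_d).
Variables (A : forall k : fieldType, 'M[k]_d) (tau std : forall k : fieldType, F -> 'M[k]_d).
Variables (Phi : forall k : fieldType, 'M[k]_(sumn mu, d)).
Variables (PhiV : forall k : fieldType, 'M[k]_(d, sumn mu)).
Hypothesis PhiK : forall k, Phi k *m PhiV k = 1%:M.
Hypothesis PhiVK : forall k, PhiV k *m Phi k = 1%:M.
Hypothesis PhiJ : forall k, Jpart k mu *m Phi k = Phi k *m A k.
Hypothesis stdU : forall k f, valid f -> std k f \in unitmx.
Hypothesis stdA : forall k f, valid f -> A k *m std k f = std k f *m tau k f.
Hypothesis nzE : forall k f l l', valid f -> (tau k f l l' != 0) = nz f l l'.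
Hypothesis nz_lt : forall f l l', valid f -> nz f l l' -> (h f l' < h f l)%N.
Hypothesis nz_tight : forall f l l' l'', valid f -> nz f l l' -> nz f l'' l' ->
  h f l = (h f l').+1 -> l'' = l \/ (h f l < h f l'')%N.
Hypothesis fits_ex : forall (k : fieldType) C, chain (A k) C ->
  (forall y, C (sumn mu + sumn nu)%N y -> y = 0) ->
  exists2 f, valid f & fits (A k) C (tau k f) (h f).
Hypothesis fits_uniq : forall (k : fieldType) f f' (R : 'M[k]_d), valid f -> valid f' ->
  R \in unitmx -> R *m tau k f = tau k f' *m R ->
  (forall b y, graded (h f) b y <-> graded (h f') b (R *m y)) -> f = f'.

Local Notation gen f := (generating (h f) (nz f)).

(** The extra element of the codomain keeps it inhabited when [nu] is empty; the first clause keeps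
    generating indices away from it. *)
Definition placement (f : F) (io : {ffun 'I_d -> 'I_(size nu).+1}) : bool :=
  [forall l, gen f l ==> ((io l < size nu)%N && (nth 0%N nu (io l) == h f l))] &&
  [forall l, forall l', [&& gen f l, gen f l' & io l == io l'] ==> (l == l')].

Definition realizable (f : F) : bool := [exists io, placement f io].

Definition place (f : F) : {ffun 'I_d -> 'I_(size nu).+1} :=
  odflt [ffun=> ord0] [pick io | placement f io].

Lemma placeP f : realizable f ->
  {in gen f &, injective (fun l => place f l : nat)} /\
  (forall l, gen f l -> nth 0%N nu (place f l) = h f l).
Proof.
rewrite /place /realizable => /existsP[io0 Hio0]; case: pickP => [io|/(_ io0)]; last by rewrite Hio0.
case/andP => /forallP H1 /forallP H2; split=> [l l' Gl Gl' E|l Gl].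
  have := forallP (H2 l) l'; rewrite -[gen f l]/(l \in gen f) Gl -[gen f l']/(l' \in gen f) Gl' /=.
  by move=> /implyP H; apply/eqP/H/eqP/val_inj.
by have := H1 l; rewrite Gl /= => /andP[_ /eqP].
Qed.

Definition normal_col (k : fieldType) (f : F) (j : nat) : 'cV[k]_(sumn mu) :=
  if [pick l | gen f l && (place f l == j :> nat)] is Some l then col l (Phi k *m std k f) else 0.

Definition normal_form (k : fieldType) (f : F) : 'M[k]_(sumn mu, sumn nu) :=
  last_col nu (normal_col k f).

Lemma normal_colE k f l : realizable f -> gen f l ->
  normal_col k f (place f l) = col l (Phi k *m std k f).
Proof.
move=> /placeP[Hinj _] Gl; rewrite /normal_col; case: pickP => [l' /andP[Gl' /eqP E]|/(_ l)].
  by rewrite (Hinj _ _ Gl' Gl E).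
by rewrite Gl eqxx.
Qed.

Definition vchain (k : fieldType) (v : 'M[k]_(sumn mu, sumn nu)) (b : nat) (y : 'cV[k]_d) : Prop :=
  height_ge (Jpart k mu) v b (Phi k *m y).

Section OneField.
Variable k : fieldType.
Local Notation J := (Jpart k mu).
Local Notation N := (Jpart k nu).
Implicit Types v : 'M[k]_(sumn mu, sumn nu).

Lemma PhiJV : PhiV k *m J = A k *m PhiV k.
Proof.
by rewrite -[LHS]mulmx1 -(PhiK k) mulmxA -(mulmxA (PhiV k)) PhiJ !mulmxA PhiVK mul1mx.
Qed.

Lemma vchain_chain v : chain (A k) (vchain v).
Proof.
have HC := height_chain J v; split=> [y|b y z|b a y|b y|b y]; rewrite /vchain.
- exact: (chain_top HC).
- by rewrite mulmxDr; apply: (chainD HC).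
- by rewrite -scalemxAr; apply: (chainZ HC).
- exact: (chain_pred HC).
by rewrite mulmxA -PhiJ -mulmxA; apply: (chain_mul HC).
Qed.

(** Since [N^n = 0], the image of [T^n] lies in [k^m], where [J^m] vanishes. Heights are thus
    bounded independently of the field, which lets configurations range over a finite type. *)
Lemma vchain_bounded v y : vchain v (sumn mu + sumn nu)%N y -> y = 0.
Proof.
case=> e He; rewrite -[y]mul1mx -(PhiVK k) -mulmxA.
suff -> : Phi k *m y = 0 by rewrite mulmx0.
have E : mpow (extmx J v) (sumn nu) e = col_mx (usubmx (mpow (extmx J v) (sumn nu) e)) 0.
  by rewrite -[LHS]vsubmxK dsub_extmx mpow_Jpart_nil.
move: He; rewrite mpow_add E extmx_up mpow_Jpart_nil => /(congr1 usubmx).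
by rewrite !col_mxKu.
Qed.

Section Fits.
Variables (v : 'M[k]_(sumn mu, sumn nu)) (f : F).
Hypothesis Vf : valid f.
Variable X : 'M[k]_d.
Hypothesis XU : X \in unitmx.
Hypothesis XA : A k *m X = X *m tau k f.
Hypothesis XC : forall b y, vchain v b (X *m y) <-> graded (h f) b y.

Let W : 'M[k]_(sumn mu, d) := Phi k *m X.
Let W' : 'M[k]_(d, sumn mu) := invmx X *m PhiV k.

Let WK : W *m W' = 1%:M. Proof. by rewrite /W /W' mulmxA mulmxK. Qed.
Let W'K : W' *m W = 1%:M.
Proof. by rewrite /W /W' mulmxA -(mulmxA (invmx X)) PhiVK mulmx1 mulVmx. Qed.
Let WJ : J *m W = W *m tau k f.
Proof. by rewrite /W mulmxA PhiJ -!mulmxA XA. Qed.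
Let WC b y : height_ge J v b (W *m y) <-> graded (h f) b y.
Proof. by have := XC b y; rewrite /vchain mulmxA. Qed.
Let nzEf l l' : (tau k f l l' != 0) = nz f l l'. Proof. exact: nzE. Qed.

Lemma fits_realizable : realizable f.
Proof.
have [io [e [w [_ Hinj Hio]]]] : exists (io : 'I_d -> nat) e w, [/\ lifts J v e w,
    {in enum (gen f) &, injective io} & forall l, l \in enum (gen f) ->
      [/\ (io l < size nu)%N, nth 0%N nu (io l) = h f l & w (io l) = col l W]].
  apply: (exchange_all WK W'K WJ nzEf (fun l l' => nz_lt Vf) WC (enum_uniq (gen f))).
  by apply/allP => l; rewrite mem_enum.
apply/existsP; exists [ffun l => inord (io l)].
have Hlt l : gen f l -> (io l < size nu)%N by move=> Gl; case: (Hio l) => //; rewrite mem_enum.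
apply/andP; split; apply/forallP => l.
  apply/implyP => Gl; rewrite ffunE inordK; last by rewrite ltnS ltnW // Hlt.
  by case: (Hio l); rewrite ?mem_enum // => -> -> _; rewrite eqxx.
apply/forallP => l'; apply/implyP => /and3P[Gl Gl' /eqP].
have Hlt' i : gen f i -> (io i < (size nu).+1)%N by move=> /Hlt /ltnW.
rewrite !ffunE => /(congr1 val); rewrite /= (inordK (Hlt' _ Gl)) (inordK (Hlt' _ Gl')) => E.
by apply/eqP/Hinj; rewrite ?mem_enum.
Qed.

Lemma fits_same_orbit : same_orbit v (normal_form k f).
Proof.
have Rf := fits_realizable; have [Hinj Hnu] := placeP Rf.
pose s := [seq j <- iota 0 (size nu) |
  (0 < nth 0 nu j)%N && [forall l, gen f l ==> (place f l != j :> nat)]].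
have [j|e [w [Hew Hw H0]]] := kill_columns WK W'K WJ nzEf (fun l l' => @nz_lt f l l' Vf)
    (fun l l' l'' => @nz_tight f l l' l'' Vf) WC Hinj Hnu (s := s).
  rewrite mem_filter => /andP[/andP[-> /forallP H] _]; split=> // l Gl.
  by have := H l; rewrite Gl.
pose S := std k f; have SU : S \in unitmx by apply: stdU.
have ES : invmx S *m A k = tau k f *m invmx S.
  by rewrite -[RHS](mulKmx SU) [S *m _]mulmxA -stdA // mulmxK.
(* [Z] takes the standard basis [Phi *m S] to the adapted basis [W]; [J] has matrix [tau] in both,
   so [Z] centralises [J]. *)
pose Z := W *m (invmx S *m PhiV k).
have ZV : (Phi k *m S *m W') *m Z = 1%:M.
  rewrite /Z mulmxA -(mulmxA _ W' W) W'K mulmx1 mulmxA mulmxK // PhiK //.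
apply: (lifts_same_orbit Hew (X := Z)).
- by case: (mulmx1_unit ZV).
- by rewrite /Z mulmxA WJ -!mulmxA PhiJV [tau k f *m _]mulmxA -ES -mulmxA.
move=> j Hj; rewrite /normal_col; case: pickP => [l /andP[Gl /eqP <-]|Hno].
  rewrite Hw // -col_mulmx; congr (col l _).
  by rewrite /Z -!mulmxA (mulmxA (PhiV k)) PhiVK mul1mx mulVmx // mulmx1.
rewrite mulmx0; apply: H0; rewrite mem_filter Hj mem_iota /= add0n.
apply/andP; split; last by rewrite ltnNge; apply: contraL Hj => H; rewrite nth_default.
by apply/forallP => l; have := Hno l; case: (gen f l) => //= ->.
Qed.

End Fits.

(** From right to left, the generating columns are relations of the standard generators, and
    [nakayama] propagates their heights. Conversely, [lifts_decomp] writes a vector of height [b]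
    through [J^b] and shifted relations, all in graded level [b]. So [f] can be read off its normal
    form. *)
Lemma normal_form_fits f : valid f -> realizable f ->
  forall b y, vchain (normal_form k f) b (std k f *m y) <-> graded (h f) b y.
Proof.
move=> Vf Rf b y; have [Hinj Hnu] := placeP Rf.
set v := normal_form k f; set S := std k f; have SU : S \in unitmx by apply: stdU.
have nzEf l l' : (tau k f l l' != 0) = nz f l l' by apply: nzE.
have HG := graded_chain nzEf (fun l l' => nz_lt Vf).
pose W := Phi k *m S; pose W' := invmx S *m PhiV k.
have WK : W *m W' = 1%:M by rewrite /W /W' mulmxA mulmxK.
have W'K : W' *m W = 1%:M by rewrite /W /W' mulmxA -(mulmxA (invmx S)) PhiVK mulmx1 mulVmx.
have WJ : J *m W = W *m tau k f by rewrite /W mulmxA PhiJ -!mulmxA stdA.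
have WJ' : W' *m J = tau k f *m W' := intertwine_inv WK W'K WJ.
have Hstd := lifts_std J v.
split; last first.
  apply: (nakayama nzEf (fun l l' => @nz_lt f l l' Vf) (fun l l' l'' => @nz_tight f l l' l'' Vf)
    (C := fun b y => vchain v b (S *m y))).
    have HC := vchain_chain v; split=> [z|c z z'|c a z|c z|c z].
    - exact: (chain_top HC).
    - by rewrite mulmxDr; apply: (chainD HC).
    - by rewrite -scalemxAr; apply: (chainZ HC).
    - exact: (chain_pred HC).
    by rewrite mulmxA -stdA // -mulmxA; apply: (chain_mul HC).
  move=> l Gl; rewrite /vchain mulmxA -colE -normal_colE // -(Hnu _ Gl).
  exists (col_mx 0 (std_gen k nu (place f l))); apply: std_relation.
  by rewrite Hnu //; case/andP: Gl.
rewrite /vchain mulmxA -/W => -[e He].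
have [_ [u0]] := lifts_decomp Hstd He; set c := invmx _ *m _ => Eu.
suff : graded (h f) b (W' *m (W *m y)) by rewrite mulmxA W'K mul1mx.
rewrite Eu mulmxDr; apply: (chainD HG).
  rewrite -(mpow_intertwine _ _ (esym WJ')) -[b]add0n.
  exact: (chain_mpow HG).
rewrite mulmx_sumr; apply: (chain_sum HG) => p Hp; rewrite -scalemxAr; apply: (chainZ HG).
rewrite -(mpow_intertwine _ _ (esym WJ')).
set i := (_ - _)%N; apply: (chain_le HG (c := (nth 0%N nu (blk nu p) + i)%N)).
  by rewrite subnKC // leq_addl.
apply: (chain_mpow HG); rewrite std_relation; last first.
  exact: leq_ltn_trans (leq0n _) (reshape_offsetP (ltn_ord p)).
rewrite col_mxKu /normal_col; case: pickP => [l /andP[Gl /eqP <-]|_]; last first.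
  by rewrite mulmx0; apply: (chain0 HG).
by rewrite colE mulmxA W'K mul1mx Hnu //; apply: graded_delta.
Qed.

End OneField.

Theorem classification_finite_type : finite_type mu nu.
Proof.
(* Neither [valid] nor [realizable] mentions a field. *)
exists #|[pred f | valid f && realizable f]| => k.
exists (fun i => normal_form k (enum_val i)); split=> [v|i j Hij].
  have [f Vf [X [XU XA XC]]] := fits_ex (vchain_chain v) (@vchain_bounded k v).
  have Rf := fits_realizable Vf XU XA XC.
  have Hf : f \in [pred f | valid f && realizable f] by rewrite inE Vf.
  exists (enum_rank_in Hf f); rewrite enum_rankK_in //.
  exact: (fits_same_orbit Vf XU XA XC).
have /andP[Vi Ri] := enum_valP i; have /andP[Vj Rj] := enum_valP j.
apply/enum_val_inj; move: Hij Vi Ri Vj Rj; move: (enum_val i) (enum_val j) => f f'.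
move=> /same_orbit_height[X [XU XJ HX]] Vf Rf Vf' Rf'.
(* [M] is the automorphism [X] in the coordinates [Phi]; conjugated by the standard bases it becomes
   an isomorphism of the two graded models, to which [fits_uniq] applies. *)
pose M := PhiV k *m X *m Phi k.
have EM y : Phi k *m (M *m y) = X *m (Phi k *m y).
  by rewrite /M !mulmxA PhiK mul1mx.
have SU := stdU k Vf; have SU' := stdU k Vf'.
have ES : invmx (std k f') *m A k = tau k f' *m invmx (std k f').
  by rewrite -[RHS](mulKmx SU') [std k f' *m _]mulmxA -stdA // mulmxK.
have EMA : A k *m M = M *m A k.
  by rewrite /M !mulmxA -PhiJV -(mulmxA (PhiV k)) XJ -!mulmxA PhiJ.
have MU : M \in unitmx.
  have : (PhiV k *m invmx X *m Phi k) *m M = 1%:M.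
    rewrite /M !mulmxA -(mulmxA _ (Phi k)) PhiK mulmx1 -(mulmxA _ (invmx X)) mulVmx //.
    by rewrite mulmx1 PhiVK.
  by case/mulmx1_unit.
apply: (fits_uniq (k := k) (R := invmx (std k f') *m M *m std k f) Vf Vf').
- by rewrite !unitmx_mul unitmx_inv SU' MU.
- rewrite -[LHS]mulmxA -stdA // mulmxA -[_ *m M *m _]mulmxA -EMA.
  by rewrite [tau k f' *m _]mulmxA [tau k f' *m _]mulmxA -ES !mulmxA.
move=> b y; rewrite -(mulmxA _ (std k f)) -(mulmxA _ M).
have := normal_form_fits (k := k) Vf Rf b y; have := normal_form_fits (k := k) Vf' Rf' b.
move=> /(_ (invmx (std k f') *m (M *m (std k f *m y)))); rewrite mulKVmx //.
rewrite {1}/vchain EM => H1 H2; rewrite -(propext H1) -(propext H2).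
by split; rewrite /vchain => /HX.
Qed.

End Classification.

(** * Common bases of two filtrations *)

Section AntitoneHeights.
Local Open Scope ring_scope.
Variables (k : fieldType) (d : nat).

Lemma unitmx_perm (M : 'M[k]_d) : M \in unitmx -> exists s : {perm 'I_d}, forall i, M i (s i) != 0.
Proof.
rewrite unitmxE unitfE => HM; have : exists s : {perm 'I_d}, \prod_i M i (s i) != 0.
  apply/existsP; apply: contraNT HM => /existsPn H; apply/eqP/big1 => s _.
  by have := H s; rewrite negbK => /eqP ->; rewrite mulr0.
by case=> s /prodf_neq0 H; exists s => i; apply: H.
Qed.

(** A nonzero term of the determinant gives a permutation with nonzero entries [M j (s j)]. If
    [g i < f i], it would map the indices from [i] on to indices strictly beyond [i], of which there
    are too few. *)
Lemma antitone_le (M : 'M[k]_d) (f g : 'I_d -> nat) : M \in unitmx ->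
  (forall i j : 'I_d, (i <= j)%N -> (f j <= f i)%N) ->
  (forall i j : 'I_d, (i <= j)%N -> (g j <= g i)%N) ->
  (forall i j, M i j != 0 -> (f j <= g i)%N) -> forall i, (f i <= g i)%N.
Proof.
move=> /unitmx_perm[s Hs] Hf Hg HM i; rewrite leqNgt; apply/negP => Hi.
pose S := [set j : 'I_d | (i <= j)%N].
have : (#|s @: S| < #|S|)%N.
  apply/proper_card/properP; split; last first.
    exists i; first by rewrite inE.
    apply/imsetP => -[j]; rewrite inE => Hj Es.
    have := HM _ _ (Hs j); rewrite -Es leqNgt; case/negP.
    exact: leq_ltn_trans (Hg _ _ Hj) Hi.
  apply/subsetP => j' /imsetP[j]; rewrite !inE => Hj ->.
  rewrite leqNgt; apply/negP => /ltnW H; have := HM _ _ (Hs j); rewrite leqNgt; case/negP.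
  by apply: leq_ltn_trans (Hg _ _ Hj) (leq_trans Hi _); apply: Hf.
by rewrite card_imset ?ltnn //; apply: perm_inj.
Qed.

Lemma antitone_eq (M M' : 'M[k]_d) (f g : 'I_d -> nat) : M' *m M = 1%:M ->
  (forall i j : 'I_d, (i <= j)%N -> (f j <= f i)%N) ->
  (forall i j : 'I_d, (i <= j)%N -> (g j <= g i)%N) ->
  (forall i j, M i j != 0 -> (f j <= g i)%N) ->
  (forall i j, M' i j != 0 -> (g j <= f i)%N) -> forall i, f i = g i.
Proof.
move=> /mulmx1_unit[HM' HM] Hf Hg H H' i; apply/eqP; rewrite eqn_leq.
by rewrite (antitone_le HM) // (antitone_le HM').
Qed.

End AntitoneHeights.

(** With [q < B], the number [p * B + q] encodes the lexicographic order, so that facts about single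
    heights apply to pairs. *)
Lemma lex_le (B p q p' q' : nat) : q < B -> q' < B -> p * B + q <= p' * B + q' -> p <= p'.
Proof.
move=> Hq Hq' /(leq_div2r B); have HB : 0 < B by apply: leq_ltn_trans Hq.
by rewrite !divnMDl // !divn_small // !addn0.
Qed.

Lemma lex_inj (B p q p' q' : nat) : q < B -> q' < B -> p * B + q = p' * B + q' ->
  p = p' /\ q = q'.
Proof.
move=> Hq Hq' E; have Ep : p = p'.
  by apply/eqP; rewrite eqn_leq (lex_le Hq Hq') ?E // (lex_le Hq' Hq) ?E.
by move: E; rewrite Ep => /addnI.
Qed.

Section TwoFiltrations.
Local Open Scope ring_scope.
Variables (k : fieldType) (d B : nat).

Lemma height_fun (F : nat -> 'cV[k]_d -> Prop) : chain 0 F -> (forall y, F B y -> y = 0) ->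
  exists ht : 'cV[k]_d -> nat, forall y, y != 0 -> (ht y < B)%N /\ forall b, F b y <-> (b <= ht y)%N.
Proof.
move=> HF FB.
have /choice[ht Hht] : forall y, exists b, y != 0 -> (b < B)%N /\ forall c, F c y <-> (c <= b)%N.
  move=> y; have [->|Hy] := eqVneq y 0; first by exists 0%N.
  have ub b : `[< F b y >] -> (b < B)%N.
    move=> /asboolP Hb; rewrite ltnNge; apply/negP => H.
    by case/eqP: Hy; apply/FB/(chain_le HF H).
  have ex0 : exists b, `[< F b y >] by exists 0%N; apply/asboolP/(chain_top HF).
  case: (ex_maxnP ex0 (fun b H => ltnW (ub b H))) => b Hb Hmax; exists b => _.
  split=> [|c]; first exact: ub.
  split=> [Hc|Hc]; first by apply/Hmax/asboolP.
  exact: (chain_le HF Hc (asboolW Hb)).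
by exists ht.
Qed.

(* A basis chosen greedily, each vector maximising [rho] outside the span of the previous ones. *)
Lemma greedy_basis (rho : 'cV[k]_d -> nat) (R : nat) : (forall y, y != 0 -> (rho y <= R)%N) ->
  exists P : 'M[k]_d, (forall i j : 'I_d, (i <= j)%N -> (rho (col j P) <= rho (col i P))%N) /\
    forall c : 'cV_d, c != 0 -> exists l : 'I_d,
      [/\ c l 0 != 0, P *m c != 0, (rho (P *m c) <= rho (col l P))%N &
        forall j : 'I_d, c j 0 != 0 -> (j <= l)%N].
Proof.
move=> HR.
pose greedy (s : seq 'cV[k]_d) := forall i, (i < size s)%N ->
   s`_i \notin <<take i s>>%VS /\
   forall u, u \notin <<take i s>>%VS -> (rho u <= rho (s`_i)%R)%N.
have [s [Hsize Hs]] : exists s, size s = d /\ greedy s.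
  suff H n : (n <= d)%N -> exists s, size s = n /\ greedy s by exact: H.
  elim: n => [|n IH] Hn; first by exists [::].
  have [s [Es Hs]] := IH (ltnW Hn).
  have Hex : exists r, `[< exists u, u \notin <<s>>%VS /\ rho u = r >].
    have /subvPn[u _ Hu] : ~~ ({:'cV[k]_d} <= <<s>>)%VS.
      apply/negP => /dimvS; rewrite dimvf /dim /= muln1 leqNgt; case/negP.
      by apply: leq_ltn_trans (dim_span s) _; rewrite Es.
    by exists (rho u); apply/asboolP; exists u.
  have Hub r : `[< exists u, u \notin <<s>>%VS /\ rho u = r >] -> (r <= R)%N.
    move=> /asboolP[u [Hu <-]]; apply: HR; apply: contraNneq Hu => ->; exact: mem0v.
  case: (ex_maxnP Hex Hub) => r /asboolP[u [Hu Eu]] Hmax.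
  exists (rcons s u); rewrite size_rcons Es; split=> // i.
  rewrite size_rcons ltnS leq_eqVlt => /orP[/eqP ->|Hi].
    rewrite nth_rcons ltnn eqxx -cats1 takel_cat // take_size; split=> // u' Hu'.
    by rewrite Eu; apply: Hmax; apply/asboolP; exists u'.
  by rewrite nth_rcons Hi -cats1 takel_cat ?(ltnW Hi) //; apply: Hs.
pose P : 'M[k]_d := \matrix_(i, j) s`_j i 0.
have colP' j : col j P = s`_j by apply/colP => i; rewrite !mxE.
have Hanti (i j : 'I_d) : (i <= j)%N -> (rho (col j P) <= rho (col i P))%N.
  move=> Hij; rewrite !colP'.
  have Hi : (i < size s)%N by rewrite Hsize.
  have Hj : (j < size s)%N by rewrite Hsize.
  have [_ Hmax] := Hs i Hi; apply: Hmax; have [Hn _] := Hs j Hj.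
  apply: contraNN Hn; apply/subvP/sub_span => x.
  by rewrite -(take_takel s Hij); apply: mem_take.
exists P; split=> // c Hc; have [l0 Hl0] : exists l0, c l0 0 != 0.
  by apply/existsP; apply: contraNT Hc => /existsPn H; apply/eqP/colP => l;
    have := H l; rewrite negbK mxE => /eqP.
(* For the last index [l] in the support of [c], the vector [P *m c] lies outside the span of the
   columns before [l], so it competed in the greedy choice of column [l]. *)
case: (@arg_maxnP _ l0 (fun l : 'I_d => c l 0 != 0) (fun l : 'I_d => l : nat) Hl0) => l Hl Hmax.
have Hout : P *m c \notin <<take l s>>%VS.
  have [Hn _] := Hs l (eq_ind_r (fun n => l < n)%N (ltn_ord l) Hsize).
  apply: contraNN Hn => HPc; rewrite -colP'.
  rewrite -[col l P](scalerK Hl) memvZ //.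
  have -> : c l 0 *: col l P = P *m c - \sum_(j | j != l) c j 0 *: col j P.
    by rewrite mulmx_sum_col (bigD1 l) //= addrK.
  apply: memvB => //; apply: memv_suml => j Hj.
  have [->|Hcj] := eqVneq (c j 0) 0; first by rewrite scale0r mem0v.
  apply/memvZ/memv_span; rewrite colP'.
  have Hjl : (j < l)%N by rewrite ltn_neqAle Hj; apply: Hmax.
  by rewrite -(nth_take 0 Hjl) mem_nth // size_takel ?Hsize // ltnW.
exists l; split=> //.
- by apply: contraNneq Hout => ->; apply: mem0v.
- rewrite colP'; have [_] := Hs l (eq_ind_r (fun n => l < n)%N (ltn_ord l) Hsize).
  exact.
Qed.

(* Since the pairs of heights come out sorted lexicographically, they are unique. *)
Lemma two_filtrations (F1 F2 : nat -> 'cV[k]_d -> Prop) : chain 0 F1 -> chain 0 F2 ->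
  (forall y, F1 B y -> y = 0) -> (forall y, F2 B y -> y = 0) ->
  exists (P : 'M[k]_d) (h1 h2 : 'I_d -> nat),
    [/\ P \in unitmx,
      forall i, (h1 i < B)%N /\ (h2 i < B)%N,
      forall b c, F1 b (P *m c) <-> graded h1 b c,
      forall b c, F2 b (P *m c) <-> graded h2 b c &
      forall i j : 'I_d, (i <= j)%N -> (h1 j * B + h2 j <= h1 i * B + h2 i)%N].
Proof.
move=> HF1 HF2 B1 B2.
have [t1 Ht1] := height_fun HF1 B1; have [t2 Ht2] := height_fun HF2 B2.
pose rho y := (t1 y * B + t2 y)%N.
have rho1 y z : y != 0 -> z != 0 -> (rho y <= rho z)%N -> (t1 y <= t1 z)%N.
  move=> Hy Hz; have [_ _] := Ht1 y Hy; have [Hy2 _] := Ht2 y Hy; have [Hz2 _] := Ht2 z Hz.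
  exact: lex_le.
have rho2 y z : (rho y <= rho z)%N -> (t1 z <= t1 y)%N -> (t2 y <= t2 z)%N.
  move=> H H'; rewrite -(leq_add2l (t1 y * B)); apply: leq_trans H _.
  by rewrite leq_add2r leq_mul2r H' orbT.
have HR y : y != 0 -> (rho y <= B * B + B)%N.
  move=> Hy; have [H1 _] := Ht1 y Hy; have [H2 _] := Ht2 y Hy.
  by rewrite leq_add // ?leq_mul // ltnW.
have [P [Hanti Hgr]] := greedy_basis HR.
have PU : P \in unitmx.
  apply: unitmx_inj => c HPc; apply/eqP; apply: contraTT isT => Hc.
  by have [l [_]] := Hgr c Hc; rewrite HPc eqxx.
have Pn (c : 'cV_d) : c != 0 -> P *m c != 0 by move=> Hc; have [l []] := Hgr c Hc.
have Pcn i : col i P != 0.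
  rewrite colE Pn //; apply/eqP => /colP/(_ i); rewrite !mxE !eqxx => /eqP.
  by rewrite oner_eq0.
exists P, (fun i => t1 (col i P)), (fun i => t2 (col i P)); split=> //.
- by move=> i; have [H1 _] := Ht1 _ (Pcn i); have [H2 _] := Ht2 _ (Pcn i).
- move=> b c; split=> [Hb j Hj|Hc]; last first.
    apply: (chain_mulmx HF1) => l Hl; have [_ ->] := Ht1 _ (Pcn l); exact: Hc.
  have c0 : c != 0 by apply: contraNneq Hj => ->; rewrite mxE.
  have [l [Hl HPc Hrho Hmax]] := Hgr c c0.
  have [_ Ht] := Ht1 _ HPc; apply: leq_trans (rho1 _ _ HPc (Pcn j) _); first by apply/Ht.
  by apply: leq_trans Hrho (Hanti _ _ (Hmax _ Hj)).
move=> b c; split=> [Hb|Hc]; last first.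
  apply: (chain_mulmx HF2) => l Hl; have [_ ->] := Ht2 _ (Pcn l); exact: Hc.
(* Terms of second height at least [b] may be discarded. If something remained, its last column [l]
   would have [t1] no larger than the whole, so the greedy choice would bound [t2] of the whole, at
   least [b], by that of column [l], which is less than [b]. *)
pose c' : 'cV[k]_d := \col_j (if (b <= t2 (col j P))%N then 0 else c j 0).
have Hc' : F2 b (P *m c').
  have -> : P *m c' = P *m c - P *m (\col_j (if (b <= t2 (col j P))%N then c j 0 else 0)).
    rewrite -mulmxBr; congr (P *m _); apply/colP => j; rewrite !mxE.
    by case: ifP; rewrite ?subrr ?subr0.
  apply: (chainB HF2) => //; apply: (chain_mulmx HF2) => l; rewrite mxE.
  by case: ifP; rewrite ?eqxx // => Hl _; have [_ ->] := Ht2 _ (Pcn l).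
have [c'0|c'n] := eqVneq c' 0.
  by move=> j Hj; apply: contraNT Hj => Hj; have /colP/(_ j) := c'0; rewrite !mxE (negbTE Hj) => ->.
have [l [Hl HPc Hrho Hmax]] := Hgr c' c'n.
have Hb2 : (b <= t2 (P *m c'))%N by have [_ <-] := Ht2 _ HPc.
have H1 : (t1 (col l P) <= t1 (P *m c'))%N.
  have [_ <-] := Ht1 _ HPc; apply: (chain_mulmx HF1) => j Hj.
  have [_ ->] := Ht1 _ (Pcn j); apply: rho1; rewrite ?Pcn //; exact: Hanti (Hmax _ Hj).
have := leq_trans Hb2 (rho2 _ _ Hrho H1).
by move=> Hbl; move: Hl; rewrite mxE Hbl eqxx.
Qed.

End TwoFiltrations.

(** * Change of coordinates from Jordan blocks to grouped bases *)

Section Reindex.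
Local Open Scope ring_scope.
Variables (k : fieldType) (s : seq nat) (d : nat) (pos : 'I_d -> 'I_(sumn s)).

Definition reindex_mx : 'M[k]_(sumn s, d) := \matrix_(q, l) (q == pos l)%:R.

Hypothesis pos_inj : injective pos.
Hypothesis pos_card : sumn s = d.

Lemma reindexVK : reindex_mx^T *m reindex_mx = 1%:M.
Proof.
apply/matrixP => l l'; rewrite !mxE (bigD1 (pos l)) //= big1 ?addr0 => [|q Hq].
  by rewrite !mxE eqxx mul1r (inj_eq pos_inj).
by rewrite !mxE (negbTE Hq) mul0r.
Qed.

Lemma reindexK : reindex_mx *m reindex_mx^T = 1%:M.
Proof.
have := reindexVK; move: reindex_mx reindex_mx^T; case: d / pos_card => M M'.
exact: mulmx1C.
Qed.

Lemma reindexJ (A : 'M[k]_d) : (forall l l', Jpart k s (pos l) (pos l') = A l l') ->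
  Jpart k s *m reindex_mx = reindex_mx *m A.
Proof.
move=> H; have -> : A = reindex_mx^T *m (Jpart k s *m reindex_mx).
  apply/matrixP => l l'; rewrite -H mxE (bigD1 (pos l)) //= big1 ?addr0 => [|q Hq]; last first.
    by rewrite !mxE (negbTE Hq) mul0r.
  rewrite !mxE eqxx mul1r (bigD1 (pos l')) //= big1 ?addr0 => [|q Hq]; last first.
    by rewrite !mxE (negbTE Hq) mulr0.
  by rewrite !mxE eqxx mulr1.
by rewrite mulmxA reindexK mul1mx.
Qed.

Lemma graded_unitmx (X : 'M[k]_d) (C : nat -> 'cV[k]_d -> Prop) (h : 'I_d -> nat) :
  (forall b, C b 0) -> (forall b y, C b (X *m y) -> graded h b y) -> X \in unitmx.
Proof.
move=> H0 H; apply: unitmx_inj => y Hy; apply/colP => l; rewrite mxE; apply/eqP/negPn/negP => Hl.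
by have := H (h l).+1 y; rewrite Hy => /(_ (H0 _) _ Hl); rewrite ltnn.
Qed.

End Reindex.

(** * The case (2^m2, 1^m1) *)

Section SquareZero.
Local Open Scope ring_scope.
Variables (m2 m1 : nat) (nu : seq nat).
Local Notation mu := (nseq m2 2%N ++ nseq m1 1%N).
Local Notation d := (m2 + m2 + m1)%N.
Local Notation B := (sumn mu + sumn nu)%N.

(** Coordinates by layer: [x] on the generators of the blocks of size 2, [w] on their images under
    the operator, [y] on the blocks of size 1. *)
Definition vec3 (k : fieldType) (p : nat) (x w : 'M[k]_(m2, p)) (y : 'M[k]_(m1, p)) : 'M[k]_(d, p) :=
  col_mx (col_mx x w) y.

Definition shift2 (k : fieldType) : 'M[k]_d := block_mx (block_mx 0 0 1%:M 0) 0 0 0.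

Lemma shift2_vec3 (k : fieldType) p (x w : 'M[k]_(m2, p)) (y : 'M[k]_(m1, p)) : shift2 k *m vec3 x w y = vec3 0 x 0.
Proof. by rewrite mul_block_col mul_block_col !mul0mx !mul1mx !addr0. Qed.

Lemma vec3D (k : fieldType) p (x w x' w' : 'M[k]_(m2, p)) (y y' : 'M[k]_(m1, p)) :
  vec3 x w y + vec3 x' w' y' = vec3 (x + x') (w + w') (y + y').
Proof. by rewrite /vec3 !add_col_mx. Qed.

Lemma vec3Z (k : fieldType) p a (x w : 'M[k]_(m2, p)) (y : 'M[k]_(m1, p)) : a *: vec3 x w y = vec3 (a *: x) (a *: w) (a *: y).
Proof. by rewrite /vec3 !scale_col_mx. Qed.

Lemma vec3_0 (k : fieldType) p : vec3 0 0 0 = 0 :> 'M[k]_(d, p).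
Proof. by rewrite /vec3 !col_mx0. Qed.

Lemma col_vec3 (k : fieldType) p (x w : 'M[k]_(m2, p)) (y : 'M[k]_(m1, p)) i : col i (vec3 x w y) = vec3 (col i x) (col i w) (col i y).
Proof. by rewrite /vec3 !col_col_mx. Qed.

Definition ht3 (hx hw : 'I_m2 -> nat) (hy : 'I_m1 -> nat) (l : 'I_d) : nat :=
  match split l with
  | inl p => match split p with inl i => hx i | inr i => hw i end
  | inr i => hy i
  end.

Lemma graded_vec3 (k : fieldType) hx hw hy b (x w : 'cV[k]_m2) (y : 'cV[k]_m1) :
  graded (ht3 hx hw hy) b (vec3 x w y) <-> [/\ graded hx b x, graded hw b w & graded hy b y].
Proof.
split=> [H|[Hx Hw Hy] l].
  split=> i Hi.
  - by have := H (lshift _ (lshift _ i)); rewrite /ht3 /vec3 !col_mxEu !(unsplitK (inl _)); apply.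
  - have := H (lshift _ (rshift _ i)).
    by rewrite /ht3 /vec3 col_mxEu col_mxEd !(unsplitK (inl _)) !(unsplitK (inr _)); apply.
  - by have := H (rshift _ i); rewrite /ht3 /vec3 col_mxEd !(unsplitK (inr _)); apply.
rewrite /vec3 /ht3 mxE; case: (split l) => [p|i]; last exact: Hy.
rewrite mxE; case: (split p) => i; [exact: Hx | exact: Hw].
Qed.

Definition nz3 (l l' : 'I_d) : bool :=
  match split l, split l' with
  | inl p, inl p' => match split p, split p' with inr i, inl i' => i == i' | _, _ => false end
  | _, _ => false
  end.

Lemma nz3E (k : fieldType) l l' : (shift2 k l l' != 0) = nz3 l l'.
Proof.
rewrite /nz3 mxE; case: (split l) => [p|i]; rewrite mxE; case: (split l') => [p'|i'];
  rewrite ?mxE ?eqxx //.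
case: (split p) => [q|q]; rewrite mxE; case: (split p') => [q'|q']; rewrite ?mxE ?eqxx //.
by case: (q == q'); rewrite ?mulr1n ?mulr0n ?oner_neq0 ?eqxx.
Qed.

Lemma nz3P l l' : nz3 l l' -> exists i, l = lshift _ (rshift _ i) /\ l' = lshift _ (lshift _ i).
Proof.
rewrite -(splitK l) -(splitK l') /nz3 !unsplitK.
case: (split l) => [p|//]; case: (split l') => [p'|//].
rewrite -(splitK p) -(splitK p') !unsplitK /=.
by case: (split p) => [//|i]; case: (split p') => [i' /eqP ->|//]; exists i'.
Qed.

Definition coord3 (l : 'I_d) : nat * nat :=
  match split l with
  | inl p => match split p with inl i => (i : nat, 0%N) | inr i => (i : nat, 1%N) end
  | inr i => ((m2 + i)%N, 0%N)
  end.

Lemma coord3P l : ((coord3 l).2 < nth 0 mu (coord3 l).1)%N.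
Proof.
rewrite /coord3; case: (split l) => [p|i]; last first.
  have E : (m2 + i < m2)%N = false by rewrite ltnNge leq_addr.
  by rewrite /= nth_cat size_nseq E addKn nth_nseq ltn_ord.
by case: (split p) => i; rewrite /= nth_cat size_nseq ltn_ord nth_nseq ltn_ord.
Qed.

Definition pos3 (l : 'I_d) : 'I_(sumn mu) := bpos (coord3P l).

Lemma pos3_inj : injective pos3.
Proof.
move=> l l' /(congr1 val) /= E; have E1 := congr1 (blk mu) E; have E2 := congr1 (off mu) E.
move: E1 E2; rewrite !flatten_indexKl ?flatten_indexKr ?coord3P //.
rewrite -(splitK l) -(splitK l') /coord3 !unsplitK.
case: (split l) => [p|i]; case: (split l') => [p'|i'] /=.
- rewrite -(splitK p) -(splitK p') !unsplitK.
  by case: (split p) => i; case: (split p') => i' //= /val_inj ->.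
- by case: (split p) => i /= E1 _; have := ltn_ord i; rewrite E1 ltnNge leq_addr.
- by case: (split p') => j /= E1 _; have := ltn_ord j; rewrite -E1 ltnNge leq_addr.
by move=> /addnI /val_inj ->.
Qed.

Lemma pos3J (k : fieldType) l l' : Jpart k mu (pos3 l) (pos3 l') = shift2 k l l'.
Proof.
rewrite JpartE !blk_bpos !off_bpos.
have -> : shift2 k l l' = (nz3 l l')%:R.
  have := nz3E k l l'; rewrite /nz3 mxE; case: (split l) => [p|i]; rewrite mxE; case: (split l') => [p'|i'];
  rewrite ?mxE //.
  case: (split p) => [q|q]; rewrite mxE; case: (split p') => [q'|q']; rewrite ?mxE //.
congr (_%:R); congr nat_of_bool; rewrite /coord3 /nz3.
case: (split l) => [p|i]; case: (split l') => [p'|i'] /=; rewrite ?andbF //.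
- case: (split p) => i; case: (split p') => i' /=; rewrite ?andbF ?andbT //.
- case: (split p) => i /=; rewrite ?andbF // andbT.
  by apply/negbTE; rewrite neq_ltn (leq_trans (ltn_ord i)) ?leq_addr.
Qed.

Lemma sumn3 : sumn mu = d.
Proof. by rewrite sumn_cat !sumn_nseq mul2n mul1n addnn. Qed.

Definition heights3 : finType := ({ffun 'I_m2 -> 'I_B * 'I_B} * {ffun 'I_m1 -> 'I_B})%type.

Definition hx3 (f : heights3) (i : 'I_m2) : nat := (f.1 i).1.
Definition hw3 (f : heights3) (i : 'I_m2) : nat := (f.1 i).2.
Definition hy3 (f : heights3) (i : 'I_m1) : nat := f.2 i.
Definition h3 (f : heights3) : 'I_d -> nat := ht3 (hx3 f) (hw3 f) (hy3 f).

(** Sorting makes a configuration canonical: it stands for a multiset of pairs of heights and a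
    multiset of single heights. *)
Definition valid3 (f : heights3) : bool :=
  [&& [forall i, hx3 f i < hw3 f i],
    [forall i : 'I_m2, forall j : 'I_m2, (i <= j) ==> (hx3 f j * B + hw3 f j <= hx3 f i * B + hw3 f i)] &
    [forall i : 'I_m1, forall j : 'I_m1, (i <= j) ==> (hy3 f j <= hy3 f i)]]%N.

Lemma nz3_lt f l l' : valid3 f -> nz3 l l' -> (h3 f l' < h3 f l)%N.
Proof.
case/and3P => /forallP H _ _ /nz3P[i [-> ->]].
by rewrite /h3 /ht3 !(unsplitK (inl _)) !(unsplitK (inr _)) ?(unsplitK (inl _)).
Qed.

Lemma nz3_tight f l l' l'' : valid3 f -> nz3 l l' -> nz3 l'' l' ->
  h3 f l = (h3 f l').+1 -> l'' = l \/ (h3 f l < h3 f l'')%N.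
Proof.
move=> _ /nz3P[i [-> E]] /nz3P[i' [-> E']] _; left.
by move: E'; rewrite E => /lshift_inj/lshift_inj ->.
Qed.

Section Existence.
Variables (k : fieldType) (C : nat -> 'cV[k]_d -> Prop).
Hypothesis HC : chain (shift2 k) C.
Hypothesis CB : forall y, C B y -> y = 0.

(* [F1] and [F2] are, on the image of the operator, the image of the filtration and its restriction:
   a basis adapted to both gives the heights of [x_i] and [t x_i]. *)
Let F1 b (x : 'cV[k]_m2) := exists w y, C b (vec3 x w y).
Let F2 b (w : 'cV[k]_m2) := C b (vec3 0 w 0).
(** This is the filtration induced on the kernel of the operator modulo its image. *)
Let F3 b (y : 'cV[k]_m1) := exists w, C b (vec3 0 w y).

Let vec3_inj (x w : 'cV[k]_m2) (y : 'cV[k]_m1) : vec3 x w y = 0 -> [/\ x = 0, w = 0 & y = 0].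
Proof. by rewrite -(vec3_0 k 1) => /eq_col_mx[/eq_col_mx[-> ->] ->]. Qed.

Let F1_chain : chain 0 F1.
Proof.
split.
- by move=> x; exists 0, 0; apply: (chain_top HC).
- move=> b x x' [w [y H]] [w' [y' H']]; exists (w + w'), (y + y').
  by rewrite -vec3D; apply: (chainD HC).
- by move=> b a x [w [y H]]; exists (a *: w), (a *: y); rewrite -vec3Z; apply: (chainZ HC).
- by move=> b x [w [y H]]; exists w, y; apply: (chain_pred HC).
by move=> b x _; rewrite mul0mx; exists 0, 0; rewrite vec3_0; apply: (chain0 HC).
Qed.

Let F2_chain : chain 0 F2.
Proof.
rewrite /F2; split.
- by move=> x; apply: (chain_top HC).
- move=> b x x' H H'; have -> : vec3 0 (x + x') 0 = vec3 0 x 0 + vec3 0 x' (0 : 'cV[k]_m1).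
    by rewrite vec3D !addr0.
  exact: (chainD HC).
- by move=> b a x H; have := chainZ HC a H; rewrite vec3Z !scaler0.
- by move=> b x; apply: (chain_pred HC).
by move=> b x _; rewrite mul0mx vec3_0; apply: (chain0 HC).
Qed.

Let F3_chain : chain 0 F3.
Proof.
split.
- by move=> x; exists 0; apply: (chain_top HC).
- move=> b x x' [w H] [w' H']; exists (w + w').
  by have := chainD HC H H'; rewrite vec3D addr0.
- by move=> b a x [w H]; exists (a *: w); have := chainZ HC a H; rewrite vec3Z scaler0.
- by move=> b x [w H]; exists w; apply: (chain_pred HC).
by move=> b x _; rewrite mul0mx; exists 0; rewrite vec3_0; apply: (chain0 HC).
Qed.

(** The operator identifies the layers [x] and [w], so one matrix [P] must serve both: hence the
    common basis of [F1] and [F2]. Columns are lifted to vectors attaining their heights, and the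
    levels of [C] are recovered for [x], then [y], then [w]. *)
Lemma fits3 : exists2 f, valid3 f & fits (shift2 k) C (shift2 k) (h3 f).
Proof.
have B1 x : F1 B x -> x = 0 by move=> [w [y /CB /vec3_inj[]]].
have B2 x : F2 B x -> x = 0 by move=> /CB /vec3_inj[].
have B3 x : F3 B x -> x = 0 by move=> [w /CB /vec3_inj[]].
have [P [hx [hw [PU hB HP1 HP2 Hanti]]]] := two_filtrations F1_chain F2_chain B1 B2.
have [Q [hy [hy' [QU hB' HQ _ Hanti']]]] := two_filtrations F3_chain F3_chain B3 B3.
have /choice[u Hu] : forall i, exists wy : 'cV[k]_m2 * 'cV[k]_m1,
    C (hx i) (vec3 (col i P) wy.1 wy.2).
  move=> i; have [w [y H]] : F1 (hx i) (col i P).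
    by rewrite colE; apply/HP1/graded_delta.
  by exists (w, y).
have /choice[w Hw] : forall i, exists w, C (hy i) (vec3 0 w (col i Q)).
  by move=> i; rewrite colE; apply/HQ/graded_delta.
pose U1 : 'M[k]_m2 := \matrix_(p, i) (u i).1 p 0.
pose U2 : 'M[k]_(m1, m2) := \matrix_(p, i) (u i).2 p 0.
pose W : 'M[k]_(m2, m1) := \matrix_(p, i) w i p 0.
have cU1 i : col i U1 = (u i).1 by apply/colP => p; rewrite !mxE.
have cU2 i : col i U2 = (u i).2 by apply/colP => p; rewrite !mxE.
have cW i : col i W = w i by apply/colP => p; rewrite !mxE.
have CU b x : graded hx b x -> C b (vec3 P U1 U2 *m x).
  move=> Hx; apply: (chain_mulmx HC) => i Hi; apply: (chain_le HC (Hx _ Hi)).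
  by rewrite col_vec3 cU1 cU2.
have CW b y : graded hy b y -> C b (vec3 0 W Q *m y).
  move=> Hy; apply: (chain_mulmx HC) => i Hi; apply: (chain_le HC (Hy _ Hi)).
  by rewrite col_vec3 cW col0.
have CP b x : graded hw b x <-> C b (vec3 0 (P *m x) 0) by rewrite -HP2.
pose X : 'M[k]_d := row_mx (row_mx (vec3 P U1 U2) (vec3 0 P 0)) (vec3 0 W Q).
have EX x z y : X *m vec3 x z y = vec3 P U1 U2 *m x + vec3 0 (P *m z) 0 + vec3 0 W Q *m y.
  by rewrite /X /vec3 !mul_row_col !mul_col_mx !mul0mx.
have HX b x z y : C b (X *m vec3 x z y) <-> [/\ graded hx b x, graded hw b z & graded hy b y].
  rewrite EX; split=> [H|[Hx Hz Hy]]; last first.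
    by apply: (chainD HC); [apply: (chainD HC); [exact: CU | exact/CP] | exact: CW].
  have Hx : graded hx b x.
    apply/HP1; move: H; rewrite /vec3 !mul_col_mx !add_col_mx mul0mx !addr0 => H.
    by do 2!eexists; exact: H.
  have {}H : C b (vec3 0 (P *m z) 0 + vec3 0 W Q *m y).
    by apply: (chainDl HC (CU _ _ Hx)); rewrite addrA.
  have Hy : graded hy b y.
    apply/HQ; move: H; rewrite /vec3 !mul_col_mx !add_col_mx mul0mx !add0r => H.
    by eexists; exact: H.
  by split=> //; apply/CP/(chainDr HC (CW _ _ Hy)).
have [f Ef] : exists f : heights3, [/\ hx3 f =1 hx, hw3 f =1 hw & hy3 f =1 hy].
  exists ([ffun i => (Ordinal (hB i).1, Ordinal (hB i).2)], [ffun i => Ordinal (hB' i).1]).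
  by split=> i; rewrite /hx3 /hw3 /hy3 /= !ffunE.
have {}HX b x : C b (X *m x) <-> graded (h3 f) b x.
  case: Ef => /funext E1 /funext E2 /funext E3.
  rewrite -[x]vsubmxK -[usubmx x]vsubmxK -/(vec3 _ _ _) /h3 E1 E2 E3.
  by split=> [/HX/graded_vec3 | /graded_vec3/HX].
exists f.
  case: Ef => E1 E2 E3; apply/and3P; split; apply/forallP => i.
  - rewrite E1 E2.
    have : C (hx i).+1 (vec3 0 (P *m delta_mx i 0) 0).
      rewrite -colE -(shift2_vec3 _ (col i U1) (col i U2)); apply: (chain_mul HC).
      by rewrite cU1 cU2.
    by move/CP => /(_ i); rewrite mxE !eqxx oner_neq0; apply.
  - by apply/forallP => j; apply/implyP => Hij; rewrite !E1 !E2 Hanti.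
  - apply/forallP => j; apply/implyP => Hij; rewrite !E3.
    by apply: lex_le (hB' j).2 (hB' i).2 _; apply: Hanti'.
exists X; split=> //.
  by apply: (graded_unitmx (C := C) (h := h3 f)) => [b|b y /HX //]; apply: (chain0 HC).
rewrite /X !mul_mx_row !shift2_vec3 !vec3_0 /shift2 mul_row_block mul_row_block.
by rewrite !mulmx0 !mulmx1 !add0r !addr0.
Qed.

End Existence.

Lemma vec3P (k : fieldType) p (z : 'M[k]_(d, p)) : exists x w y, z = vec3 x w y.
Proof.
by exists (usubmx (usubmx z)), (dsubmx (usubmx z)), (dsubmx z); rewrite /vec3 !vsubmxK.
Qed.

Lemma eq_vec3 (k : fieldType) p (x w x' w' : 'M[k]_(m2, p)) (y y' : 'M[k]_(m1, p)) :
  vec3 x w y = vec3 x' w' y' -> [/\ x = x', w = w' & y = y'].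
Proof. by case/eq_col_mx => /eq_col_mx[-> ->] ->. Qed.

Lemma mul_vec3 (k : fieldType) p q (x w : 'M[k]_(m2, p)) (y : 'M[k]_(m1, p)) (z : 'M[k]_(p, q)) :
  vec3 x w y *m z = vec3 (x *m z) (w *m z) (y *m z).
Proof. by rewrite /vec3 !mul_col_mx. Qed.

Lemma shift2_comm (k : fieldType) (R : 'M[k]_d) : R *m shift2 k = shift2 k *m R ->
  exists M1 M2 M3 M4 M5, forall p (x w : 'M[k]_(m2, p)) (y : 'M[k]_(m1, p)),
    R *m vec3 x w y = vec3 (M1 *m x) (M2 *m x + M1 *m w + M4 *m y) (M3 *m x + M5 *m y).
Proof.
move=> RA; have [M1 [M2 [M3 E1]]] := vec3P (R *m vec3 1%:M 0 0).
have [M0 [M4 [M5 E3]]] := vec3P (R *m vec3 0 0 1%:M).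
have E2 : R *m vec3 0 1%:M 0 = vec3 0 M1 0.
  by rewrite -(shift2_vec3 1%:M 0 0) mulmxA RA -mulmxA E1 shift2_vec3.
have M00 : M0 = 0.
  have : shift2 k *m (R *m vec3 0 0 1%:M) = 0.
    by rewrite mulmxA -RA -mulmxA shift2_vec3 vec3_0 mulmx0.
  by rewrite E3 shift2_vec3 -(vec3_0 _ _) => /eq_vec3[].
exists M1, M2, M3, M4, M5 => p x w y.
have -> : vec3 x w y = vec3 1%:M 0 0 *m x + vec3 0 1%:M 0 *m w + vec3 0 0 1%:M *m y.
  by rewrite !mul_vec3 !vec3D !mul0mx !mul1mx !addr0 !add0r.
rewrite !mulmxDr !mulmxA E1 E2 E3 M00 !mul_vec3 !vec3D.
by rewrite !mul0mx !addr0.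
Qed.

Lemma shift2_heights (k : fieldType) f f' (R : 'M[k]_d) M1 M2 M3 M4 M5 :
  (forall b y, graded (h3 f) b y -> graded (h3 f') b (R *m y)) ->
  (forall p (x w : 'M[k]_(m2, p)) (y : 'M[k]_(m1, p)),
    R *m vec3 x w y = vec3 (M1 *m x) (M2 *m x + M1 *m w + M4 *m y) (M3 *m x + M5 *m y)) ->
  (forall i j, M1 i j != 0 -> (hx3 f j <= hx3 f' i)%N /\ (hw3 f j <= hw3 f' i)%N) /\
  (forall i j, M5 i j != 0 -> (hy3 f j <= hy3 f' i)%N).
Proof.
move=> HR E; have g0 n (h : 'I_n -> nat) b : graded h b (0 : 'cV[k]_n).
  by move=> l; rewrite mxE eqxx.
have Eij n (M : 'M[k]_n) i j : M i j = (M *m delta_mx j 0 : 'cV_n) i 0.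
  by rewrite -colE mxE.
split=> [i j Hij|i j Hij]; rewrite Eij in Hij; first split.
- have : graded (h3 f) (hx3 f j) (vec3 (delta_mx j 0) 0 (0 : 'cV[k]_m1)).
    by apply/graded_vec3; split=> //; apply: graded_delta.
  by move/HR; rewrite E => /graded_vec3[H _ _]; apply: H.
- have : graded (h3 f) (hw3 f j) (vec3 0 (delta_mx j 0) (0 : 'cV[k]_m1)).
    by apply/graded_vec3; split=> //; apply: graded_delta.
  by move/HR; rewrite E !mulmx0 addr0 add0r => /graded_vec3[_ H _]; apply: H.
have : graded (h3 f) (hy3 f j) (vec3 0 (0 : 'cV[k]_m2) (delta_mx j 0)).
  by apply/graded_vec3; split=> //; apply: graded_delta.
by move/HR; rewrite E !mulmx0 !add0r => /graded_vec3[_ _ H]; apply: H.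
Qed.

(** The blocks [M1] and [M5] of [R] have the corresponding blocks of its inverse as left inverses.
    [M1] acts on both [x] and [w], so it respects both heights and their lexicographic encoding, and
    [antitone_eq] applies to the sorted heights. *)
Lemma uniq3 (k : fieldType) f f' (R : 'M[k]_d) : valid3 f -> valid3 f' -> R \in unitmx ->
  R *m shift2 k = shift2 k *m R ->
  (forall b y, graded (h3 f) b y <-> graded (h3 f') b (R *m y)) -> f = f'.
Proof.
move=> Vf Vf' RU RA HR; have RA' := esym (comm_inv RU (esym RA)).
have [M1 [M2 [M3 [M4 [M5 E]]]]] := shift2_comm RA.
have [M1' [M2' [M3' [M4' [M5' E']]]]] := shift2_comm RA'.
have K1 : M1' *m M1 = 1%:M.
  have := E' _ (0 : 'M_(m2, m2)) M1 0; have := E _ (0 : 'M_(m2, m2)) 1%:M 0.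
  rewrite !mulmx0 !mulmx1 !add0r !addr0 => <-; rewrite mulKmx // => /eq_vec3[] //.
have K5 : M5' *m M5 = 1%:M.
  have := E' _ (0 : 'M_(m2, m1)) M4 M5; have := E _ (0 : 'M_(m2, m1)) 0 1%:M.
  rewrite !mulmx0 !mulmx1 !add0r => <-; rewrite mulKmx // => /eq_vec3[] //.
have HR' b y : graded (h3 f') b y -> graded (h3 f) b (invmx R *m y).
  by move=> Hy; apply/HR; rewrite mulKVmx.
have [Hxw Hy] := shift2_heights (fun b y => (HR b y).1) E.
have [Hxw' Hy'] := shift2_heights HR' E'.
case/and3P: Vf => _ /forallP A1 /forallP A2; case/and3P: Vf' => _ /forallP A1' /forallP A2'.
have Ey i : hy3 f i = hy3 f' i.
  apply: (antitone_eq K5) => // {}i j Hij.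
    by have /forallP/(_ j)/implyP := A2 i; apply.
  by have /forallP/(_ j)/implyP := A2' i; apply.
have Exw i : (hx3 f i * B + hw3 f i = hx3 f' i * B + hw3 f' i)%N.
  apply: (antitone_eq (f := fun i => (hx3 f i * B + hw3 f i)%N)
     (g := fun i => (hx3 f' i * B + hw3 f' i)%N) K1) => {}i j Hij.
  - by have /forallP/(_ j)/implyP := A1 i; apply.
  - by have /forallP/(_ j)/implyP := A1' i; apply.
  - by have [H1 H2] := Hxw _ _ Hij; rewrite leq_add // leq_mul2r H1 orbT.
  - by have [H1 H2] := Hxw' _ _ Hij; rewrite leq_add // leq_mul2r H1 orbT.
case: f f' {HR HR' A1 A2 A1' A2' Hxw Hxw' Hy Hy'} Ey Exw => f1 f2 [f1' f2'] Ey Exw.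
congr pair; apply/ffunP => i; last exact/val_inj/Ey.
have [] := lex_inj (ltn_ord _) (ltn_ord _) (Exw i).
by rewrite /hx3 /hw3 /=; case: (f1 i) (f1' i) => a b [a' b'] /= /val_inj -> /val_inj ->.
Qed.

End SquareZero.

Theorem finite_type_square_zero (m2 m1 : nat) (nu : seq nat) :
  finite_type (nseq m2 2 ++ nseq m1 1) nu.
Proof.
have Hinj := @pos3_inj m2 m1; have Hcard := sumn3 m2 m1.
apply: (@classification_finite_type _ _ _ (heights3 m2 m1 nu) (@valid3 m2 m1 nu) (@h3 m2 m1 nu)
  (fun _ => @nz3 m2 m1) (fun k => shift2 m2 m1 k) (fun k _ => shift2 m2 m1 k)
  (fun k _ => 1%:M%R) (fun k => reindex_mx k (@pos3 m2 m1))
  (fun k => (reindex_mx k (@pos3 m2 m1))^T%R)).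
- by move=> k; exact: (reindexK k Hinj Hcard).
- by move=> k; exact: (reindexVK k Hinj).
- by move=> k; apply: (reindexJ Hinj Hcard) => l l'; apply: pos3J.
- by move=> k f _; apply: unitmx1.
- by move=> k f _; rewrite mulmx1 mul1mx.
- by move=> k f l l' _; apply: nz3E.
- exact: nz3_lt.
- exact: nz3_tight.
- by move=> k C HC CB; apply: fits3.
- exact: uniq3.
Qed.

(** * Vectors of maximal height and a single Jordan block *)

Lemma natb_neq0 (k : fieldType) (b : bool) : (b%:R != 0 :> k)%R = b.
Proof. by case: b; rewrite ?mulr1n ?mulr0n ?oner_neq0 ?eqxx. Qed.

Lemma chain_weaken (k : fieldType) (d : nat) (A : 'M[k]_d) C : chain A C -> chain (0%R : 'M_d) C.
Proof.
move=> HC; split=> *; [exact: (chain_top HC) | exact: (chainD HC) | exact: (chainZ HC) |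
  exact: (chain_pred HC) | by rewrite mul0mx; apply: (chain0 HC)].
Qed.

Section MaxHeight.
Local Open Scope ring_scope.
Variables (k : fieldType) (d B : nat) (A : 'M[k]_d) (C : nat -> 'cV[k]_d -> Prop).
Hypothesis HC : chain A C.
Hypothesis CB : forall y, C B y -> y = 0.

Lemma max_height (P : 'cV[k]_d -> Prop) : (exists y, P y) -> (forall y, P y -> y != 0) ->
  exists x h, [/\ P x, C h x, (h < B)%N & forall y b, P y -> C b y -> (b <= h)%N].
Proof.
move=> [y0 Py0] Pn.
have ub b y : P y -> C b y -> (b < B)%N.
  move=> Py Cy; rewrite ltnNge; apply/negP => H; have := Pn y Py.
  by rewrite (CB (chain_le HC H Cy)) eqxx.
have ex0 : exists b, `[< exists y, P y /\ C b y >].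
  by exists 0%N; apply/asboolP; exists y0; split=> //; apply: (chain_top HC).
have ub' b : `[< exists y, P y /\ C b y >] -> (b <= B)%N.
  by move=> /asboolP[y [Py Cy]]; apply/ltnW/(ub _ _ Py Cy).
case: (ex_maxnP ex0 ub') => h /asboolP[x [Px Cx]] Hmax; exists x, h; split=> //.
  exact: ub Px Cx.
by move=> y b Py Cy; apply: Hmax; apply/asboolP; exists y.
Qed.

End MaxHeight.

Section JordanBlock.
Local Open Scope ring_scope.
Variables (k : fieldType) (r : nat).
Local Notation Jb := (Jblock k r).

Lemma Jblock_shift b (a : 'cV[k]_r) (i i' : 'I_r) : i' = (b + i)%N :> nat -> mpow Jb b a i' 0 = a i 0.
Proof.
elim: b i' => [|b IH] i' E; first by congr (a _ 0); apply: val_inj.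
have Hi : (b + i < r)%N by rewrite (leq_trans _ (ltn_ord i')) // E addSn.
rewrite mpowS mxE (bigD1 (Ordinal Hi)) //= big1 ?addr0 => [|j Hj].
  by rewrite mxE E addSn eqxx mul1r IH.
rewrite mxE E addSn eqSS; case: eqP => [F|]; last by rewrite mul0r.
by case/eqP: Hj; apply: val_inj.
Qed.

Lemma Jblock_shift0 b (a : 'cV[k]_r) (i : 'I_r) : (i < b)%N -> mpow Jb b a i 0 = 0.
Proof.
elim: b i => // b IH i H; rewrite mpowS mxE big1 // => j _.
rewrite mxE; case: eqP => [E|]; last by rewrite mul0r.
by rewrite IH ?mulr0 // -ltnS -E.
Qed.

Lemma mul_Jblock p (S : 'M[k]_(r, p)) (e i : 'I_r) (j : 'I_p) : e = i.+1 :> nat ->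
  (Jb *m S) e j = S i j.
Proof.
move=> E; rewrite mxE (bigD1 i) //= big1 ?addr0 => [|l Hl]; first by rewrite mxE E eqxx mul1r.
rewrite mxE E eqSS; case: eqP => [F|]; last by rewrite mul0r.
by case/eqP: Hl; apply: val_inj.
Qed.

Lemma mul_Jblock0 p (S : 'M[k]_(r, p)) (e : 'I_r) (j : 'I_p) : e = 0%N :> nat ->
  (Jb *m S) e j = 0.
Proof. by move=> E; rewrite mxE big1 // => l _; rewrite mxE E mul0r. Qed.

End JordanBlock.

(** * The case (r, 1^m1) *)

Section Hook.
Local Open Scope ring_scope.
Variables (r m1 : nat) (nu : seq nat).
Hypothesis r_gt1 : (1 < r)%N.
Local Notation mu := (r :: nseq m1 1%N).
Local Notation d := (r + m1)%N.
Local Notation B := (sumn mu + sumn nu)%N.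
Local Notation Jb k := (Jblock k r).

Let i0 : 'I_r := Ordinal (ltnW r_gt1).
Let ilast_proof : (r.-1 < r)%N. Proof. by rewrite prednK // ltnW. Qed.
Let ilast : 'I_r := Ordinal ilast_proof.

Definition hshift (k : fieldType) : 'M[k]_d := block_mx (Jb k) 0 0 0.

Definition hook_heights : finType := ({ffun 'I_r -> 'I_B} * {ffun 'I_m1 -> 'I_B * 'I_B})%type.

Implicit Type f : hook_heights.
(* [hx f e] is the height of [t^e x], where [x] generates the long block. The [i]-th block of size 1
   is spanned by some [y_i] of height [s2 f i]; when [s2 f i < s1 f i] (a pivot), [y_i + t^e x] has the
   larger height [s1 f i] for the [e] with [hx f e = s2 f i], and replaces [y_i] in the basis. *)
Definition hx f (e : 'I_r) : nat := f.1 e.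
Definition s1 f (i : 'I_m1) : nat := (f.2 i).1.
Definition s2 f (i : 'I_m1) : nat := (f.2 i).2.
Definition piv f i : bool := (s2 f i < s1 f i)%N.
Definition hh f (l : 'I_d) : nat := match split l with inl e => hx f e | inr i => s1 f i end.

Definition pivmx (k : fieldType) f : 'M[k]_(r, m1) :=
  \matrix_(e, i) (piv f i && (hx f e == s2 f i))%:R.

(** A pivot vector [y_i + t^e x] is no longer killed by the operator: it goes to [t^(e+1) x], which
    gives the block [Jb *m pivmx]. *)
Definition tauh (k : fieldType) f : 'M[k]_d := block_mx (Jb k) (Jb k *m pivmx k f) 0 0.
Definition stdh (k : fieldType) f : 'M[k]_d := block_mx 1%:M (pivmx k f) 0 1%:M.

(** A pivot has [e > 0], because [x] is chosen of greatest height, and lies below the socle, because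
    corrections by the socle are already allowed in [s2]. The bound [s1 f i < hx f e'] makes the
    operator raise heights; the fourth clause says that distinct pivots use distinct powers. *)
Definition validh f : bool :=
  [&& [forall e : 'I_r, forall e' : 'I_r, (e < e') ==> (hx f e < hx f e')],
    [forall i, s2 f i <= s1 f i],
    [forall i, piv f i ==> [exists e : 'I_r, exists e' : 'I_r,
      [&& 0 < e, e' == e.+1 :> nat, hx f e == s2 f i & s1 f i < hx f e']]],
    [forall i, forall i', [&& piv f i, piv f i' & s2 f i == s2 f i'] ==> (i == i')] &
    [forall i : 'I_m1, forall j : 'I_m1, (i <= j) ==> (s1 f j * B + s2 f j <= s1 f i * B + s2 f i)]]%N.

Lemma validhP f : validh f -> [/\ forall e e' : 'I_r, (e < e')%N -> (hx f e < hx f e')%N,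
  forall i, (s2 f i <= s1 f i)%N,
  forall i, piv f i -> exists e e' : 'I_r,
    [/\ (0 < e)%N, e' = e.+1 :> nat, hx f e = s2 f i & (s1 f i < hx f e')%N],
  forall i i', piv f i -> piv f i' -> s2 f i = s2 f i' -> i = i' &
  forall i j : 'I_m1, (i <= j)%N -> (s1 f j * B + s2 f j <= s1 f i * B + s2 f i)%N].
Proof.
case/and5P => /forallP H1 /forallP H2 /forallP H3 /forallP H4 /forallP H5; split=> //.
- by move=> e e' He; have /forallP/(_ e')/implyP := H1 e; apply.
- move=> i Hi; have /implyP/(_ Hi)/existsP[e /existsP[e']] := H3 i.
  by case/and4P => E1 /eqP E2 /eqP E3 E4; exists e, e'.
- move=> i i' Hi Hi' E; have /forallP/(_ i')/implyP := H4 i.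
  by rewrite Hi Hi' E eqxx => /(_ isT)/eqP.
- by move=> i j Hij; have /forallP/(_ j)/implyP := H5 i; apply.
Qed.

Lemma hx_inj f : validh f -> injective (hx f).
Proof.
case/validhP => H _ _ _ _ e e' E; apply: val_inj.
by case: (ltngtP e e') => // /H; rewrite E ltnn.
Qed.

Definition nzh f (l l' : 'I_d) : bool :=
  match split l, split l' with
  | inl e, inl e' => e == e'.+1 :> nat
  | inl e, inr i => [exists e0 : 'I_r, [&& e == e0.+1 :> nat, piv f i & hx f e0 == s2 f i]]
  | _, _ => false
  end.

Lemma nzhE k f l l' : (tauh k f l l' != 0) = nzh f l l'.
Proof.
rewrite /nzh mxE; case: (split l) => [e|i]; rewrite mxE; case: (split l') => [e'|i'].
- by rewrite mxE natb_neq0.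
- case: (posnP e) => He.
    rewrite mul_Jblock0 // eqxx; apply/esym/existsP => -[e0 /and3P[/eqP]].
    by rewrite He.
  have Hp : (e.-1 < r)%N by rewrite (leq_ltn_trans (leq_pred _)).
  rewrite (@mul_Jblock _ _ _ _ e (Ordinal Hp)) /= ?prednK // mxE natb_neq0.
  apply/idP/existsP => [H|[e0 /and3P[/eqP E H1 H2]]].
    by exists (Ordinal Hp); rewrite /= prednK // eqxx.
  have -> : Ordinal Hp = e0 by apply: val_inj; rewrite /= E.
  by rewrite H1.
- by rewrite mxE eqxx.
- by rewrite mxE eqxx.
Qed.

Lemma nzh_cases f l l' : nzh f l l' ->
  exists2 e : 'I_r, l = lshift _ e & (exists2 e' : 'I_r, l' = lshift _ e' & e = e'.+1 :> nat) \/
    exists i (e0 : 'I_r), [/\ l' = rshift _ i, e = e0.+1 :> nat, piv f i & hx f e0 = s2 f i].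
Proof.
rewrite -(splitK l) -(splitK l') /nzh !unsplitK.
case: (split l) => [e|//]; case: (split l') => [e'|i] /=.
  by move=> /eqP E; exists e => //; left; exists e'.
by move=> /existsP[e0 /and3P[/eqP E P /eqP H]]; exists e => //; right; exists i, e0.
Qed.

Lemma hh_l f e : hh f (lshift _ e) = hx f e. Proof. by rewrite /hh (unsplitK (inl _)). Qed.
Lemma hh_r f i : hh f (rshift _ i) = s1 f i. Proof. by rewrite /hh (unsplitK (inr _)). Qed.

Lemma nzh_lt f l l' : validh f -> nzh f l l' -> (hh f l' < hh f l)%N.
Proof.
move=> Vf; have [V1 _ V3 _ _] := validhP Vf.
move=> /nzh_cases[e -> [[e' -> E]|[i [e0 [-> E Pi Hx]]]]]; rewrite ?hh_l ?hh_r.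
  by apply: V1; rewrite E.
have [e1 [e' [_ E1 H1 Hs]]] := V3 i Pi.
have E01 : e0 = e1 by apply: (hx_inj Vf); rewrite Hx.
by have -> : e = e' by apply: val_inj; rewrite /= E E1 E01.
Qed.

Lemma nzh_tight f l l' l'' : validh f -> nzh f l l' -> nzh f l'' l' ->
  hh f l = (hh f l').+1 -> l'' = l \/ (hh f l < hh f l'')%N.
Proof.
move=> Vf /nzh_cases[e -> H] /nzh_cases[e'' -> H''] _; left; congr lshift; apply: val_inj.
case: H H'' => [[e' -> E]|[i [e0 [-> E Pi Hx]]]] [[e1 + E1]|[j [e1 [+ E1 Pj Hx']]]].
- by move=> /lshift_inj Ee; rewrite /= E E1 Ee.
- by move=> /eqP; rewrite eq_lrshift.
- by move=> /eqP; rewrite eq_rlshift.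
move=> /rshift_inj Ei; rewrite /= E E1; congr _.+1; congr nat_of_ord.
by apply: (hx_inj Vf); rewrite Hx Hx' Ei.
Qed.

Lemma graded_col (k : fieldType) f b (a : 'cV[k]_r) (c : 'cV[k]_m1) :
  graded (hh f) b (col_mx a c) <-> graded (hx f) b a /\ graded (s1 f) b c.
Proof.
split=> [H|[Ha Hc] l].
  split=> i Hi.
    by have := H (lshift _ i); rewrite col_mxEu hh_l; apply.
  by have := H (rshift _ i); rewrite col_mxEd hh_r; apply.
rewrite -(splitK l); case: (split l) => i /=.
  by rewrite col_mxEu hh_l; apply: Ha.
by rewrite col_mxEd hh_r; apply: Hc.
Qed.

Lemma hshift_std (k : fieldType) f : hshift k *m stdh k f = stdh k f *m tauh k f.
Proof. by rewrite !mulmx_block !mulmx0 !mul0mx !mulmx1 !mul1mx !addr0. Qed.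

Lemma stdh_unit (k : fieldType) f : stdh k f \in unitmx.
Proof. by rewrite unitmxE det_ublock !det1 mulr1 unitr1. Qed.

Section HookExistence.
Variables (k : fieldType) (C : nat -> 'cV[k]_d -> Prop).
Hypothesis HC : chain (hshift k) C.
Hypothesis CB : forall y, C B y -> y = 0.
Local Notation T := (hshift k).
Local Notation inc c := (col_mx (0 : 'cV[k]_r) c).

Lemma hshift_col (a : 'cV[k]_r) (c : 'cV[k]_m1) : T *m col_mx a c = col_mx (Jb k *m a) 0.
Proof. by rewrite mul_block_col !mul0mx !addr0. Qed.

Lemma hshift_pow b (a : 'cV[k]_r) (c : 'cV[k]_m1) :
  mpow T b.+1 (col_mx a c) = col_mx (mpow (Jb k) b.+1 a) 0.
Proof. by elim: b => [|b IH]; rewrite mpowS ?mpow0 ?IH hshift_col. Qed.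

Lemma usub_hshift_pow b (x : 'cV[k]_d) : usubmx (mpow T b x) = mpow (Jb k) b (usubmx x).
Proof. by case: b => // b; rewrite -{1}[x]vsubmxK hshift_pow col_mxKu. Qed.

Lemma inc_add (c c' : 'cV[k]_m1) : inc (c + c') = inc c + inc c'.
Proof. by rewrite add_col_mx addr0. Qed.

Lemma inc_scale a (c : 'cV[k]_m1) : inc (a *: c) = a *: inc c.
Proof. by rewrite scale_col_mx scaler0. Qed.

Variable x : 'cV[k]_d.
Hypothesis x_top : usubmx x i0 0 != 0.
Variable h0 : nat.
Hypothesis Ch0 : C h0 x.
Hypothesis h0_max : forall y b, usubmx y i0 0 != 0 -> C b y -> (b <= h0)%N.

Let tx e := mpow T e x.

Let tx_top (e : 'I_r) : usubmx (tx e) e 0 != 0.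
Proof. by rewrite usub_hshift_pow (@Jblock_shift _ _ e _ i0) //= addn0. Qed.

Let tx_neq0 (e : 'I_r) : tx e != 0.
Proof. by apply: contraNneq (tx_top e) => ->; rewrite linear0 mxE. Qed.

Let tx_nil e : (r <= e)%N -> tx e = 0.
Proof.
case: e => [|e]; first by rewrite leqNgt (ltnW r_gt1).
move=> He; rewrite /tx -[x]vsubmxK hshift_pow -[RHS]col_mx0; congr col_mx.
apply/colP => i; rewrite [RHS]mxE Jblock_shift0 //; exact: leq_trans (ltn_ord i) He.
Qed.

Let Xx : 'M[k]_(d, r) := \matrix_(i, e) tx e i 0.

Let col_Xx e : col e Xx = tx e.
Proof. by apply/colP => i; rewrite !mxE. Qed.

Let Xx_sum a : Xx *m a = \sum_e a e 0 *: tx e.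
Proof. by rewrite mulmx_sum_col; apply: eq_bigr => e _; rewrite col_Xx. Qed.

Let T_Xx : T *m Xx = Xx *m Jb k.
Proof.
apply: eq_cols => e; rewrite !col_mulmx col_Xx.
have -> : T *m tx e = tx e.+1 by [].
case: (ltnP e.+1 r) => He.
  rewrite Xx_sum (bigD1 (Ordinal He)) //= big1 ?addr0 => [|j Hj].
    by rewrite !mxE eqxx scale1r.
  rewrite !mxE; case: eqP => [E|]; last by rewrite scale0r.
  by case/eqP: Hj; apply: val_inj.
rewrite tx_nil // Xx_sum big1 // => j _; rewrite !mxE; case: eqP => [E|]; last by rewrite scale0r.
by move: (ltn_ord j); rewrite E ltnNge He.
Qed.

(* Up to a unit of [k[t]/t^r], the vector [Xx *m a] is [t^e x] for the lowest [e] with [a_e <> 0]. *)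
Let cyclic_leading (a : 'cV[k]_r) (e : 'I_r) s b : a e 0 != 0 -> (forall e' : 'I_r, (e' < e)%N -> a e' 0 = 0) ->
  C b (mpow T s (Xx *m a)) -> forall i, C (b + i)%N (tx (e + s + i)).
Proof.
move=> Ha Hmin Hb.
suff H n i : (r <= e + s + i + n)%N -> C (b + i)%N (tx (e + s + i)).
  by move=> i; apply: (H r); apply: leq_addl.
elim: n i => [|n IH] i Hi.
  by rewrite tx_nil ?(leq_trans Hi) ?addn0 //; apply: (chain0 HC).
have := chain_mpow HC i Hb; rewrite -mpow_add Xx_sum linear_sum /= (bigD1 e) //=.
have Et (e' : 'I_r) : mpow T (i + s) (a e' 0 *: tx e') = a e' 0 *: tx (e' + s + i).
  by rewrite linearZ /= -mpow_add (addnC (i + s)%N) addnA (addnAC e').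
rewrite Et => H; have {H} : C (b + i)%N (a e 0 *: tx (e + s + i)).
  apply: (chainDr HC) H; apply: (chain_sum HC) => e' He'; rewrite Et.
  case: (ltngtP e' e) => [Hlt|Hgt|/val_inj E]; last by rewrite E eqxx in He'.
    by rewrite Hmin // scale0r; apply: (chain0 HC).
  apply: (chainZ HC).
  have -> : (e' + s + i = e + s + (i + (e' - e)))%N.
    by lia.
  apply: (chain_le HC (c := (b + (i + (e' - e)))%N)); first by rewrite addnA leq_addr.
  by apply: IH; lia.
by move/(chainZ HC (a e 0)^-1); rewrite scalerA mulVf // scale1r.
Qed.

(* [F1] is the quotient filtration modulo the submodule generated by [x], [F2] the one modulo its
   socle; they differ in codimension at most one, which is what a pivot accounts for. *)
Let F1 b (c : 'cV[k]_m1) := exists a : 'cV[k]_r, C b (inc c + Xx *m a).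
Let F2 b (c : 'cV[k]_m1) := exists a : k, C b (inc c + a *: tx r.-1).

Let F1_chain : chain 0 F1.
Proof.
split.
- by move=> c; exists 0; apply: (chain_top HC).
- move=> b c c' [a H] [a' H']; exists (a + a').
  by rewrite inc_add mulmxDr addrACA; apply: (chainD HC).
- move=> b z c [a H]; exists (z *: a).
  by rewrite inc_scale -scalemxAr -scalerDr; apply: (chainZ HC).
- by move=> b c [a H]; exists a; apply: (chain_pred HC).
by move=> b c _; exists 0; rewrite mul0mx mulmx0 col_mx0 addr0; apply: (chain0 HC).
Qed.

Let F2_chain : chain 0 F2.
Proof.
split.
- by move=> c; exists 0; apply: (chain_top HC).
- move=> b c c' [a H] [a' H']; exists (a + a').
  by rewrite inc_add scalerDl addrACA; apply: (chainD HC).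
- move=> b z c [a H]; exists (z * a).
  by rewrite inc_scale -scalerA -scalerDr; apply: (chainZ HC).
- by move=> b c [a H]; exists a; apply: (chain_pred HC).
by move=> b c _; exists 0; rewrite mul0mx scale0r col_mx0 addr0; apply: (chain0 HC).
Qed.

Let F21 b c : F2 b c -> F1 b c.
Proof.
case=> a H; exists (a *: delta_mx ilast 0).
by rewrite -scalemxAr -colE col_Xx.
Qed.

Let dsub_Xx (a : 'cV[k]_r) : dsubmx (Xx *m a) = a i0 0 *: dsubmx x.
Proof.
rewrite Xx_sum linear_sum (bigD1 i0) //= big1 ?addr0 => [|e He]; first by rewrite linearZ.
rewrite linearZ /=; have He0 : (0 < e)%N.
  by rewrite lt0n; apply: contraNneq He => E; apply/eqP/val_inj.
by rewrite /tx -(prednK He0) -[x]vsubmxK hshift_pow col_mxKd scaler0.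
Qed.

Let usub_Xx (a : 'cV[k]_r) : usubmx (Xx *m a) i0 0 = a i0 0 * usubmx x i0 0.
Proof.
rewrite Xx_sum linear_sum (bigD1 i0) //= mxE linearZ /= [X in X + _]mxE summxE big1 ?addr0 // => e He.
rewrite linearZ /= [LHS]mxE /tx usub_hshift_pow Jblock_shift0 ?mulr0 //=.
by rewrite lt0n; apply: contraNneq He => E'; apply/eqP/val_inj.
Qed.

Let F1_bounded c : F1 B c -> c = 0.
Proof.
case=> a /CB E; have a0 : a i0 0 = 0.
  have /colP/(_ i0) := congr1 usubmx E; rewrite linearD /= col_mxKu add0r linear0 [RHS]mxE.
  by rewrite usub_Xx => /eqP; rewrite mulf_eq0 (negbTE x_top) orbF => /eqP.
by have := congr1 dsubmx E; rewrite linearD /= col_mxKd dsub_Xx a0 scale0r addr0 linear0.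
Qed.

Let F2_bounded c : F2 B c -> c = 0.
Proof. by move/F21/F1_bounded. Qed.

Section Heights.
Variable ht : 'I_r -> nat.
Hypothesis htP : forall (e : 'I_r) b, C b (tx e) <-> (b <= ht e)%N.
Variables (P : 'M[k]_m1) (t1 t2 : 'I_m1 -> nat).
Hypothesis HP1 : forall b c, F1 b (P *m c) <-> graded t1 b c.
Hypothesis HP2 : forall b c, F2 b (P *m c) <-> graded t2 b c.

Lemma ht_lt (e e' : 'I_r) : (e < e')%N -> (ht e < ht e')%N.
Proof.
move=> H; apply/htP; have /htP He : (ht e <= ht e)%N by [].
have := chain_mpow HC (e' - e) He; rewrite /tx -mpow_add subnK ?(ltnW H) // => H'.
by apply: (chain_le HC) H'; lia.
Qed.

Lemma ht_graded (a : 'cV[k]_r) b : C b (Xx *m a) -> graded ht b a.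
Proof.
move=> H l Hl; case: (@arg_minnP _ l (fun e : 'I_r => a e 0 != 0) (fun e : 'I_r => e : nat) Hl).
move=> e He Hmin; apply/htP.
have Hm (e' : 'I_r) : (e' < e)%N -> a e' 0 = 0.
  by move=> Hlt; apply/eqP; apply: contraTT Hlt => /Hmin; rewrite -leqNgt.
have := cyclic_leading (s := 0%N) He Hm H (l - e); rewrite addn0 subnKC ?Hmin //.
by apply: (chain_le HC); apply: leq_addr.
Qed.

Lemma pivot_relation i : (t2 i < t1 i)%N -> exists (e e' : 'I_r) (z : k),
  [/\ (0 < e)%N /\ e' = e.+1 :> nat, ht e = t2 i, (t1 i < ht e')%N, z != 0 &
    C (t1 i) (z *: inc (col i P) + tx e)].
Proof.
move=> Hlt; have [a Ha] : F1 (t1 i) (col i P) by rewrite colE; apply/HP1/graded_delta.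
have F2n b : F2 b (col i P) -> (b <= t2 i)%N.
  by rewrite colE => /HP2/(_ i); rewrite mxE !eqxx oner_neq0; apply.
have [l Hl] : exists l, a l 0 != 0.
  apply/existsP; apply: contraTT Hlt => /existsPn Hz; rewrite -leqNgt; apply: F2n.
  exists 0; rewrite scale0r addr0; have <- : inc (col i P) + Xx *m a = inc (col i P) => //.
  rewrite (_ : a = 0) ?mulmx0 ?addr0 //; apply/colP => l; rewrite mxE.
  by apply/eqP; have := Hz l; rewrite negbK.
case: (@arg_minnP _ l (fun e : 'I_r => a e 0 != 0) (fun e : 'I_r => e : nat) Hl) => {l Hl} e He Hmin.
have Hm (e' : 'I_r) : (e' < e)%N -> a e' 0 = 0.
  by move=> H; apply/eqP; apply: contraTT H => /Hmin; rewrite -leqNgt.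
have Htail j : C (t1 i).+1 (tx (e + j.+1)).
  have H1 : C (t1 i).+1 (mpow T 1 (Xx *m a)).
    have := chain_mul HC Ha; rewrite mulmxDr hshift_col mulmx0 col_mx0 add0r.
    exact.
  have := cyclic_leading He Hm H1 j; rewrite -addnA add1n; apply: (chain_le HC).
  exact: leq_addr.
have Htail' (e' : 'I_r) : (e < e')%N -> C (t1 i).+1 (tx e').
  by move=> H; rewrite (_ : e' = (e + (e' - e).-1.+1)%N :> nat) //; lia.
have Hrest : C (t1 i) (inc (col i P) + a e 0 *: tx e).
  move: Ha; rewrite Xx_sum (bigD1 e) //= addrA => H.
  apply: (chainDr HC) H; apply: (chain_sum HC) => e' Hne.
  case: (ltngtP e' e) => [H|H|/val_inj E]; last by rewrite E eqxx in Hne.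
    by rewrite Hm // scale0r; apply: (chain0 HC).
  by apply/(chainZ HC)/(chain_pred HC)/Htail'.
have Hlast : (e.+1 < r)%N.
  have := ltn_ord e; rewrite leq_eqVlt => /orP[/eqP Er|//].
  have Ee : (nat_of_ord e) = r.-1 by lia.
  by move: Hlt; rewrite ltnNge F2n //; exists (a e 0); rewrite -Ee.
have Hn : ~ C (t1 i) (tx e).
  move=> H; move: Hlt; rewrite ltnNge F2n //; exists 0; rewrite scale0r addr0.
  exact: (chainDr HC) (chainZ HC _ H) Hrest.
have Hhe : (ht e < t1 i)%N by rewrite ltnNge; apply/negP => /htP.
have Epos : (0 < e)%N.
  rewrite lt0n; apply/eqP => E0; have Ei : e = i0 by apply: val_inj.
  have /htP H0 : C h0 (tx e) by rewrite E0.
  have : (t1 i <= h0)%N.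
    by apply: h0_max Ha; rewrite linearD /= col_mxKu add0r usub_Xx mulf_neq0 // -Ei.
  by move=> H; move: (leq_trans Hhe (leq_trans H H0)); rewrite ltnn.
have Hz : C (t1 i) ((a e 0)^-1 *: inc (col i P) + tx e).
  by have := chainZ HC (a e 0)^-1 Hrest; rewrite scalerDr scalerA mulVf // scale1r.
exists e, (Ordinal Hlast), (a e 0)^-1; split=> //; last by rewrite invr_eq0.
  (* The combination has level [t1 i], above both [ht e] and [t2 i], so its two terms have equal
     height; the socle term allowed by [F2] is too high to matter. *)
  apply/eqP; rewrite eqn_leq; apply/andP; split.
    apply: F2n; exists 0; rewrite scale0r addr0.
    have H1 : C (ht e) (tx e) by apply/htP.
    have := chainDr HC H1 (chain_le HC (ltnW Hhe) Hz).
    by move=> /(chainZ HC (a e 0)); rewrite scalerA mulfV // scale1r.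
  apply/htP; have [z Hz2] : F2 (t2 i) (col i P) by rewrite colE; apply/HP2/graded_delta.
  have Hl : C (t2 i) (tx r.-1).
    apply: (chain_le HC (c := (t1 i).+1)); first by rewrite ltnW // ltnS ltnW.
    by apply: (Htail' ilast); rewrite /= -ltnS prednK // ltnW.
  have Hp : C (t2 i) (inc (col i P)) by apply: (chainDr HC) Hz2; apply: (chainZ HC).
  exact: (chainDl HC) (chainZ HC _ Hp) (chain_le HC (ltnW Hlt) Hz).
by apply/htP; apply: Htail'.
Qed.

End Heights.
Lemma fits_hook_at : exists2 f, validh f & fits T C (tauh k f) (hh f).
Proof.
have [ht0 Hht] := height_fun (chain_weaken HC) CB; pose ht (e : 'I_r) := ht0 (tx e).
have htP (e : 'I_r) b : C b (tx e) <-> (b <= ht e)%N by have [_] := Hht _ (tx_neq0 e); apply.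
have htB e : (ht e < B)%N by have [] := Hht _ (tx_neq0 e).
have [P [t1 [t2 [PU tB HP1 HP2 Hanti]]]] := two_filtrations F1_chain F2_chain F1_bounded F2_bounded.
have ht_mono := ht_lt htP; have Hpiv := pivot_relation htP HP1 HP2.
have ht_inj : injective ht.
  move=> e e' E; apply: val_inj; case: (ltngtP e e') => // /ht_mono; by rewrite E ltnn.
have t21 i : (t2 i <= t1 i)%N.
  have /F21 : F2 (t2 i) (P *m delta_mx i 0) by apply/HP2/graded_delta.
  by move/HP1 => /(_ i); rewrite mxE !eqxx oner_neq0; apply.
pose f : hook_heights := ([ffun e => Ordinal (htB e)],
  [ffun i => (Ordinal (tB i).1, Ordinal (tB i).2)]).
have E1 : hx f = ht by apply/funext => e; rewrite /hx /f ffunE.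
have E2 : s1 f = t1 by apply/funext => e; rewrite /s1 /f ffunE.
have E3 : s2 f = t2 by apply/funext => e; rewrite /s2 /f ffunE.
(* A pivot is corrected by exactly [t^e x] after rescaling by [z]. Otherwise the correction is a
   multiple of the socle vector, which the operator kills, so it leaves no trace in [tauh]. *)
have /choice[u Hu] : forall i, exists za : k * 'cV[k]_r, [/\ za.1 != 0,
    C (t1 i) (za.1 *: inc (col i P) + Xx *m za.2), Jb k *m za.2 = Jb k *m col i (pivmx k f) &
    piv f i -> za.2 = col i (pivmx k f)].
  move=> i; case: (ltnP (t2 i) (t1 i)) => Ht.
    have [e [e' [z [_ He _ Hz Cz]]]] := Hpiv i Ht.
    have Ecol : col i (pivmx k f) = delta_mx e 0.
      by apply/colP => l; rewrite !mxE /piv E1 E2 E3 Ht -He (inj_eq ht_inj) /= andbT.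
    by exists (z, delta_mx e 0); split; rewrite ?Ecol //= -colE col_Xx.
  have [z Hz] : F2 (t2 i) (col i P) by rewrite colE; apply/HP2/graded_delta.
  have Hn : piv f i = false by rewrite /piv E2 E3 ltnNge Ht.
  exists (1, z *: delta_mx ilast 0); split; rewrite ?oner_neq0 ?Hn //=.
    by rewrite scale1r -scalemxAr -colE col_Xx; apply: (chain_le HC) Hz.
  have -> : col i (pivmx k f) = 0 by apply/colP => l; rewrite !mxE Hn.
  rewrite mulmx0 -scalemxAr -[X in _ *: X]/(mpow (Jb k) 1 _).
  rewrite (_ : mpow _ 1 _ = 0) ?scaler0 //; apply/colP => l; rewrite [RHS]mxE.
  rewrite mpowS mpow0 mxE big1 // => j _; rewrite !mxE; case: eqP => [El|]; last by rewrite mul0r.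
  case: (j =P ilast) => [Ej|]; last by rewrite mulr0.
  by move: (ltn_ord l); rewrite El Ej /= prednK ?ltnn // ltnW.
pose D : 'M[k]_m1 := diag_mx (\row_i (u i).1).
pose AA : 'M[k]_(r, m1) := \matrix_(e, i) (u i).2 e 0.
have cAA i : col i AA = (u i).2 by apply/colP => e; rewrite !mxE.
pose Z : 'M[k]_(d, m1) := col_mx 0 (P *m D) + Xx *m AA.
have cZ i : col i Z = (u i).1 *: inc (col i P) + Xx *m (u i).2.
  rewrite /Z linearD /= col_col_mx col0 [col i (Xx *m AA)]col_mulmx cAA -inc_scale; congr (inc _ + _).
  by apply/colP => q; rewrite mxE mul_mx_diag !mxE mulrC.
have EZ c : Z *m c = inc (P *m (D *m c)) + Xx *m (AA *m c).
  by rewrite /Z mulmxDl mul_col_mx mul0mx !mulmxA.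
have CZ b c : graded t1 b c -> C b (Z *m c).
  move=> Hc; apply: (chain_mulmx HC) => i Hi; rewrite cZ; apply: (chain_le HC (Hc _ Hi)).
  by case: (Hu i).
pose X : 'M[k]_d := row_mx Xx Z.
have HX b y : C b (X *m y) <-> graded (hh f) b y.
  rewrite -[y]vsubmxK /X mul_row_col; set a := usubmx y; set c := dsubmx y.
  split=> [H|/graded_col]; rewrite ?E1 ?E2.
    have Hc : graded t1 b c.
      have /HP1 Hg : F1 b (P *m (D *m c)).
        by exists (a + AA *m c); move: H; rewrite EZ mulmxDr addrCA.
      move=> i Hi; apply: Hg; rewrite mul_diag_mx mxE [X in X * _]mxE mulf_neq0 //; by case: (Hu i).
    apply/graded_col; rewrite E1 E2; split=> //; apply: (ht_graded htP).
    exact: (chainDr HC) (CZ _ _ Hc) H.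
  case=> Ha Hc; apply: (chainD HC); last exact: CZ.
  apply: (chain_mulmx HC) => e He; rewrite col_Xx; apply/htP; exact: Ha.
exists f.
  apply/and5P; rewrite /piv E1 E2 E3; split; apply/forallP => i.
  - by apply/forallP => e'; apply/implyP; apply: ht_mono.
  - exact: t21.
  - apply/implyP => /Hpiv[e [e' [z [[H1 H2] H3 H4 _ _]]]].
    by apply/existsP; exists e; apply/existsP; exists e'; rewrite H1 H2 H3 H4 !eqxx.
  (* For two pivots at the same [t^e x], the difference of their relations cancels it and puts a
     combination of the two columns above [t2 i], against the splitting of [F2]. *)
  - apply/forallP => i'; apply/implyP => /and3P[Hi Hi' /eqP Et]; apply: contraT => Hne.
    have [e [_ [z [_ He _ Hz Cz]]]] := Hpiv i Hi; have [e' [_ [z' [_ He' _ Hz' Cz']]]] := Hpiv i' Hi'.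
    have Eee : e = e' by apply: ht_inj; rewrite He He'.
    have Hb : C (t2 i).+1 (inc (P *m (z *: delta_mx i 0 - z' *: delta_mx i' 0))).
      have := chainB HC (chain_le HC Hi Cz) (chain_le HC (_ : (t2 i).+1 <= t1 i')%N Cz').
      rewrite Et => /(_ Hi'); rewrite Eee opprD addrACA subrr addr0.
      by rewrite mulmxBr -!scalemxAr -!colE -scaleNr -!inc_scale -inc_add scaleNr.
    have /HP2/(_ i) : F2 (t2 i).+1 (P *m (z *: delta_mx i 0 - z' *: delta_mx i' 0)).
      by exists 0; rewrite scale0r addr0.
    by rewrite !mxE !eqxx (negbTE Hne) mulr1 mulr0 subr0 ltnn => /(_ Hz).
  - by apply/forallP => j; apply/implyP; apply: Hanti.
exists X; split=> //.
  by apply: (graded_unitmx (C := C) (h := hh f)) => [b|b y /HX //]; apply: (chain0 HC).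
rewrite /X mul_mx_row /tauh mul_row_block !mulmx0 !addr0 -T_Xx; congr row_mx.
rewrite /Z mulmxDr mul_block_col !mul0mx !mulmx0 !addr0 col_mx0 add0r !mulmxA T_Xx -!mulmxA.
by congr (Xx *m _); apply: eq_cols => i; rewrite !col_mulmx cAA; case: (Hu i).
Qed.

End HookExistence.

Lemma fits_hook (k : fieldType) C : chain (hshift k) C -> (forall y, C B y -> y = 0) ->
  exists2 f, validh f & fits (hshift k) C (tauh k f) (hh f).
Proof.
move=> HC CB; have [||x [h [Hx Ch _ Hmax]]] := max_height HC CB
    (P := fun y : 'cV[k]_d => usubmx y i0 0 != 0).
- by exists (col_mx (delta_mx i0 0) 0); rewrite col_mxKu mxE !eqxx oner_neq0.
- by move=> y; apply: contraNneq => ->; rewrite linear0 mxE.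
exact: (fits_hook_at HC CB Hx Ch Hmax).
Qed.


Section HookUniqueness.
Variable k : fieldType.
Implicit Types (R : 'M[k]_d).

Lemma tauh_col f (a : 'cV[k]_r) (c : 'cV[k]_m1) :
  tauh k f *m col_mx a c = col_mx (Jb k *m (a + pivmx k f *m c)) 0.
Proof. by rewrite mul_block_col !mul0mx !addr0 mulmxDr mulmxA. Qed.

Lemma tauh_pow f b (a : 'cV[k]_r) (c : 'cV[k]_m1) :
  mpow (tauh k f) b.+1 (col_mx a c) = col_mx (mpow (Jb k) b.+1 (a + pivmx k f *m c)) 0.
Proof.
elim: b => [|b IH]; first by rewrite !mpowS !mpow0 tauh_col.
by rewrite mpowS IH tauh_col mulmx0 addr0.
Qed.

Lemma pivmx_top f (c : 'cV[k]_m1) : validh f -> (pivmx k f *m c) i0 0 = 0.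
Proof.
move=> Vf; rewrite mxE big1 // => i _; rewrite mxE.
case Pi : (piv f i); last by rewrite mul0r.
have [_ _ V3 _ _] := validhP Vf; have [e [_ [He _ Ee _]]] := V3 i Pi.
case: eqP => [E|]; last by rewrite mul0r.
by move: He; have -> : e = i0 by apply: (hx_inj Vf); rewrite Ee E.
Qed.

Lemma tauh_pow_delta f (e : 'I_r) :
  mpow (tauh k f) e (col_mx (delta_mx i0 0) 0) = col_mx (delta_mx e 0) 0.
Proof.
case Ee : (nat_of_ord e) => [|b]; first by rewrite mpow0; congr (col_mx (delta_mx _ _) _); apply: val_inj.
rewrite tauh_pow mulmx0 addr0 -Ee; congr col_mx; apply/colP => i; rewrite mxE.
case: (ltnP i e) => Hi.
  by rewrite Jblock_shift0 //; case: eqP => // E; rewrite E ltnn in Hi.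
have Hi' : (i - e < r)%N by rewrite (leq_ltn_trans (leq_subr _ _)).
rewrite (@Jblock_shift _ _ e _ (Ordinal Hi')) /= ?subnKC // mxE; congr (_%:R).
rewrite !andbT; congr nat_of_bool; apply/eqP/eqP => [[E]|E].
  by apply: val_inj; apply/eqP; rewrite eqn_leq Hi andbT -subn_eq0 E.
by apply: val_inj; rewrite /= E subnn.
Qed.

Variables (f f' : hook_heights) (R : 'M[k]_d).
Hypotheses (Vf : validh f) (Vf' : validh f').
Hypothesis RU : R \in unitmx.
Hypothesis RA : R *m tauh k f = tauh k f' *m R.

Let rho : 'cV[k]_d := R *m col_mx (delta_mx i0 0) 0.

Let R_delta (e : 'I_r) : R *m col_mx (delta_mx e 0) 0 = mpow (tauh k f') e rho.
Proof. by rewrite -(tauh_pow_delta f) (mpow_intertwine _ _ (esym RA)). Qed.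

Let beta : 'cV[k]_r := usubmx rho + pivmx k f' *m dsubmx rho.

Let beta_top : beta i0 0 = usubmx rho i0 0.
Proof. by rewrite mxE pivmx_top // addr0. Qed.

Let R_delta_pos (e : 'I_r) : (0 < e)%N ->
  R *m col_mx (delta_mx e 0) 0 = col_mx (mpow (Jb k) e beta) 0.
Proof. by move=> He; rewrite R_delta -{1}[rho]vsubmxK -(prednK He) tauh_pow. Qed.

Let rho_top : usubmx rho i0 0 != 0.
Proof.
rewrite -beta_top; apply/eqP => H0.
have Hp : (0 < ilast)%N by rewrite /= -subn1 subn_gt0.
have E : R *m col_mx (delta_mx ilast 0) 0 = 0 :> 'cV[k]_d.
  rewrite R_delta_pos // -[RHS]col_mx0; congr col_mx; apply/colP => i; rewrite [RHS]mxE.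
  case: (ltnP i ilast) => Hi; first by rewrite Jblock_shift0.
  rewrite (@Jblock_shift _ _ _ _ i0) //= addn0; apply/eqP; rewrite eqn_leq Hi andbT.
  by rewrite -ltnS prednK ?ltn_ord // ltnW.
have : col_mx (delta_mx ilast 0) 0 = 0 :> 'cV[k]_d by rewrite -[LHS](mulKmx RU) E mulmx0.
move=> /(congr1 usubmx); rewrite col_mxKu linear0 => /colP/(_ ilast).
by rewrite !mxE !eqxx => /eqP; rewrite oner_eq0.
Qed.

(** The power [r - 1] of the operator reads off the top coordinate, and it kills [col_mx 0 c] since
    pivots have [e > 0]. It is written [b.+1] because [tauh_pow] covers positive exponents. *)
Lemma inc_usub (c : 'cV[k]_m1) : usubmx (R *m col_mx 0 c) i0 0 = 0.
Proof.
set z := R *m _; pose b := r.-2.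
have Eb : b.+1 = r.-1 by rewrite /b prednK // -subn1 subn_gt0.
have E0 : mpow (tauh k f) b.+1 (col_mx 0 c) = 0.
  rewrite tauh_pow add0r -[RHS]col_mx0; congr col_mx; apply/colP => i; rewrite [RHS]mxE.
  case: (ltnP i b.+1) => Hi; first by rewrite Jblock_shift0.
  rewrite (@Jblock_shift _ _ _ _ i0) ?pivmx_top //= addn0; apply/eqP; rewrite eqn_leq Hi andbT.
  by rewrite Eb -ltnS prednK ?ltn_ord // ltnW.
have : mpow (tauh k f') b.+1 z = 0 by rewrite (mpow_intertwine _ _ (esym RA)) E0 mulmx0.
rewrite -[z]vsubmxK tauh_pow -[RHS]col_mx0 => /eq_col_mx[/colP/(_ ilast)].
rewrite (@Jblock_shift _ _ _ _ i0) ?addn0 //= [RHS]mxE mxE pivmx_top // addr0.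
by rewrite col_mxKu.
Qed.

Lemma R_col0 (u : 'cV[k]_r) : u i0 0 = 0 -> dsubmx (R *m col_mx u 0) = 0.
Proof.
move=> u0; pose W : 'M[k]_(d, r) := R *m col_mx 1%:M 0.
have cW e : dsubmx (R *m col_mx (delta_mx e 0) 0) = col e (dsubmx W).
  have -> : col_mx (delta_mx e 0) 0 = col_mx 1%:M 0 *m delta_mx e 0 :> 'cV[k]_d.
    by rewrite mul_col_mx mul1mx mul0mx.
  by rewrite mulmxA -colE; apply/colP => i; rewrite !mxE.
have -> : col_mx u 0 = col_mx 1%:M 0 *m u :> 'cV[k]_d by rewrite mul_col_mx mul1mx mul0mx.
rewrite mulmxA -/W -mul_dsub_mx mulmx_sum_col big1 // => e _.
have [E|He] := eqVneq e i0; first by rewrite E u0 scale0r.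
rewrite -cW R_delta_pos ?col_mxKd ?scaler0 // lt0n.
by apply: contraNneq He => E'; apply/eqP/val_inj.
Qed.

(** By [inc_usub] and [R_col0] this block is the map that [R] induces on the vectors with top
    coordinate 0 modulo those with no lower part; this makes it multiplicative. *)
Definition lowmx := drsubmx R.

Lemma dsub_inc (c : 'cV[k]_m1) : dsubmx (R *m col_mx 0 c) = lowmx *m c.
Proof. by rewrite -{1}[R]submxK mul_block_col mulmx0 add0r col_mxKd mulmx0 add0r. Qed.

Hypothesis HR : forall b y, graded (hh f) b y -> graded (hh f') b (R *m y).

Lemma hx_le (e : 'I_r) : (hx f e <= hx f' e)%N.
Proof.
have : graded (hh f) (hx f e) (col_mx (delta_mx e 0) (0 : 'cV[k]_m1)).
  by apply/graded_col; split; [exact: graded_delta | move=> l; rewrite mxE eqxx].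
move/HR; rewrite R_delta; case: (posnP e) => He.
  have -> : e = i0 by apply: val_inj.
  by rewrite mpow0 -[rho]vsubmxK => /graded_col[H _]; apply: H; apply: rho_top.
rewrite -[rho]vsubmxK -(prednK He) tauh_pow prednK // => /graded_col[H _]; apply: H.
by rewrite (@Jblock_shift _ _ _ _ i0) ?addn0 // beta_top rho_top.
Qed.

Lemma low_heights i j : lowmx i j != 0 -> (s1 f j <= s1 f' i)%N /\ (s2 f j <= s2 f' i)%N.
Proof.
have Eij (c : 'cV[k]_m1) : c = delta_mx j 0 -> (lowmx *m c) i 0 = lowmx i j.
  by move=> ->; rewrite -colE mxE.
move=> Hij; split.
  have : graded (hh f) (s1 f j) (col_mx (0 : 'cV[k]_r) (delta_mx j 0)).
    by apply/graded_col; split; [move=> l; rewrite mxE eqxx | exact: graded_delta].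
  move/HR; rewrite -[R *m _]vsubmxK dsub_inc => /graded_col[_ H]; apply: H.
  by rewrite Eij.
(* [y] undoes the pivot: it is killed by the operator and lies in level [s2 f j]. Its image is
   killed too, which at a pivot [i] of [f'] forces the coordinate at [t^e x] to be [- lowmx i j], so
   [s2 f j] is at most [hx f' e]. *)
pose y : 'cV[k]_d := col_mx (- (pivmx k f *m delta_mx j 0)) (delta_mx j 0).
have [_ V2 _ _ _] := validhP Vf; have [_ V2' V3' V4' _] := validhP Vf'.
have Hy : graded (hh f) (s2 f j) y.
  apply/graded_col; split; last by apply: graded_delta; apply: V2.
  move=> e; rewrite -colE !mxE oppr_eq0 natb_neq0 => /andP[_ /eqP ->] //.
have Ty : tauh k f *m y = 0 by rewrite tauh_col addNr mulmx0 col_mx0.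
have Edy : dsubmx (R *m y) = lowmx *m delta_mx j 0.
  have -> : y = col_mx (- (pivmx k f *m delta_mx j 0)) 0 + col_mx 0 (delta_mx j 0).
    by rewrite add_col_mx addr0 add0r.
  by rewrite mulmxDr linearD /= dsub_inc R_col0 ?add0r // mxE pivmx_top // oppr0.
have TRy : tauh k f' *m (R *m y) = 0 by rewrite mulmxA -RA -mulmxA Ty mulmx0.
move/HR: Hy; move: TRy; rewrite -[R *m y]vsubmxK Edy tauh_col.
set u := usubmx _ => TRy /graded_col[Hu Hm].
case: (boolP (piv f' i)) => Pi; last first.
  have -> : s2 f' i = s1 f' i by apply/eqP; rewrite eqn_leq V2' leqNgt.
  by apply: Hm; rewrite Eij.
have [e [e' [_ Ee' He _]]] := V3' i Pi; rewrite -He; apply: Hu.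
have /colP/(_ e') : Jb k *m (u + pivmx k f' *m (lowmx *m delta_mx j 0)) = 0.
  by move: TRy; rewrite -[RHS]col_mx0 => /eq_col_mx[].
rewrite (mul_Jblock _ _ Ee') mxE [RHS]mxE => /eqP; rewrite addr_eq0 => /eqP ->.
rewrite oppr_eq0 mxE (bigD1 i) //= big1 ?addr0 => [|i' Hi'].
  by rewrite Eij // mxE Pi He eqxx mul1r.
rewrite mxE; case: eqP => [E|]; last by rewrite andbF mul0r.
case Pi' : (piv f' i'); last by rewrite mul0r.
by case/eqP: Hi'; apply: V4' => //; rewrite -E He.
Qed.

End HookUniqueness.

Lemma lowmx_mul (k : fieldType) (R R' : 'M[k]_d) f f' : validh f -> validh f' ->
  R *m tauh k f = tauh k f' *m R -> R' *m tauh k f' = tauh k f *m R' -> R' *m R = 1%:M ->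
  lowmx R' *m lowmx R = 1%:M.
Proof.
move=> Vf Vf' RA RA' E; apply: eq_cols => i.
rewrite col_mulmx colE col1; set c : 'cV[k]_m1 := delta_mx i 0.
have Ec : dsubmx (R' *m (R *m col_mx 0 c)) = c by rewrite mulmxA E mul1mx col_mxKd.
have Ez : R *m col_mx 0 c = col_mx (usubmx (R *m col_mx 0 c)) 0 + col_mx 0 (lowmx R *m c).
  by rewrite add_col_mx addr0 add0r -dsub_inc vsubmxK.
rewrite -[RHS]Ec Ez mulmxDr linearD /= (R_col0 RA') ?add0r ?dsub_inc //.
exact: (inc_usub Vf Vf' RA).
Qed.

Lemma uniq_hook (k : fieldType) f f' (R : 'M[k]_d) : validh f -> validh f' -> R \in unitmx ->
  R *m tauh k f = tauh k f' *m R ->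
  (forall b y, graded (hh f) b y <-> graded (hh f') b (R *m y)) -> f = f'.
Proof.
move=> Vf Vf' RU RA HR.
have HR1 b y : graded (hh f) b y -> graded (hh f') b (R *m y) by move/HR.
have HR2 b y : graded (hh f') b y -> graded (hh f) b (invmx R *m y).
  by move=> Hy; apply/HR; rewrite mulKVmx.
have RA' : invmx R *m tauh k f' = tauh k f *m invmx R.
  by rewrite -[RHS](mulKmx RU) [R *m _]mulmxA RA mulmxK.
have RU' : invmx R \in unitmx by rewrite unitmx_inv.
have M1 := lowmx_mul Vf Vf' RA RA' (mulVmx RU).
have [_ V2 _ _ V5] := validhP Vf; have [_ V2' _ _ V5'] := validhP Vf'.
have Ex e : hx f e = hx f' e.
  by apply/eqP; rewrite eqn_leq (hx_le Vf' RU RA HR1) (hx_le Vf RU' RA' HR2).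
have Es i : (s1 f i * B + s2 f i = s1 f' i * B + s2 f' i)%N.
  apply: (antitone_eq (f := fun i => (s1 f i * B + s2 f i)%N)
     (g := fun i => (s1 f' i * B + s2 f' i)%N) M1) => // {}i j Hij.
    by have [H1 H2] := low_heights Vf Vf' RA HR1 Hij; rewrite leq_add // leq_mul2r H1 orbT.
  by have [H1 H2] := low_heights Vf' Vf RA' HR2 Hij; rewrite leq_add // leq_mul2r H1 orbT.
case: f f' {Vf Vf' RA HR HR1 HR2 RA' M1 V2 V2' V5 V5'} Ex Es => f1 f2 [f1' f2'] Ex Es.
congr pair; apply/ffunP => i; first exact/val_inj/Ex.
have [] := lex_inj (ltn_ord _) (ltn_ord _) (Es i).
by rewrite /s1 /s2 /=; case: (f2 i) (f2' i) => a b [a' b'] /= /val_inj -> /val_inj ->.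
Qed.

Definition coordh (l : 'I_d) : nat * nat :=
  match split l with inl e => (0%N, e : nat) | inr i => (i.+1, 0%N) end.

Lemma coordhP l : ((coordh l).2 < nth 0 mu (coordh l).1)%N.
Proof. by rewrite /coordh; case: (split l) => i //=; rewrite nth_nseq ltn_ord. Qed.

Definition posh (l : 'I_d) : 'I_(sumn mu) := bpos (coordhP l).

Lemma posh_inj : injective posh.
Proof.
move=> l l' /(congr1 val) /= E; have E1 := congr1 (blk mu) E; have E2 := congr1 (off mu) E.
move: E1 E2; rewrite !flatten_indexKl ?flatten_indexKr ?coordhP //.
rewrite -(splitK l) -(splitK l') /coordh !unsplitK.
case: (split l) => [p|i]; case: (split l') => [p'|i'] //=; first by move=> _ /val_inj ->.
by move=> /succn_inj /val_inj ->.
Qed.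

Lemma poshJ (k : fieldType) l l' : Jpart k mu (posh l) (posh l') = hshift k l l'.
Proof.
rewrite JpartE !blk_bpos !off_bpos /coordh mxE.
case: (split l) => [e|i]; rewrite mxE; case: (split l') => [e'|i']; rewrite ?mxE ?andbF //=.
Qed.

Lemma sumnh : sumn mu = d.
Proof. by rewrite /= sumn_nseq mul1n. Qed.

End Hook.

Theorem finite_type_hook (r m1 : nat) (nu : seq nat) : 1 < r -> finite_type (r :: nseq m1 1) nu.
Proof.
move=> Hr; have Hinj := @posh_inj r m1; have Hcard := sumnh r m1.
apply: (@classification_finite_type _ _ _ (hook_heights r m1 nu) (@validh r m1 nu)
  (@hh r m1 nu) (@nzh r m1 nu) (fun k => hshift r m1 k) (fun k => @tauh r m1 nu k)
  (fun k => @stdh r m1 nu k) (fun k => reindex_mx k (@posh r m1))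
  (fun k => (reindex_mx k (@posh r m1))^T%R)).
- by move=> k; exact: (reindexK k Hinj Hcard).
- by move=> k; exact: (reindexVK k Hinj).
- by move=> k; apply: (reindexJ Hinj Hcard) => l l'; apply: poshJ.
- by move=> k f _; apply: stdh_unit.
- by move=> k f _; apply: hshift_std.
- by move=> k f l l' _; apply: nzhE.
- exact: nzh_lt.
- exact: nzh_tight.
- by move=> k C HC CB; apply: fits_hook.
- by move=> k f f' R; apply: uniq_hook.
Qed.

(** * The case (3, 2) *)

Section ThreeTwo.
Local Open Scope ring_scope.
Variable nu : seq nat.
Local Notation mu := [:: 3; 2]%N.
Local Notation B := (sumn mu + sumn nu)%N.

Definition vec5 (k : fieldType) (a0 a1 a2 b0 b1 : k) : 'cV[k]_5 :=
  \col_i nth 0 [:: a0; a1; a2; b0; b1] i.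

Definition l5 (n : nat) (H : (n < 5)%N) : 'I_5 := Ordinal H.
Local Notation i0 := (@l5 0 isT).
Local Notation i1 := (@l5 1 isT).
Local Notation i2 := (@l5 2 isT).
Local Notation i3 := (@l5 3 isT).
Local Notation i4 := (@l5 4 isT).

Lemma ord5P (P : 'I_5 -> Prop) : P i0 -> P i1 -> P i2 -> P i3 -> P i4 -> forall l, P l.
Proof.
move=> H0 H1 H2 H3 H4 [l Hl].
have -> : Ordinal Hl = inord l by apply: val_inj; rewrite /= inordK.
by move: l Hl => [|[|[|[|[|//]]]]] _; [move: H0|move: H1|move: H2|move: H3|move: H4];
  congr (P _); apply: val_inj; rewrite /= inordK.
Qed.

Lemma sum5 (V : nmodType) (F : 'I_5 -> V) : \sum_l F l = F i0 + F i1 + F i2 + F i3 + F i4.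
Proof.
rewrite !big_ord_recl big_ord0 addr0 !addrA.
by congr (F _ + F _ + F _ + F _ + F _); apply: val_inj.
Qed.

Section OverField.
Variable k : fieldType.
Implicit Types (a b c : k).

Lemma vec5E (y : 'cV[k]_5) : y = vec5 (y i0 0) (y i1 0) (y i2 0) (y i3 0) (y i4 0).
Proof. by apply/colP; apply: ord5P; rewrite mxE. Qed.

Lemma vec5D a0 a1 a2 b0 b1 a0' a1' a2' b0' b1' :
  vec5 a0 a1 a2 b0 b1 + vec5 a0' a1' a2' b0' b1' =
  vec5 (a0 + a0') (a1 + a1') (a2 + a2') (b0 + b0') (b1 + b1').
Proof. by apply/colP; apply: ord5P; rewrite !mxE. Qed.

Lemma vec5Z c a0 a1 a2 b0 b1 :
  c *: vec5 a0 a1 a2 b0 b1 = vec5 (c * a0) (c * a1) (c * a2) (c * b0) (c * b1).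
Proof. by apply/colP; apply: ord5P; rewrite !mxE. Qed.

Lemma vec5_inj a0 a1 a2 b0 b1 a0' a1' a2' b0' b1' :
  vec5 a0 a1 a2 b0 b1 = vec5 a0' a1' a2' b0' b1' ->
  [/\ a0 = a0', a1 = a1' & a2 = a2'] /\ b0 = b0' /\ b1 = b1'.
Proof.
move=> /colP E; have := (E i0, E i1, E i2, E i3, E i4); rewrite !mxE /=.
by case=> -[[[-> ->] ->] ->] ->.
Qed.

Definition nz5 (kd l l' : nat) : bool :=
  (l, l') \in [:: (1, 0); (2, 1); (4, 3)] ++
    (if kd == 1 then [:: (4, 0)] else if kd == 2 then [:: (2, 3)] else [::])%N.

(* Entries in the adapted basis [z] of the three kinds of configurations: [z] is the standard
   basis [a_0, a_1, a_2, b_0, b_1] for [kd = 0], has [z_1 = a_1 + b_1] for [kd = 1] and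
   [z_4 = b_1 + a_2] for [kd = 2]. *)
Definition tau5 (kd : nat) : 'M[k]_5 :=
  \matrix_(l, l') if nz5 kd l l' then (if nz5 0 l l' then 1 else - 1) else 0.

Definition std5 (kd : nat) : 'M[k]_5 :=
  \matrix_(l, l') ((l == l') || ((kd == 1) && (l == i4) && (l' == i1)) ||
     ((kd == 2) && (l == i2) && (l' == i4)))%N%:R.

Lemma tau5E kd l l' : (tau5 kd l l' != 0) = nz5 kd l l'.
Proof. by rewrite mxE; case: ifP; rewrite ?eqxx //; case: ifP; rewrite ?oppr_eq0 oner_neq0. Qed.

Definition c1 (kd : nat) : k := (kd == 1%N)%:R.
Definition c2 (kd : nat) : k := (kd == 2%N)%:R.

Lemma tau5_vec kd a0 a1 a2 b0 b1 : tau5 kd *m vec5 a0 a1 a2 b0 b1 =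
  vec5 0 a0 (a1 - c2 kd * b0) 0 (b0 - c1 kd * a0).
Proof.
rewrite /c1 /c2; apply/colP; apply: ord5P; rewrite !mxE sum5 !mxE /nz5 /=;
(case: (kd =P 1%N) => [E1|_]; [rewrite ?E1 /= | case: (kd =P 2%N) => _ /=]);
rewrite ?mul0r ?mul1r ?mulN1r ?add0r ?addr0 ?subr0 ?mulr0n ?mulr1n ?mul0r ?mul1r ?subr0 //.
all: by rewrite addrC.
Qed.

Lemma std5_vec kd a0 a1 a2 b0 b1 : std5 kd *m vec5 a0 a1 a2 b0 b1 =
  vec5 a0 a1 (a2 + c2 kd * b1) b0 (b1 + c1 kd * a1).
Proof.
rewrite /c1 /c2; apply/colP; apply: ord5P; rewrite !mxE sum5 !mxE /=;
(case: (kd =P 1%N) => [E1|_]; [rewrite ?E1 /= | case: (kd =P 2%N) => _ /=]);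
rewrite ?mul0r ?mul1r ?mulN1r ?add0r ?addr0 ?subr0 ?mulr0n ?mulr1n ?mul0r ?mul1r ?subr0 ?add0r ?addr0 //.
all: by rewrite addrC.
Qed.

Lemma eq_mx5 (M N : 'M[k]_5) : (forall a0 a1 a2 b0 b1,
  M *m vec5 a0 a1 a2 b0 b1 = N *m vec5 a0 a1 a2 b0 b1) -> M = N.
Proof.
move=> H; apply: eq_cols => l; rewrite !colE [delta_mx l 0]vec5E; exact: H.
Qed.

Lemma c12 kd : c1 kd * c2 kd = 0.
Proof. by rewrite /c1 /c2; case: eqP => [->|_]; rewrite ?mulr0 ?mul0r. Qed.

Lemma std5_tau kd : tau5 0 *m std5 kd = std5 kd *m tau5 kd.
Proof.
apply: eq_mx5 => a0 a1 a2 b0 b1; rewrite -!mulmxA std5_vec !tau5_vec std5_vec.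
have -> : c1 0 = 0 by []. have -> : c2 0 = 0 by [].
rewrite !mul0r !subr0 mulrBr !mulrA (mulrC (c2 kd) (c1 kd)) c12 mul0r subr0 subrK.
by rewrite subrK.
Qed.

Lemma std5_unit kd : std5 kd \in unitmx.
Proof.
apply: unitmx_inj => y; rewrite [y]vec5E std5_vec.
have -> : 0 = vec5 0 0 0 0 0 :> 'cV[k]_5 by rewrite [LHS]vec5E !mxE.
move=> /vec5_inj[[-> ->]]; rewrite mulr0 addr0 => E [-> E4].
by rewrite E4 mulr0 addr0 in E; rewrite E E4.
Qed.

End OverField.

Definition heights5 : finType := (5.-tuple 'I_B * 'I_3)%type.
Implicit Type f : heights5.
Definition h5 f (n : nat) : nat := nth 0%N [seq val x | x <- f.1] n.
Definition kd5 f : nat := f.2.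
Definition h5o f (l : 'I_5) : nat := h5 f l.

(** In kind 1 the sum [tx + ty] is higher than [ty], and the gain cannot be absorbed into [x]
    because [y] is lower than [x]; in kind 2 the same happens to [ty + ttx], with [tx] lower than
    [y]. The two chains of inequalities exclude each other. *)
Definition valid5 f : bool :=
  [&& h5 f 0 < h5 f 1, h5 f 1 < h5 f 2, h5 f 3 < h5 f 4,
    (kd5 f == 1) ==> [&& h5 f 3 < h5 f 0, h5 f 0 < h5 f 4 & h5 f 4 < h5 f 1] &
    (kd5 f == 2) ==> [&& h5 f 1 < h5 f 3, h5 f 3 < h5 f 2 & h5 f 2 < h5 f 4]]%N.

Lemma nz5_cases kd l l' : nz5 kd l l' -> [\/ l = 1%N /\ l' = 0%N, l = 2%N /\ l' = 1%N |
  l = 4%N /\ l' = 3%N] \/ (kd = 1%N /\ l = 4%N /\ l' = 0%N) \/ (kd = 2%N /\ l = 2%N /\ l' = 3%N).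
Proof.
rewrite /nz5 mem_cat !inE => /orP[/or3P[]/eqP[-> ->]|].
- by left; constructor 1.
- by left; constructor 2.
- by left; constructor 3.
case: eqP => [->|_]; first by rewrite inE => /eqP[-> ->]; right; left.
by case: eqP => [->|_ //]; rewrite inE => /eqP[-> ->]; right; right.
Qed.

Lemma valid5P f : valid5 f -> [/\ (h5 f 0 < h5 f 1)%N, (h5 f 1 < h5 f 2)%N, (h5 f 3 < h5 f 4)%N,
  kd5 f = 1%N -> [/\ (h5 f 3 < h5 f 0)%N, (h5 f 0 < h5 f 4)%N & (h5 f 4 < h5 f 1)%N] &
  kd5 f = 2%N -> [/\ (h5 f 1 < h5 f 3)%N, (h5 f 3 < h5 f 2)%N & (h5 f 2 < h5 f 4)%N]].
Proof.
case/and5P => H1 H2 H3 /implyP H4 /implyP H5; split=> // E.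
  by have /and3P := H4 (introT eqP E).
by have /and3P := H5 (introT eqP E).
Qed.

Lemma nz5_lt f (l l' : 'I_5) : valid5 f -> nz5 (kd5 f) l l' -> (h5o f l' < h5o f l)%N.
Proof.
case/valid5P => H1 H2 H3 H4 H5; rewrite /h5o.
move=> /nz5_cases[[[-> ->]|[-> ->]|[-> ->]]|[[E [-> ->]]|[E [-> ->]]]] //.
  by case: (H4 E).
by case: (H5 E).
Qed.

Lemma nz5_tight f (l l' l'' : 'I_5) : valid5 f -> nz5 (kd5 f) l l' -> nz5 (kd5 f) l'' l' ->
  h5o f l = (h5o f l').+1 -> l'' = l \/ (h5o f l < h5o f l'')%N.
Proof.
case/valid5P => H1 H2 H3 H4 H5 Hn Hn'; rewrite /h5o => Eh.
suff : l'' = l :> nat \/ (h5 f l < h5 f l'')%N by case=> [E|]; [left; apply: val_inj | right].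
move: Hn Hn' Eh => /nz5_cases[[[-> ->]|[-> ->]|[-> ->]]|[[E [-> ->]]|[E [-> ->]]]]
  /nz5_cases[[[-> E']|[-> E']|[-> E']]|[[E2 [-> E']]|[E2 [-> E']]]] Eh //;
  try (by left); try (by have [] := H4 E2; lia); try (by have [] := H5 E2; lia);
  try (by have [] := H4 E; lia); try (by have [] := H5 E; lia).
Qed.

Section Existence5.
Variables (k : fieldType) (C : nat -> 'cV[k]_5 -> Prop).
Hypothesis HC : chain (tau5 k 0) C.
Hypothesis CB : forall y, C B y -> y = 0.

Lemma tau50_vec (a0 a1 a2 b0 b1 : k) : tau5 k 0 *m vec5 a0 a1 a2 b0 b1 = vec5 0 a0 a1 0 b0.
Proof. by rewrite tau5_vec /c1 /c2 !mul0r !subr0. Qed.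

(* The first nonzero coordinate for the order a_0, b_0, a_1, b_1, a_2, in which the coordinate
   subspaces form a full flag of characteristic submodules. *)
Definition lead (n : nat) (y : 'cV[k]_5) : Prop :=
  match n with
  | 0 => y i0 0 != 0
  | 1 => [/\ y i0 0 = 0, y i3 0 = 0 & y i1 0 != 0]
  | 2 => [/\ y i0 0 = 0, y i3 0 = 0, y i1 0 = 0, y i4 0 = 0 & y i2 0 != 0]
  | 3 => y i0 0 = 0 /\ y i3 0 != 0
  | _ => [/\ y i0 0 = 0, y i3 0 = 0, y i1 0 = 0 & y i4 0 != 0]
  end.

Variable H : nat -> nat.
Hypothesis HB : forall n, (n < 5)%N -> (H n < B)%N.
Hypothesis Hmax : forall n y b, (n < 5)%N -> lead n y -> C b y -> (b <= H n)%N.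

Lemma peel n b a z w : (n < 5)%N -> C (H n) z -> (a != 0 -> lead n (a *: z + w)) ->
  C b (a *: z + w) -> (a != 0 -> (b <= H n)%N) /\ C b w.
Proof.
move=> Hn Cz Hl Cb; have [E|Ha] := eqVneq a 0.
  by split=> //; move: Cb; rewrite E scale0r add0r.
have Hb := Hmax Hn (Hl Ha) Cb; split=> //.
by apply: (chainDl HC) Cb; apply/(chainZ HC)/(chain_le HC Hb).
Qed.

Lemma fits5_adapted (kd : nat) (x y : 'cV[k]_5) :
  let tx := tau5 k 0 *m x in let ty := tau5 k 0 *m y in let ttx := tau5 k 0 *m tx in
  (kd < 3)%N -> lead 0 x -> lead 3 y -> C (H 0) x -> C (H 3) y ->
  C (H 1) (tx + c1 k kd *: ty) -> C (H 2) ttx -> C (H 4) (ty + c2 k kd *: ttx) ->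
  (kd = 1 -> [/\ H 3 < H 0, H 0 < H 4 & H 4 < H 1])%N ->
  (kd = 2 -> [/\ H 1 < H 3, H 3 < H 2 & H 2 < H 4])%N ->
  exists2 f, valid5 f & fits (tau5 k 0) C (tau5 k (kd5 f)) (h5o f).
Proof.
move=> tx ty ttx Hkd Lx Ly Cx Cy C1 C2 C4 K1 K2.
pose z1 := tx + c1 k kd *: ty; pose z4 := ty + c2 k kd *: ttx.
have [x0 [x1 [x2 [x3 [x4 Ex]]]]] : exists a0 a1 a2 b0 b1, x = vec5 a0 a1 a2 b0 b1.
  by do 5!eexists; exact: vec5E.
have [y0 [y1 [y2 [y3 [y4 Ey]]]]] : exists a0 a1 a2 b0 b1, y = vec5 a0 a1 a2 b0 b1.
  by do 5!eexists; exact: vec5E.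
have Nx : x0 != 0 by move: Lx; rewrite Ex /lead mxE.
have [Ey0 Ny] : y0 = 0 /\ y3 != 0 by move: Ly; rewrite Ey /lead !mxE.
have Etx : tx = vec5 0 x0 x1 0 x3 by rewrite /tx Ex tau50_vec.
have Etty : ttx = vec5 0 0 x0 0 0 by rewrite /ttx Etx tau50_vec.
have Ety : ty = vec5 0 0 y1 0 y3 by rewrite /ty Ey tau50_vec Ey0.
have Ez1 : z1 = vec5 0 x0 (x1 + c1 k kd * y1) 0 (x3 + c1 k kd * y3).
  by rewrite /z1 Etx Ety vec5Z vec5D !mulr0 !addr0.
have Ez4 : z4 = vec5 0 0 (y1 + c2 k kd * x0) 0 y3.
  by rewrite /z4 Etty Ety vec5Z vec5D !mulr0 !addr0.
(* The terms come in the order of the flag, so that [peel] can remove them one at a time. *)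
pose zc (a0 a1 a2 b0 b1 : k) := a0 *: x + (b0 *: y + (a1 *: z1 + (b1 *: z4 + a2 *: ttx))).
have adapt b a0 a1 a2 b0 b1 : C b (zc a0 a1 a2 b0 b1) ->
  [/\ a0 != 0 -> (b <= H 0)%N, a1 != 0 -> (b <= H 1)%N & a2 != 0 -> (b <= H 2)%N] /\
  (b0 != 0 -> (b <= H 3)%N) /\ (b1 != 0 -> (b <= H 4)%N).
  rewrite /zc => Hb.
  have [|H0 {}Hb] := peel (n := 0) isT Cx _ Hb.
    move=> Ha; rewrite Ex Ey Ez1 Ez4 Etty !vec5Z !vec5D /lead mxE /= Ey0.
    by rewrite !mulr0 !addr0 mulf_neq0.
  have [|H3 {}Hb] := peel (n := 3) isT Cy _ Hb.
    move=> Ha; rewrite Ey Ez1 Ez4 Etty !vec5Z !vec5D /lead !mxE /= Ey0.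
    by rewrite !mulr0 !addr0 mulf_neq0.
  have [|H1 {}Hb] := peel (n := 1) isT C1 _ Hb.
    move=> Ha; rewrite -/z1 Ez1 Ez4 Etty !vec5Z !vec5D /lead !mxE /=.
    by rewrite !mulr0 !addr0 mulf_neq0.
  have [|H4 {}Hb] := peel (n := 4) isT C4 _ Hb.
    move=> Ha; rewrite -/z4 Ez4 Etty !vec5Z !vec5D /lead !mxE /=.
    by rewrite !mulr0 !addr0 mulf_neq0.
  rewrite -[a2 *: _]addr0 in Hb.
  have [|H2 _] := peel (n := 2) isT C2 _ Hb; last by [].
  by move=> Ha; rewrite addr0 Etty !vec5Z /lead !mxE /= !mulr0 mulf_neq0.
pose X : 'M[k]_5 := \matrix_(p, l) (nth 0 [:: x; z1; ttx; y; z4] l) p 0.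
have EX a0 a1 a2 b0 b1 : X *m vec5 a0 a1 a2 b0 b1 = zc a0 a1 a2 b0 b1.
  have cX l : col l X = nth 0 [:: x; z1; ttx; y; z4] l by apply/colP => p; rewrite !mxE.
  rewrite mulmx_sum_col sum5 !cX !mxE /= /zc.
  by rewrite -!addrA; congr (_ + _); rewrite addrCA addrC -!addrA addrCA; congr (_ + (_ + _)).
have [f [Ef Ek]] : exists f : heights5, (forall n, (n < 5)%N -> h5 f n = H n) /\ kd5 f = kd.
  exists ([tuple Ordinal (HB (ltn_ord i)) | i < 5], inord kd); split; last by rewrite /kd5 inordK.
  move=> n Hn; rewrite /h5 (nth_map (Ordinal (HB (n := 0) isT))) ?size_tuple //.
  by rewrite -(tnth_nth _ _ (Ordinal Hn)) tnth_mktuple.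
have HX b w : C b (X *m w) <-> graded (h5o f) b w.
  rewrite [w]vec5E EX; split=> [/adapt[[A0 A1 A2] [A3 A4]]|Hg].
    by apply: ord5P; rewrite mxE /h5o Ef.
  have Hc n (c : k) z (Hn : (n < 5)%N) : c = w (Ordinal Hn) 0 -> C (H n) z -> C b (c *: z).
    move=> Ec Cz; have [->|Hcn] := eqVneq c 0; first by rewrite scale0r; apply: (chain0 HC).
    apply/(chainZ HC)/(chain_le HC _ Cz); have := Hg (Ordinal Hn).
    by rewrite -vec5E /h5o Ef // -Ec; apply.
  by do !apply: (chainD HC); [apply: (Hc 0 _ _ isT) | apply: (Hc 3 _ _ isT) | apply: (Hc 1 _ _ isT) |
    apply: (Hc 4 _ _ isT) | apply: (Hc 2 _ _ isT)].
exists f.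
  have L1 : lead 1 tx by rewrite Etx /lead !mxE.
  have L2 : lead 2 ttx by rewrite Etty /lead !mxE.
  have L4 : lead 4 ty by rewrite Ety /lead !mxE.
  have Ez : tau5 k 0 *m z1 = ttx by rewrite Ez1 tau50_vec Etty.
  apply/and5P; rewrite !Ef // Ek; split.
  - by apply: (Hmax _ L1) => //; apply: (chain_mul HC).
  - by apply: (Hmax _ L2) => //; rewrite -Ez; apply: (chain_mul HC).
  - by apply: (Hmax _ L4) => //; apply: (chain_mul HC).
  - by apply/implyP => /eqP /K1[-> -> ->].
  - by apply/implyP => /eqP /K2[-> -> ->].
exists X; split=> //.
  by apply: (graded_unitmx (C := C) (h := h5o f)) => [b|b w /HX //]; apply: (chain0 HC).
rewrite Ek; apply: eq_mx5 => a0 a1 a2 b0 b1; rewrite -!mulmxA tau5_vec !EX /zc.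
rewrite Ex Ey Ez1 Ez4 Etty !vec5Z !vec5D tau50_vec.
congr vec5; rewrite ?Ey0; move: Hkd; case: (kd) => [|[|[|//]]] _; rewrite /c1 /c2 /=; ring.
Qed.

End Existence5.

Lemma fits5 (k : fieldType) C : chain (tau5 k 0) C -> (forall y, C B y -> y = 0) ->
  exists2 f, valid5 f & fits (tau5 k 0) C (tau5 k (kd5 f)) (h5o f).
Proof.
move=> HC CB.
have /choice[W HW] : forall n, exists xh : 'cV[k]_5 * nat, [/\ lead n xh.1, C xh.2 xh.1,
    (xh.2 < B)%N & forall y b, lead n y -> C b y -> (b <= xh.2)%N].
  move=> n; have [||x [h Hx]] := max_height HC CB (P := lead n); last by exists (x, h).
    move: n => [|[|[|[|n]]]].
    - by exists (vec5 1 0 0 0 0); rewrite /lead !mxE oner_neq0.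
    - by exists (vec5 0 1 0 0 0); rewrite /lead !mxE oner_neq0.
    - by exists (vec5 0 0 1 0 0); rewrite /lead !mxE oner_neq0.
    - by exists (vec5 0 0 0 1 0); rewrite /lead !mxE oner_neq0.
    - by exists (vec5 0 0 0 0 1); rewrite /lead !mxE oner_neq0.
  move=> y; move: n => [|[|[|[|n]]]] /=; first by apply: contraNneq => ->; rewrite mxE.
  - by case=> _ _; apply: contraNneq => ->; rewrite mxE.
  - by case=> _ _ _ _; apply: contraNneq => ->; rewrite mxE.
  - by case=> _; apply: contraNneq => ->; rewrite mxE.
  - by case=> _ _ _; apply: contraNneq => ->; rewrite mxE.
pose H n := (W n).2.
have HB n : (n < 5)%N -> (H n < B)%N by move=> _; case: (HW n).
have Hmax n y b : (n < 5)%N -> lead n y -> C b y -> (b <= H n)%N.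
  by move=> _; case: (HW n) => _ _ _; apply.
pose x := (W 0%N).1; pose y := (W 3).1.
have Lx : lead 0 x by case: (HW 0%N). have Ly : lead 3 y by case: (HW 3).
have Cx : C (H 0%N) x by case: (HW 0%N). have Cy : C (H 3) y by case: (HW 3).
pose tx := tau5 k 0 *m x; pose ty := tau5 k 0 *m y; pose ttx := tau5 k 0 *m tx.
have [x0 [x1 [x2 [x3 [x4 Ex]]]]] : exists a0 a1 a2 b0 b1, x = vec5 a0 a1 a2 b0 b1.
  by do 5!eexists; exact: vec5E.
have [y0 [y1 [y2 [y3 [y4 Ey]]]]] : exists a0 a1 a2 b0 b1, y = vec5 a0 a1 a2 b0 b1.
  by do 5!eexists; exact: vec5E.
have Nx : x0 != 0 by move: Lx; rewrite Ex /lead mxE.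
have [Ey0 Ny] : y0 = 0 /\ y3 != 0 by move: Ly; rewrite Ey /lead !mxE.
have Etx : tx = vec5 0 x0 x1 0 x3 by rewrite /tx Ex tau50_vec.
have Etty : ttx = vec5 0 0 x0 0 0 by rewrite /ttx Etx tau50_vec.
have Ety : ty = vec5 0 0 y1 0 y3 by rewrite /ty Ey tau50_vec Ey0.
have C2 : C (H 2) ttx.
  have [[Z0 Z3 Z1 Z4 Zn] Cz _ _] := HW 2.
  set u := (W 2).1 in Z0 Z3 Z1 Z4 Zn Cz.
  have Eu : u = vec5 0 0 (u i2 0) 0 0 by rewrite {1}[u]vec5E Z0 Z3 Z1 Z4.
  have -> : ttx = (x0 / u i2 0) *: vec5 0 0 (u i2 0) 0 0 by rewrite Etty vec5Z !mulr0 divfK.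
  by rewrite -Eu; apply: (chainZ HC).
have C10 : C (H 0%N).+1 tx by apply: (chain_mul HC).
have C43 : C (H 3).+1 ty by apply: (chain_mul HC).
have [H01 H34] : (H 0 < H 1)%N /\ (H 3 < H 4)%N.
  split; [apply: (Hmax _ _ _ _ _ C10) | apply: (Hmax _ _ _ _ _ C43)] => //.
    by rewrite Etx /lead !mxE.
  by rewrite Ety /lead !mxE.
have [c [Cc H12]] : exists c, C (H 1%N) (tx + c *: ty) /\ (H 1 < H 2)%N.
  have [[Z0 Z3 Z1] Cz _ _] := HW 1%N; set u := (W 1%N).1 in Z0 Z3 Z1 Cz.
  have H12 : (H 1 < H 2)%N.
    apply: (Hmax _ (tau5 k 0 *m u)) => //; last exact: (chain_mul HC).
    by rewrite [u]vec5E Z0 Z3 tau50_vec /lead !mxE.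
  (* With [u] attaining [H 1], these values match [tx + c ty] with [g u] at [i1] and [i4]; the
     difference is a multiple of [ttx], which is higher. *)
  pose g := x0 / u i1 0; pose c := (g * u i4 0 - x3) / y3.
  exists c; split=> //.
  have -> : tx + c *: ty = g *: u + ((x1 + c * y1 - g * u i2 0) / x0) *: ttx.
    have Eu : u = vec5 0 (u i1 0) (u i2 0) 0 (u i4 0) by rewrite {1}[u]vec5E Z0 Z3.
    rewrite {1}Eu Etx Ety Etty !vec5Z !vec5D /c /g.
    by congr vec5; field; rewrite ?Nx ?Ny ?Z1.
  apply: (chainD HC); first exact: (chainZ HC).
  by apply/(chainZ HC)/(chain_le HC (ltnW H12)).
have [e Ce] : exists e, C (H 4) (ty + e *: ttx).
  have [[Z0 Z3 Z1 Z4] Cz _ _] := HW 4; set u := (W 4).1 in Z0 Z3 Z1 Z4 Cz.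
  exists ((y3 / u i4 0 * u i2 0 - y1) / x0).
  have -> : ty + ((y3 / u i4 0 * u i2 0 - y1) / x0) *: ttx = (y3 / u i4 0) *: u.
    have Eu : u = vec5 0 0 (u i2 0) 0 (u i4 0) by rewrite {1}[u]vec5E Z0 Z3 Z1.
    rewrite {4}Eu Ety Etty !vec5Z !vec5D.
    by congr vec5; field; rewrite ?Nx ?Ny ?Z4.
  exact: (chainZ HC).
have c10 : c1 k 0 = 0 by []. have c20 : c2 k 0 = 0 by [].
have fin := fits5_adapted HC HB Hmax.
have kind0 x' y' : lead 0 x' -> lead 3 y' -> C (H 0%N) x' -> C (H 3) y' ->
    C (H 1%N) (tau5 k 0 *m x') -> C (H 2) (tau5 k 0 *m (tau5 k 0 *m x')) ->
    C (H 4) (tau5 k 0 *m y') ->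
    exists2 f, valid5 f & fits (tau5 k 0) C (tau5 k (kd5 f)) (h5o f).
  by move=> *; apply: (fin 0%N x' y'); rewrite ?c10 ?c20 ?scale0r ?addr0.
case: (leqP (H 1%N) (H 4)) => H14.
  have Ctx : C (H 1%N) tx.
    have -> : tx = tx + c *: ty - c *: (ty + e *: ttx) + (c * e) *: ttx.
      by rewrite scalerDr scalerA opprD addrA addrK subrK.
    apply: (chainD HC); last by apply/(chainZ HC)/(chain_le HC (ltnW H12)).
    by apply: (chainB HC) => //; apply/(chainZ HC)/(chain_le HC H14).
  case: (leqP (H 4) (H 2)) => H42.
    apply: (kind0 x y) => //.
    have -> : tau5 k 0 *m y = ty + e *: ttx - e *: ttx by rewrite addrK.
    by apply: (chainB HC) => //; apply/(chainZ HC)/(chain_le HC H42).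
  have [e0|en] := eqVneq e 0.
    by apply: (kind0 x y) => //; move: Ce; rewrite e0 scale0r addr0.
  case: (leqP (H 3) (H 1%N)) => H31.
    apply: (kind0 x (y + e *: tx)) => //.
    - by rewrite Ey Etx vec5Z vec5D /lead !mxE /= Ey0 !mulr0 !addr0.
    - by apply: (chainD HC) => //; apply/(chainZ HC)/(chain_le HC H31).
    - by rewrite mulmxDr -scalemxAr.
  apply: (fin 2 x (e^-1 *: y)) => //.
  - by rewrite Ey vec5Z /lead !mxE /= Ey0 mulr0 mulf_neq0 // invr_eq0.
  - exact: (chainZ HC).
  - by rewrite /c1 scale0r addr0.
  - rewrite /c2 scale1r -scalemxAr; have -> : e^-1 *: ty + ttx = e^-1 *: (ty + e *: ttx).
      by rewrite scalerDr scalerA mulVf // scale1r.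
    exact: (chainZ HC).
  - move=> _; split=> //; apply: (Hmax _ ttx) => //; first by rewrite Etty /lead !mxE.
    have -> : ttx = e^-1 *: ((ty + e *: ttx) - ty).
      by rewrite addrAC subrr add0r scalerA mulVf // scale1r.
    by apply/(chainZ HC)/(chainB HC) => //; apply: (chain_le HC) Ce.
have Cty : C (H 4) ty.
  have -> : ty = ty + e *: ttx - e *: ttx by rewrite addrK.
  apply: (chainB HC) => //; apply/(chainZ HC)/(chain_le HC _ C2).
  exact: ltnW (ltn_trans H14 H12).
have [c0|cn] := eqVneq c 0.
  by apply: (kind0 x y) => //; move: Cc; rewrite c0 scale0r addr0.
case: (leqP (H 0%N) (H 3)) => H03.
  apply: (kind0 (x + c *: y) y) => //.
  - by rewrite Ex Ey vec5Z vec5D /lead !mxE /= Ey0 mulr0 addr0.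
  - by apply: (chainD HC) => //; apply/(chainZ HC)/(chain_le HC H03).
  - by rewrite mulmxDr -scalemxAr.
  - rewrite mulmxDr -scalemxAr mulmxDr -scalemxAr -/ty Ety tau50_vec.
    by rewrite vec5Z !mulr0 -/tx -/ttx Etty vec5D !addr0 -Etty.
apply: (fin 1%N x (c *: y)) => //.
- by rewrite Ey vec5Z /lead !mxE /= Ey0 mulr0 mulf_neq0.
- exact: (chainZ HC).
- by rewrite /c1 scale1r -scalemxAr.
- by rewrite /c2 scale0r addr0 -scalemxAr; apply: (chainZ HC).
move=> _; split=> //; apply: (Hmax _ ty) => //; first by rewrite Ety /lead !mxE.
have -> : ty = c^-1 *: ((tx + c *: ty) - tx).
  by rewrite addrAC subrr add0r scalerA mulVf // scale1r.
by apply/(chainZ HC)/(chainB HC) => //; apply: (chain_le HC) Cc.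
Qed.

(** The images of the two generators determine [R]. The square of the operator kills the second
    generator, so the first coordinate of its image vanishes; the other columns follow by applying
    the operator and correcting for the extra entry of [tau5]. *)
Lemma comm5 (k : fieldType) kd kd' (R : 'M[k]_5) : R \in unitmx ->
  R *m tau5 k kd = tau5 k kd' *m R -> exists r0 r1 r2 r3 r4 s1 s2 s3 s4 p : k,
  [/\ r0 != 0, s3 != 0, R *m vec5 1 0 0 0 0 = vec5 r0 r1 r2 r3 r4 &
    R *m vec5 0 0 0 1 0 = vec5 0 s1 s2 s3 s4] /\
  [/\ R *m vec5 0 1 0 0 0 = vec5 0 r0 p 0 (r3 - c1 k kd' * r0 + c1 k kd * s3),
    R *m vec5 0 0 1 0 0 = vec5 0 0 r0 0 0 &
    R *m vec5 0 0 0 0 1 = vec5 0 0 (s1 - c2 k kd' * s3 + c2 k kd * r0) 0 s3].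
Proof.
move=> RU RT; have RT' y : R *m (tau5 k kd *m y) = tau5 k kd' *m (R *m y).
  by rewrite !mulmxA RT.
have [r0 [r1 [r2 [r3 [r4 Er]]]]] : exists r0 r1 r2 r3 r4, R *m vec5 1 0 0 0 0 = vec5 r0 r1 r2 r3 r4.
  by do 5!eexists; exact: vec5E.
have [s0 [s1 [s2 [s3 [s4 Es]]]]] : exists r0 r1 r2 r3 r4, R *m vec5 0 0 0 1 0 = vec5 r0 r1 r2 r3 r4.
  by do 5!eexists; exact: vec5E.
have tau2 kd0 (a0 a1 a2 b0 b1 : k) :
    tau5 k kd0 *m (tau5 k kd0 *m vec5 a0 a1 a2 b0 b1) = vec5 0 0 a0 0 0.
  by rewrite !tau5_vec !mulr0 !subr0.
have v0 : vec5 0 0 0 0 0 = 0 :> 'cV[k]_5 by rewrite [RHS]vec5E !mxE.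
have E2 : R *m vec5 0 0 1 0 0 = vec5 0 0 r0 0 0.
  by rewrite -(tau2 kd 1 0 0 0 0) !RT' Er tau2.
have s00 : s0 = 0.
  have : R *m 0 = vec5 0 0 s0 0 0 by rewrite -v0 -(tau2 kd 0 0 0 1 0) !RT' Es tau2.
  by rewrite mulmx0 -v0 => /vec5_inj[[_ _ <-]].
have E4 : R *m vec5 0 0 0 0 1 = vec5 0 0 (s1 - c2 k kd' * s3 + c2 k kd * r0) 0 s3.
  have -> : vec5 0 0 0 0 1 = tau5 k kd *m vec5 0 0 0 1 0 + c2 k kd *: vec5 0 0 1 0 0.
    by rewrite tau5_vec vec5Z vec5D !mulr0 !mulr1 !subr0 sub0r addNr !addr0.
  rewrite mulmxDr RT' Es -scalemxAr E2 tau5_vec vec5Z vec5D s00 !mulr0 !addr0.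
  by rewrite subr0.
have E1 : exists p, R *m vec5 0 1 0 0 0 = vec5 0 r0 p 0 (r3 - c1 k kd' * r0 + c1 k kd * s3).
  eexists; have -> : vec5 0 1 0 0 0 = tau5 k kd *m vec5 1 0 0 0 0 + c1 k kd *: vec5 0 0 0 0 1.
    by rewrite tau5_vec vec5Z vec5D !mulr0 !mulr1 !subr0 sub0r addNr !addr0.
  by rewrite mulmxDr RT' Er -scalemxAr E4 tau5_vec vec5Z vec5D !mulr0 !addr0.
have [p Ep] := E1.
have Nr : r0 != 0.
  apply/eqP => E; have : vec5 0 0 1 0 0 = 0 :> 'cV[k]_5.
    by rewrite -[LHS](mulKmx RU) E2 E v0 mulmx0.
  by rewrite -v0 => /vec5_inj[[_ _ /eqP]]; rewrite oner_eq0.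
have Ns : s3 != 0.
  apply/eqP => E; set g := s1 - _ + _ in E4.
  have : vec5 0 0 (- (g / r0)) 0 1 = 0 :> 'cV[k]_5.
    rewrite -[LHS](mulKmx RU).
    have -> : vec5 0 0 (- (g / r0)) 0 1 = vec5 0 0 0 0 1 - (g / r0) *: vec5 0 0 1 0 0 :> 'cV[k]_5.
      by rewrite -scaleNr vec5Z vec5D !mulr0 mulr1 !addr0 add0r.
    rewrite mulmxBr -scalemxAr E2 E4 E -scaleNr vec5Z vec5D !mulr0 !addr0 mulNr divfK // subrr.
    by rewrite v0 mulmx0.
  by rewrite -v0 => /vec5_inj[_ [_ /eqP]]; rewrite oner_eq0.
by exists r0, r1, r2, r3, r4, s1, s2, s3, s4, p; split; split; rewrite ?Es ?s00.
Qed.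

(** Heights separate the kinds: if [f'] has kind 1, then [h 3 < h 0] forces [r3 = 0], and a map from
    kind 0 would send the vector at [i1] to one with coordinate [- r0] at [i4], although
    [h 4 < h 1]. Kind 2 is analogous with [s1] and [s3]. *)
Lemma heights5_le (k : fieldType) f f' (R : 'M[k]_5) : R \in unitmx ->
  R *m tau5 k (kd5 f) = tau5 k (kd5 f') *m R ->
  (forall b y, graded (h5o f) b y -> graded (h5o f') b (R *m y)) ->
  (forall l : 'I_5, (h5o f l <= h5o f' l)%N) /\
  (valid5 f' -> (forall l : 'I_5, h5o f l = h5o f' l) -> kd5 f = 0%N -> kd5 f' = 0%N).
Proof.
move=> RU RT HR.
have [r0 [r1 [r2 [r3 [r4 [s1 [s2 [s3 [s4 [p [[Nr Ns E0 E3] [E1 E2 E4]]]]]]]]]]]] := comm5 RU RT.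
have HRl (l l' : 'I_5) : (R *m delta_mx l 0 : 'cV_5) l' 0 != 0 -> (h5o f l <= h5o f' l')%N.
  by apply: HR; apply: graded_delta.
have D0 : delta_mx i0 0 = vec5 1 0 0 0 0 :> 'cV[k]_5 by rewrite [LHS]vec5E !mxE.
have D1 : delta_mx i1 0 = vec5 0 1 0 0 0 :> 'cV[k]_5 by rewrite [LHS]vec5E !mxE.
have D2 : delta_mx i2 0 = vec5 0 0 1 0 0 :> 'cV[k]_5 by rewrite [LHS]vec5E !mxE.
have D3 : delta_mx i3 0 = vec5 0 0 0 1 0 :> 'cV[k]_5 by rewrite [LHS]vec5E !mxE.
have D4 : delta_mx i4 0 = vec5 0 0 0 0 1 :> 'cV[k]_5 by rewrite [LHS]vec5E !mxE.
split=> [|Vf' Eh Ek].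
  by apply: ord5P; apply: HRl; rewrite ?D0 ?D1 ?D2 ?D3 ?D4 ?E0 ?E1 ?E2 ?E3 ?E4 mxE.
have [_ _ _ K1 K2] := valid5P Vf'.
have c10 : c1 k (kd5 f) = 0 by rewrite Ek. have c20 : c2 k (kd5 f) = 0 by rewrite Ek.
have Hk : (kd5 f' < 3)%N by rewrite /kd5 ltn_ord.
case Ek' : (kd5 f') => [|[|[|n]]] //; last by rewrite Ek' in Hk.
  have [K13 _ K14] := K1 Ek'.
  have r30 : r3 = 0.
    apply/eqP/negPn/negP => Hr; have := HRl i0 i3; rewrite D0 E0 mxE => /(_ Hr).
    by rewrite Eh leqNgt K13.
  have := HRl i1 i4; rewrite D1 E1 mxE /= r30 c10 mul0r addr0 sub0r oppr_eq0 Ek' /c1 mul1r.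
  by move=> /(_ Nr); rewrite Eh leqNgt K14.
have [K21 _ K24] := K2 Ek'.
have s10 : s1 = 0.
  apply/eqP/negPn/negP => Hs; have := HRl i3 i1; rewrite D3 E3 mxE => /(_ Hs).
  by rewrite Eh leqNgt K21.
have := HRl i4 i2; rewrite D4 E4 mxE /= s10 c20 mul0r addr0 sub0r oppr_eq0 Ek' /c2 mul1r.
by move=> /(_ Ns); rewrite Eh leqNgt K24.
Qed.

Lemma uniq5 (k : fieldType) f f' (R : 'M[k]_5) : valid5 f -> valid5 f' -> R \in unitmx ->
  R *m tau5 k (kd5 f) = tau5 k (kd5 f') *m R ->
  (forall b y, graded (h5o f) b y <-> graded (h5o f') b (R *m y)) -> f = f'.
Proof.
move=> Vf Vf' RU RT HR.
have RT' : invmx R *m tau5 k (kd5 f') = tau5 k (kd5 f) *m invmx R.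
  by rewrite -[RHS](mulKmx RU) [R *m _]mulmxA RT mulmxK.
have RU' : invmx R \in unitmx by rewrite unitmx_inv.
have [L1 Z1] := heights5_le RU RT (fun b y => (HR b y).1).
have [|L2 Z2] := heights5_le RU' RT'.
  by move=> b y Hy; apply/HR; rewrite mulKVmx.
have Eh l : h5o f l = h5o f' l by apply/eqP; rewrite eqn_leq L1 L2.
have {Z1} := Z1 Vf' Eh; have {Z2} := Z2 Vf (fun l => esym (Eh l)) => Z2 Z1.
have [_ _ _ K1 K2] := valid5P Vf; have [_ _ _ K1' K2'] := valid5P Vf'.
have Ekd : kd5 f = kd5 f'.
  have [H0 H1 H2 H3 H4] : [/\ h5 f 0 = h5 f' 0, h5 f 1 = h5 f' 1, h5 f 2 = h5 f' 2,
     h5 f 3 = h5 f' 3 & h5 f 4 = h5 f' 4]%N.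
    by split; [apply: (Eh i0) | apply: (Eh i1) | apply: (Eh i2) | apply: (Eh i3) | apply: (Eh i4)].
  rewrite H0 H1 H2 H3 H4 in K1 K2.
  have : (kd5 f < 3)%N by rewrite /kd5 ltn_ord.
  have : (kd5 f' < 3)%N by rewrite /kd5 ltn_ord.
  move: Z1 Z2 K1 K2 K1' K2'; case: (kd5 f) (kd5 f') => [|[|[|//]]] [|[|[|//]]] //.
  - by move=> /(_ erefl).
  - by move=> /(_ erefl).
  - by move=> _ /(_ erefl).
  - by move=> _ _ /(_ erefl)[? ? ?] _ _ /(_ erefl)[? ? ?]; lia.
  - by move=> _ /(_ erefl).
  - by move=> _ _ _ /(_ erefl)[? ? ?] /(_ erefl)[? ? ?]; lia.
case: f f' Eh Ekd {Vf Vf' RT HR RT' L1 L2 Z1 Z2 K1 K2 K1' K2'} => t a [t' a'] Eh /val_inj Ea.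
congr pair => //; apply: eq_from_tnth => l; apply: val_inj.
have := Eh l; rewrite /h5o /h5 /= !(nth_map (tnth t l)) ?size_tuple //.
by rewrite -!tnth_nth.
Qed.

Definition coord5 (l : 'I_5) : nat * nat := if (l < 3)%N then (0%N, l : nat) else (1%N, (l - 3)%N).

Lemma coord5P l : ((coord5 l).2 < nth 0 mu (coord5 l).1)%N.
Proof. by move: l; apply: ord5P. Qed.

Definition pos5 (l : 'I_5) : 'I_(sumn mu) := bpos (coord5P l).

Lemma pos5_inj : injective pos5.
Proof.
move=> l l' /(congr1 val) /= E; have E1 := congr1 (blk mu) E; have E2 := congr1 (off mu) E.
move: E1 E2; rewrite !flatten_indexKl ?flatten_indexKr ?coord5P //.
by move: l l' {E}; apply: ord5P; apply: ord5P => //.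
Qed.

Lemma pos5J (k : fieldType) l l' : Jpart k mu (pos5 l) (pos5 l') = tau5 k 0 l l'.
Proof.
rewrite JpartE !blk_bpos !off_bpos mxE.
by move: l l'; apply: ord5P; apply: ord5P.
Qed.

End ThreeTwo.

Theorem finite_type_three_two (nu : seq nat) : finite_type [:: 3; 2] nu.
Proof.
have Hinj := pos5_inj; have Hcard : sumn [:: 3; 2] = 5 by [].
apply: (@classification_finite_type _ _ _ (heights5 nu) (@valid5 nu)
  (@h5o nu) (fun f => fun l l' : 'I_5 => nz5 (kd5 f) l l') (fun k => tau5 k 0) (fun k f => tau5 k (kd5 f))
  (fun k f => std5 k (kd5 f)) (fun k => reindex_mx k pos5)
  (fun k => (reindex_mx k pos5)^T%R)).
- by move=> k; exact: (reindexK k Hinj Hcard).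
- by move=> k; exact: (reindexVK k Hinj).
- by move=> k; apply: (reindexJ Hinj Hcard) => l l'; apply: pos5J.
- by move=> k f _; apply: std5_unit.
- by move=> k f _; apply: std5_tau.
- by move=> k f l l' _; apply: tau5E.
- exact: nz5_lt.
- exact: nz5_tight.
- by move=> k C HC CB; apply: fits5.
- by move=> k f f' R; apply: uniq5.
Qed.

(** * Partitions of size below 6, and the conclusion *)

Lemma partition_lt6 (mu : seq nat) : is_partition mu -> sumn mu < 6 ->
  [\/ exists m2 m1, mu = nseq m2 2 ++ nseq m1 1,
    exists r m1, 1 <= r /\ mu = r :: nseq m1 1 | mu = [:: 3; 2]].
Proof.
have ones b s : b <= 1 -> path geq b s -> all (fun x => 0 < x) s -> s = nseq (size s) 1.
  move=> Hb Hs Hp; apply/all_pred1P/allP => x Hx.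
  have geq_trans : transitive geq by move=> y1 y2 y3 H1 H2; apply: leq_trans H1.
  have := allP (order_path_min geq_trans Hs) _ Hx; have := allP Hp _ Hx => /= H0 H1.
  by rewrite eqn_leq H0 (leq_trans H1).
case: mu => [_ _|r s]; first by constructor 1; exists 0, 0.
case/andP => /= Hs /andP[Hr Hp] Hsum; case: s Hs Hp Hsum => [|b s] /=.
  by move=> _ _ _; constructor 2; exists r, 0.
case/andP=> Hbr Hs /andP[Hb Hp] Hsum; case: (leqP b 1) => Hb1.
  constructor 2; exists r, (size s).+1; split=> //=.
  by rewrite -(ones b s) //; congr [:: _, _ & _]; apply/eqP; rewrite eqn_leq Hb1.
(* Two parts of size at least 2 leave at most 1 of a total below 6. *)
have {ones Hs} Es : s = [::] \/ s = [:: 1].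
  case: s Hp Hsum {Hs} => [|c [|e s]] /=; first by left.
    by move=> Hc Hsum; right; congr [:: _]; lia.
  by case/and3P => Hc He _ Hsum; lia.
case: Es Hsum => -> /= Hsum.
  have -> : b = 2 by lia.
  have [->|->] : r = 2 \/ r = 3 by lia.
    by constructor 1; exists 2, 0.
  by constructor 3.
have -> : b = 2 by lia.
have -> : r = 2 by lia.
by constructor 1; exists 2, 1.
Qed.

Theorem mainTheorem8 (mu nu : seq nat) :
  is_partition mu -> is_partition nu ->
  ((exists m2 m1 : nat, mu = nseq m2 2 ++ nseq m1 1) \/
   (exists r m1 : nat, 1 <= r /\ mu = r :: nseq m1 1) \/
   mu = [:: 3; 2] \/
   sumn mu < 6) ->
  finite_type mu nu.
Proof.
have hook r m1 : 1 <= r -> finite_type (r :: nseq m1 1) nu.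
  (* For [r = 1] all parts are 1, which is the square-zero case without blocks of size 2;
     [finite_type_hook] assumes [1 < r]. *)
  case: r => [//|[|r]] _; last exact: finite_type_hook.
  exact: (finite_type_square_zero 0 m1.+1).
move=> Hmu _ [[m2 [m1 ->]]|[[r [m1 [Hr ->]]]|[->|Hlt]]].
- exact: finite_type_square_zero.
- exact: hook.
- exact: finite_type_three_two.
case: (partition_lt6 Hmu Hlt) => [[m2 [m1 ->]]|[r [m1 [Hr ->]]]|->].
- exact: finite_type_square_zero.
- exact: hook.
- exact: finite_type_three_two.
Qed.
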